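(* Let $X$ be a compact Kähler manifold with $K_X$ nef which contains a possibly singular rational curve $C\subset X$ (i.e. $C$ is the birational image of a nonconstant holomorphic map $f:\mathbb{CP}^1\to X$) such that $\int_C c_1(X)=0$. Then any solution $\omega(t)$ of the unnormalized Kähler–Ricci flow $$\frac{\partial}{\partial t}\omega=-\mathrm{Ric}(\omega),\qquad \omega(0)=\omega_X,$$ on $X$ ($\omega_X$ any Kähler metric on $X$) must be of type IIb.
   Context: If $K_X$ is nef, every solution of the unnormalized Kähler–Ricci flow on $X$ exists for all $t\ge 0$. Such a long-time solution is called of type IIb if $$\sup_{X\times[0,\infty)} t\,|\mathrm{Rm}(\omega(t))|_{\omega(t)}=+\infty,$$ where $\mathrm{Rm}$ is the Riemann curvature tensor. *)

(* Defs.v *)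
From HB Require Import structures.
From mathcomp Require Import all_boot all_order all_algebra.
From mathcomp Require Import all_classical all_reals all_analysis.
From mathcomp Require Import complex.

Set Implicit Arguments.
Unset Strict Implicit.
Unset Printing Implicit Defensive.
Import Order.TTheory GRing.Theory Num.Theory.
Import numFieldNormedType.Exports.
Local Open Scope classical_set_scope.
Local Open Scope ring_scope.

(* [R[i]] has no topology of its own in the library; seen as an abstract
   [numClosedFieldType] it inherits the one given by its norm, so that
   [differentiable], [derive1] and [jacobian] below are complex ones. *)
Definition Cplx (R : realType) : numClosedFieldType := R[i].

Definition toC {R : realType} (x : R) : Cplx R := (x%:C)%C.

Definition reC {R : realType} (z : Cplx R) : R := complex.Re z.

Definition conj_mx {R : realType} {m n : nat} (A : 'M[Cplx R]_(m, n)) :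
  'M[Cplx R]_(m, n) := map_mx Num.conj A.

(* For the (1,1)-form i A_(a b) dz^a /\ dzbar^b this is
   A_(a b) v^a (v^b)^*; inequalities between complex numbers entail that
   the difference is real. *)
Definition herm_form {R : realType} {n : nat} (A : 'M[Cplx R]_n)
  (v : 'rV[Cplx R]_n) : Cplx R := (v *m A *m (conj_mx v)^T) 0 0.

Section Calculus.
Context {R : realType} {n : nat}.
Local Notation C := (Cplx R).
Local Notation Cn := 'rV[C]_n.

(* Derivative along the real line spanned by v, not assuming that F is
   complex differentiable. *)
Definition rquot (v : Cn) (F : Cn -> C) (z : Cn) (h : R) : C :=
  toC h^-1 * (F (z + toC h *: v) - F z).

Definition rderivable (v : Cn) (F : Cn -> C) (z : Cn) : Prop :=
  cvg (rquot v F z h @[h --> (0 : R)^']).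

Definition rderive (v : Cn) (F : Cn -> C) (z : Cn) : C :=
  lim (rquot v F z h @[h --> (0 : R)^']).

Fixpoint Ck (k : nat) (V : set Cn) (F : Cn -> C) : Prop :=
  (forall z, V z -> {for z, continuous F}) /\
  if k is k'.+1 then
    forall v, (forall z, V z -> rderivable v F z) /\ Ck k' V (rderive v F)
  else True.

Definition smooth_on (V : set Cn) (F : Cn -> C) : Prop := forall k, Ck k V F.

(* The time derivative on [0, +oo[ is one-sided at 0. *)
Definition tquot (f : R -> C) (t s : R) : C := toC (s - t)^-1 * (f s - f t).

Definition tderivable (f : R -> C) (t : R) : Prop :=
  cvg (tquot f t s @[s --> within [set s | 0 <= s] t^']).

Definition tderive (f : R -> C) (t : R) : C :=
  lim (tquot f t s @[s --> within [set s | 0 <= s] t^']).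

Fixpoint Ck_time (k : nat) (V : set Cn) (F : R -> Cn -> C) : Prop :=
  {within [set p : R * Cn | 0 <= p.1 /\ V p.2],
     continuous (fun p : R * Cn => F p.1 p.2)} /\
  if k is k'.+1 then
    (forall v, (forall t z, 0 <= t -> V z -> rderivable v (F t) z) /\
               Ck_time k' V (fun t => rderive v (F t))) /\
    (forall t z, 0 <= t -> V z -> tderivable (F ^~ z) t) /\
    Ck_time k' V (fun t z => tderive (F ^~ z) t)
  else True.

(* smooth on [0, +oo[ x V, up to the boundary t = 0 *)
Definition smooth_time_on (V : set Cn) (F : R -> Cn -> C) : Prop :=
  forall k, Ck_time k V F.

Definition dz (a : 'I_n) (F : Cn -> C) (z : Cn) : C :=
  2^-1 * (rderive (delta_mx 0 a) F z - 'i * rderive ('i *: delta_mx 0 a) F z).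

Definition dzbar (a : 'I_n) (F : Cn -> C) (z : Cn) : C :=
  2^-1 * (rderive (delta_mx 0 a) F z + 'i * rderive ('i *: delta_mx 0 a) F z).

(* The coefficients of the real (1,1)-form - i d dbar log h. *)
Definition minus_ddbar_log (h : Cn -> R) (z : Cn) : 'M[C]_n :=
  \matrix_(a, b) - dz a (dzbar b (fun w => toC (ln (h w)))) z.

(* Below G w a b stands for g_(a bbar), in omega = i g_(a bbar) dz^a /\ dzbar^b;
   the inverse metric is g^(p qbar) = invmx (G w) q p. *)
Definition ricci (G : Cn -> 'M[C]_n) : Cn -> 'M[C]_n :=
  minus_ddbar_log (fun w => reC (\det (G w))).

(* R_(a bbar c dbar) = - d_c d_dbar g_(a bbar)
     + g^(p qbar) (d_c g_(a qbar)) (d_dbar g_(p bbar)) *)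
Definition riemann (G : Cn -> 'M[C]_n) (z : Cn) (a b c d : 'I_n) : C :=
  - dz c (dzbar d (fun w => G w a b)) z
  + \sum_(p < n) \sum_(q < n)
      invmx (G z) q p * dz c (fun w => G w a q) z * dzbar d (fun w => G w p b) z.

(* |Rm|^2 = g^(a ebar) g^(f bbar) g^(c kbar) g^(l dbar)
              R_(a bbar c dbar) (R_(e fbar k lbar))^* ;
   the norm of the underlying Riemannian curvature tensor is a universal
   constant times this. *)
Definition riemann_norm (G : Cn -> 'M[C]_n) (z : Cn) : R :=
  let ginv p q := invmx (G z) q p in
  Num.sqrt (reC (
    \sum_(a < n) \sum_(b < n) \sum_(c < n) \sum_(d < n)
    \sum_(e < n) \sum_(f < n) \sum_(k < n) \sum_(l < n)
      ginv a e * ginv f b * ginv c k * ginv l d *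
      riemann G z a b c d * Num.conj (riemann G z e f k l))).

End Calculus.

(* Charts are total functions of which only the restrictions to [cdom i] and
   to its image matter. *)
Record complex_manifold (R : realType) (n : nat) (X : topologicalType) :=
  ComplexManifold {
  cindex : Type;
  cdom : cindex -> set X;
  chart : cindex -> X -> 'rV[Cplx R]_n;
  chart_inv : cindex -> 'rV[Cplx R]_n -> X;
  chart_at : X -> cindex;
  manifold_hausdorff : hausdorff_space X;
  cdom_open : forall i, open (cdom i);
  cimage_open : forall i, open (chart i @` cdom i);
  chartK : forall i x, cdom i x -> chart_inv i (chart i x) = x;
  chart_continuous : forall i x, cdom i x -> {for x, continuous (chart i)};
  chart_inv_continuous : forall i z, (chart i @` cdom i) z ->
    {for z, continuous (chart_inv i)};
  cdom_chart_at : forall x, cdom (chart_at x) x;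
  transition_holomorphic : forall i j z, (chart i @` (cdom i `&` cdom j)) z ->
    differentiable (chart j \o chart_inv i) z }.

Section Kahler.
Context {R : realType} {n : nat} {X : topologicalType}.
Local Notation C := (Cplx R).
Local Notation Cn := 'rV[C]_n.
Variable M : complex_manifold R n X.
Local Notation I := (cindex M).

Definition cimage (i : I) : set Cn := chart i @` cdom i.

Definition coverlap (i j : I) : set Cn := chart i @` (cdom i `&` cdom j).

Definition transition (i j : I) : Cn -> Cn := chart j \o chart_inv i.

(* A family of local coefficients, one matrix function per chart. [jacobian]
   acts on row vectors: its (a, b) entry is the a-th partial derivative of the
   b-th component. *)
Definition kahler_metric (g : I -> Cn -> 'M[C]_n) : Prop :=
  [/\ forall i a b, smooth_on (cimage i) (fun z => g i z a b),
      forall i z, cimage i z -> (conj_mx (g i z))^T = g i z,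
      forall i z v, cimage i z -> v != 0 -> 0 < herm_form (g i z) v,
      forall i j z, coverlap i j z ->
        let J := jacobian (transition i j) z in
        g i z = J *m g j (transition i j z) *m (conj_mx J)^T &
      forall i z, cimage i z -> forall a b c,
        dz c (fun w => g i w a b) z = dz a (fun w => g i w c b) z].

(* A line bundle with local frames s_i over the charts is given by functions
   with s_i = e i j * s_j at the point of coordinate z in the i-th chart. *)
Definition canonical_bundle (i j : I) (z : Cn) : C :=
  (\det (jacobian (transition i j) z))^-1.

Definition anticanonical_bundle (i j : I) (z : Cn) : C :=
  \det (jacobian (transition i j) z).

(* h i is the squared norm of the frame s_i. *)
Definition hermitian_metric (e : I -> I -> Cn -> C) (h : I -> Cn -> R) : Prop :=
  [/\ forall i, smooth_on (cimage i) (fun z => toC (h i z)),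
      forall i z, cimage i z -> 0 < h i z &
      forall i j z, coverlap i j z ->
        toC (h i z) = `|e i j z| ^+ 2 * toC (h j (transition i j z))].

Definition chern_form (h : I -> Cn -> R) (i : I) : Cn -> 'M[C]_n :=
  minus_ddbar_log (h i).

(* X being compact, the choice of the reference metric g is immaterial. *)
Definition nef (g : I -> Cn -> 'M[C]_n) (e : I -> I -> Cn -> C) : Prop :=
  forall eps : R, 0 < eps ->
  exists2 h : I -> Cn -> R, hermitian_metric e h &
    forall i z v, cimage i z ->
      - toC eps * herm_form (g i z) v <= herm_form (chern_form h i z) v.

(* The Riemann sphere is [option C], [None] being the point at infinity; it is
   covered by the two affine charts below. *)
Definition CP1 : Type := option C.

Definition affine0 (z : C) : CP1 := Some z.

Definition affine1 (w : C) : CP1 := if w == 0 then None else Some w^-1.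

Definition holomorphic_curve (u : C -> X) : Prop :=
  continuous u /\
  forall (i : I) z, cdom i (u z) -> differentiable (chart i \o u) z.

Definition velocity (u : C -> X) (z : C) : Cn :=
  derive1 (chart (chart_at M (u z)) \o u) z.

Definition holomorphic_CP1 (f : CP1 -> X) : Prop :=
  holomorphic_curve (f \o affine0) /\ holomorphic_curve (f \o affine1).

(* Away from finite sets, f is a biholomorphism onto its image: it is injective
   and immersive, hence (being proper onto its image) a closed embedding. *)
Definition birational_onto_image (f : CP1 -> X) : Prop :=
  exists T : set X,
  [/\ finite_set T, finite_set (f @^-1` T),
      forall p q, ~ T (f p) -> f p = f q -> p = q &
      forall z, (~ T (f (affine0 z)) -> velocity (f \o affine0) z != 0) /\
                (~ T (f (affine1 z)) -> velocity (f \o affine1) z != 0)].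

Definition rational_curve (f : CP1 -> X) (S : set X) : Prop :=
  [/\ holomorphic_CP1 f, exists p q, f p <> f q, birational_onto_image f &
      S = range f].

(* The integral over CP1 of the pull-back of i A_(a b) dz^a /\ dzbar^b, computed
   in the affine chart, whose complement is a point; there
   i dz /\ dzbar = 2 dx dy. *)
Definition pullback_integral (f : CP1 -> X) (A : I -> Cn -> 'M[C]_n) : R :=
  Rintegral (lebesgue_measure \x lebesgue_measure)%E [set: R * R]
    (fun p : R * R =>
       let z : C := (p.1 +i* p.2)%C in
       let u := f \o affine0 in
       let i := chart_at M (u z) in
       2 * reC (herm_form (A i (chart i (u z))) (velocity u z))).

(* c_1(X) = c_1(K_X^-1) is represented by the Chern form, divided by 2 pi, of
   any hermitian metric on K_X^-1; the integral does not depend on it. *)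
Definition c1_integral_is (f : CP1 -> X) (r : R) : Prop :=
  exists2 h : I -> Cn -> R, hermitian_metric anticanonical_bundle h &
    r = (2 * pi)^-1 * pullback_integral f (chern_form h).

Definition kahler_ricci_flow (gX : I -> Cn -> 'M[C]_n)
    (g : R -> I -> Cn -> 'M[C]_n) : Prop :=
  [/\ forall t, 0 <= t -> kahler_metric (g t),
      forall i a b, smooth_time_on (cimage i) (fun t z => g t i z a b),
      forall t i z a b, 0 <= t -> cimage i z ->
        tderive (fun s => g s i z a b) t = - ricci (g t i) z a b &
      forall i z, cimage i z -> g 0 i z = gX i z].

Definition type_IIb (g : R -> I -> Cn -> 'M[C]_n) : Prop :=
  ereal_sup [set y : \bar R | exists t x, 0 <= t /\
    y = (t * riemann_norm (g t (chart_at M x)) (chart (chart_at M x) x))%:E]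
  = +oo%E.

End Kahler.

(* Main.v *)
From HB Require Import structures.
Require Import Defs.
From mathcomp Require Import all_boot all_order all_algebra.
From mathcomp Require Import all_classical all_reals all_analysis.
From mathcomp Require Import complex measurable_realfun.
From mathcomp Require Import ring lra.

Set Implicit Arguments.
Unset Strict Implicit.
Unset Printing Implicit Defensive.
Import Order.TTheory GRing.Theory Num.Theory.
Import numFieldNormedType.Exports.
Local Open Scope classical_set_scope.
Local Open Scope ring_scope.

(** Suppose that the flow is not of type IIb, that is, t |Rm| <= K for all t.
    Read the rational curve in an affine chart of the sphere as u : C -> X, let
    E be the energy density |u'|^2 of u for the metric g_t, and let A (t) be the
    integral of E over the plane, half the area of the curve.

    The area is constant for t > 0. The flow equation says that the derivative of
    E in time is - Ric (u', u'). If h is a metric on the anticanonical bundle, the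
    forms Ric (g_t) and chern_form h are both curvatures of metrics on that
    bundle, hence differ by d dbar of the function log (h / det g_t) on X
    (potential_ddbar). By Stokes' theorem on the sphere
    (sphere_ddbar_integral) the integrals of both along the curve agree, and the
    second one vanishes since the first Chern class is trivial on the curve.

    The curvature bound keeps (K / t) A (t) away from 0. If D is the covariant
    derivative of u' then E_z = <D, u'> and E_{z zbar} = |D|^2 - Rm (u', u', u', u'),
    so that d dbar log E >= - (K / t) E wherever u' does not vanish
    (energy_bochner). The function e = E (1 + |z|^2)^2, the squared norm of the
    differential for the Fubini-Study metric, extends to the whole sphere, and
    d dbar log e >= 2 (1 + |z|^2)^-2 - (K / t) E. Since e may vanish, replace
    log e by log (e + d) with d > 0; the estimate becomes
    d dbar log (e + d) >= 2 E / (e + d) - (K / t) E (dbar_log_ge). The integral of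
    the left-hand side over the sphere vanishes, so that
    the integral of 2 E / (e + d) is at most (K / t) A (t)
    (quotient_integral_le). Fix a square on which u' does not vanish, which is
    possible since the curve is birational onto its image, and take for d the
    minimum of e on it: on that square 2 E / (e + d) >= (1 + |z|^2)^-2, which
    gives a lower bound c > 0 for (K / t) A (t) that depends on neither t nor g_t
    (curvature_area_lower_bound). With A constant, letting t tend to infinity is
    a contradiction.

    Two analytic tools carry this. A holomorphic curve is only assumed to be complex differentiable at each point, whereas E involves its
    derivative and must be differentiated twice; hence the part on Goursat's
    lemma and Cauchy's formula, which ends with hol_derivative_hol. Stokes'
    theorem on the sphere is the divergence theorem on the squares [-L, L]^2, for
    (0,1)-forms that are O(|z|^-2) because they are smooth in the other affine
    chart. *)

(** * Complex numbers and their topology *)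

Section ComplexNumbers.
Context {R : realType}.
Local Notation C := (Cplx R).
Implicit Types (z w : C) (x y : R).

Definition imC z : R := complex.Im z.

(** The modulus as a real number: the norm of [Cplx R] takes values in [Cplx R]. *)
Definition cabs z : R := Normc.normc z.

Lemma toC_is_additive : additive (@toC R).
Proof. by move=> x y; rewrite /toC; apply: rmorphB. Qed.
Lemma toC_is_multiplicative : multiplicative (@toC R).
Proof. by split=> [x y|] //; rewrite /toC; apply: rmorphM. Qed.
HB.instance Definition _ := GRing.isAdditive.Build R C (@toC R) toC_is_additive.
HB.instance Definition _ :=
  GRing.isMultiplicative.Build R C (@toC R) toC_is_multiplicative.

Lemma reC_is_additive : additive (@reC R).
Proof. by move=> [a b] [c d]. Qed.
HB.instance Definition _ := GRing.isAdditive.Build C R (@reC R) reC_is_additive.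
Lemma imC_is_additive : additive imC.
Proof. by move=> [a b] [c d]. Qed.
HB.instance Definition _ := GRing.isAdditive.Build C R imC imC_is_additive.

Lemma reC_toC x : reC (toC x) = x. Proof. by []. Qed.
Lemma imC_toC x : imC (toC x) = 0. Proof. by []. Qed.
Lemma toC_inj : injective (@toC R). Proof. by move=> x y []. Qed.

Lemma imunitE : ('i : C) = (0 +i* 1)%C.
Proof. by rewrite -complexiE. Qed.

Lemma reCi : reC ('i : C) = 0. Proof. by rewrite imunitE. Qed.
Lemma imCi : imC ('i : C) = 1. Proof. by rewrite imunitE. Qed.

Lemma reCM z w : reC (z * w) = reC z * reC w - imC z * imC w.
Proof. by case: z w => [a b] [c d]. Qed.
Lemma imCM z w : imC (z * w) = reC z * imC w + imC z * reC w.
Proof. by case: z w => [a b] [c d]. Qed.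

Lemma Cext z w : reC z = reC w -> imC z = imC w -> z = w.
Proof. by case: z w => [a b] [c d] /= -> ->. Qed.

Lemma CsplitE z : z = toC (reC z) + 'i * toC (imC z).
Proof.
by apply: Cext; rewrite raddfD ?reCM ?imCM /= ?reC_toC ?imC_toC ?reCi ?imCi; ring.
Qed.

Lemma reC_conj z : reC (Num.conj z) = reC z.
Proof. by case: z. Qed.
Lemma imC_conj z : imC (Num.conj z) = - imC z.
Proof. by case: z. Qed.
Lemma conj_toC x : Num.conj (toC x) = toC x.
Proof. by apply: Cext; rewrite ?reC_conj ?imC_conj ?imC_toC ?oppr0. Qed.

Lemma reCD z w : reC (z + w) = reC z + reC w. Proof. exact: raddfD. Qed.
Lemma reCB z w : reC (z - w) = reC z - reC w. Proof. exact: raddfB. Qed.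
Lemma reCN z : reC (- z) = - reC z. Proof. exact: raddfN. Qed.
Lemma imCD z w : imC (z + w) = imC z + imC w. Proof. exact: raddfD. Qed.
Lemma imCB z w : imC (z - w) = imC z - imC w. Proof. exact: raddfB. Qed.
Lemma toCD x y : toC (x + y) = toC x + toC y :> C. Proof. exact: rmorphD. Qed.
Lemma toCB x y : toC (x - y) = toC x - toC y :> C. Proof. exact: rmorphB. Qed.
Lemma toCN x : toC (- x) = - toC x :> C. Proof. exact: rmorphN. Qed.
Lemma toCM x y : toC (x * y) = toC x * toC y :> C. Proof. exact: rmorphM. Qed.
Lemma toCX x k : toC (x ^+ k) = toC x ^+ k :> C. Proof. exact: rmorphXn. Qed.
Lemma toCV x : toC x^-1 = (toC x)^-1 :> C. Proof. exact: fmorphV. Qed.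
Lemma toC0 : toC 0 = 0 :> C. Proof. exact: rmorph0. Qed.
Lemma toC1 : toC 1 = 1 :> C. Proof. exact: rmorph1. Qed.
Lemma toC_nat k : toC k%:R = k%:R :> C. Proof. exact: rmorph_nat. Qed.
Lemma reCZ x z : reC (toC x * z) = x * reC z.
Proof. by rewrite reCM reC_toC imC_toC mul0r subr0. Qed.
Lemma conjD z w : Num.conj (z + w) = Num.conj z + Num.conj w.
Proof. exact: rmorphD. Qed.
Lemma conjB z w : Num.conj (z - w) = Num.conj z - Num.conj w.
Proof. exact: rmorphB. Qed.
Lemma conjM z w : Num.conj (z * w) = Num.conj z * Num.conj w.
Proof. exact: rmorphM. Qed.
Lemma conj0 : Num.conj (0 : C) = 0.
Proof. exact: rmorph0. Qed.
Lemma conj1 : Num.conj (1 : C) = 1.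
Proof. exact: rmorph1. Qed.
Lemma conjV z : Num.conj z^-1 = (Num.conj z)^-1.
Proof. exact: fmorphV. Qed.
Lemma conj_sum (I : Type) (r : seq I) (P : pred I) (F : I -> C) :
  Num.conj (\sum_(i <- r | P i) F i) = \sum_(i <- r | P i) Num.conj (F i).
Proof. exact: rmorph_sum. Qed.

Lemma cabsE z : `|z| = toC (cabs z).
Proof. by []. Qed.
Lemma cabs_sqrt z : cabs z = Num.sqrt (reC z ^+ 2 + imC z ^+ 2).
Proof. by case: z. Qed.
Lemma sqr_cabs z : cabs z ^+ 2 = reC z ^+ 2 + imC z ^+ 2.
Proof. by rewrite cabs_sqrt sqr_sqrtr // addr_ge0 ?sqr_ge0. Qed.
Lemma cabs_ge0 z : 0 <= cabs z.
Proof. by rewrite cabs_sqrt sqrtr_ge0. Qed.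
Lemma cabs0 : cabs 0 = 0. Proof. exact: Normc.normc0. Qed.
Lemma cabs1 : cabs 1 = 1. Proof. exact: Normc.normc1. Qed.
Lemma cabsM z w : cabs (z * w) = cabs z * cabs w.
Proof. exact: Normc.normcM. Qed.
Lemma cabsV z : cabs z^-1 = (cabs z)^-1.
Proof. exact: Normc.normcV. Qed.
Lemma cabsX z k : cabs (z ^+ k) = cabs z ^+ k.
Proof. by elim: k => [|k IH]; rewrite ?expr0 ?cabs1 // !exprS cabsM IH. Qed.
Lemma cabsN z : cabs (- z) = cabs z.
Proof. exact: complex.normcN. Qed.
Lemma cabsD z w : cabs (z + w) <= cabs z + cabs w.
Proof. exact: complex.le_normcD. Qed.
Lemma cabsB z w : cabs (z - w) <= cabs z + cabs w.
Proof. by rewrite -(cabsN w); apply: cabsD. Qed.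
Lemma cabsBC z w : cabs (z - w) = cabs (w - z).
Proof. by rewrite -cabsN opprB. Qed.
Lemma cabs_lB z w : cabs z - cabs w <= cabs (z - w).
Proof. by have := cabsD (z - w) w; rewrite subrK; lra. Qed.
Lemma cabs_eq0 z : (cabs z == 0) = (z == 0).
Proof.
by apply/eqP/eqP => [/Normc.eq0_normc|->]; rewrite ?cabs0.
Qed.
Lemma cabs_gt0 z : (0 < cabs z) = (z != 0).
Proof. by rewrite lt_neqAle cabs_ge0 andbT eq_sym cabs_eq0. Qed.
Lemma cabs_toC x : cabs (toC x) = `|x|.
Proof. by rewrite cabs_sqrt reC_toC imC_toC expr0n addr0 sqrtr_sqr. Qed.
Lemma cabs_conj z : cabs (Num.conj z) = cabs z.
Proof. by rewrite !cabs_sqrt reC_conj imC_conj sqrrN. Qed.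
Lemma cabsi : cabs ('i : C) = 1.
Proof. by rewrite cabs_sqrt reCi imCi expr0n expr1n add0r sqrtr1. Qed.
Lemma reC_le_cabs z : `|reC z| <= cabs z.
Proof.
rewrite -(@ler_pXn2r _ 2) ?nnegrE ?cabs_ge0 // sqr_cabs real_normK ?num_real //.
by rewrite lerDl sqr_ge0.
Qed.
Lemma imC_le_cabs z : `|imC z| <= cabs z.
Proof.
rewrite -(@ler_pXn2r _ 2) ?nnegrE ?cabs_ge0 // sqr_cabs real_normK ?num_real //.
by rewrite lerDr sqr_ge0.
Qed.
Lemma cabs_le_reim z : cabs z <= `|reC z| + `|imC z|.
Proof.
rewrite {1}(CsplitE z); apply: (le_trans (cabsD _ _)).
by rewrite cabsM cabsi mul1r !cabs_toC.
Qed.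
Lemma mulconjE z : z * Num.conj z = toC (cabs z ^+ 2).
Proof.
rewrite sqr_cabs; apply: Cext; rewrite ?reCM ?imCM reC_conj imC_conj /=; ring.
Qed.

Lemma cabs_sum (I : Type) (r : seq I) (P : pred I) (F : I -> C) :
  cabs (\sum_(i <- r | P i) F i) <= \sum_(i <- r | P i) cabs (F i).
Proof.
elim/big_ind2: _ => [|a b c d ab cd|//]; first by rewrite cabs0.
by apply: (le_trans (cabsD _ _)); apply: lerD.
Qed.

Lemma gt0C z : 0 < z -> 0 < reC z /\ imC z = 0.
Proof. by rewrite ltcE /= => /andP[/eqP h1 h2]; split. Qed.
Lemma toC_gt0 x : (0 < toC x) = (0 < x).
Proof. exact: (@ltcR _ 0 x). Qed.
Lemma toC_eq0 x : (toC x == 0) = (x == 0).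
Proof. by apply/eqP/eqP => [/(congr1 (@reC R))//|->]; rewrite raddf0. Qed.

Lemma nbhsCP z (A : set C) :
  nbhs z A <-> exists2 e : R, 0 < e & forall w, cabs (w - z) < e -> A w.
Proof.
split.
  case/nbhs_ballP => e /= e0 eA; have [e0' ime] := gt0C e0.
  exists (reC e) => // w wz; apply: eA; rewrite /ball /= cabsE cabsBC in wz *.
  have -> : e = toC (reC e) by apply: Cext.
  by rewrite -subr_gt0 -raddfB /= toC_gt0 subr_gt0.
case=> e e0 eA; apply/nbhs_ballP; exists (toC e) => /=; first by rewrite toC_gt0.
move=> w; rewrite /ball /= cabsE cabsBC -subr_gt0 -raddfB /= toC_gt0 subr_gt0.
exact: eA.
Qed.

Lemma openCP (U : set C) : open U <->
  forall z, U z -> exists2 e : R, 0 < e & forall w, cabs (w - z) < e -> U w.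
Proof.
rewrite openE; split=> H z Uz.
  by have /nbhsCP := H _ Uz.
by apply/nbhsCP; exact: H.
Qed.

Lemma cvgCP (T : Type) (F : set_system T) (f : T -> C) l : Filter F ->
  f @ F --> l <-> forall e : R, 0 < e -> \forall x \near F, cabs (f x - l) < e.
Proof.
move=> FF; split=> [H e e0|H].
  by apply: (H [set w | cabs (w - l) < e]); apply/nbhsCP; exists e.
by move=> A /nbhsCP[e e0 eA]; apply: filterS (H _ e0) => x; exact: eA.
Qed.

Lemma reC_continuous : continuous (@reC R).
Proof.
move=> z; apply/(@cvgrPdist_lt _ _ _ (nbhs z)) => e e0; apply/nbhsCP; exists e => // w wz.
rewrite -raddfB /=; apply: le_lt_trans (reC_le_cabs _) _.
by rewrite cabsBC.
Qed.
Lemma imC_continuous : continuous imC.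
Proof.
move=> z; apply/(@cvgrPdist_lt _ _ _ (nbhs z)) => e e0; apply/nbhsCP; exists e => // w wz.
rewrite -raddfB /=; apply: le_lt_trans (imC_le_cabs _) _.
by rewrite cabsBC.
Qed.
Lemma toC_continuous : continuous (@toC R).
Proof.
move=> x; apply/cvgCP => e e0; near=> y.
have -> : toC y - toC x = toC (y - x) by rewrite raddfB.
rewrite cabs_toC distrC.
by near: y; apply: cvgr_dist_lt.
Unshelve. all: by end_near. Qed.
Lemma cabs_continuous : continuous cabs.
Proof.
move=> z; apply/(@cvgrPdist_lt _ _ _ (nbhs z)) => e e0; apply/nbhsCP; exists e => // w wz.
rewrite ltr_norml; have := cabs_lB w z; have := cabs_lB z w.
by rewrite (cabsBC z w); move: wz; lra.
Qed.

Section Continuity.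
Context {T : topologicalType}.
Implicit Types (f g : T -> C) (t : T).

Lemma for_cst t (k : C) : {for t, continuous (fun _ : T => k)}.
Proof. exact: cvg_cst. Qed.
Lemma forD t f g : {for t, continuous f} -> {for t, continuous g} ->
  {for t, continuous (fun s => f s + g s)}.
Proof. exact: cvgD. Qed.
Lemma forN t f : {for t, continuous f} -> {for t, continuous (fun s => - f s)}.
Proof. exact: cvgN. Qed.
Lemma forB t f g : {for t, continuous f} -> {for t, continuous g} ->
  {for t, continuous (fun s => f s - g s)}.
Proof. exact: cvgB. Qed.
Lemma forM t f g : {for t, continuous f} -> {for t, continuous g} ->
  {for t, continuous (fun s => f s * g s)}.
Proof. exact: cvgM. Qed.
Lemma forV t f : f t != 0 -> {for t, continuous f} ->
  {for t, continuous (fun s => (f s)^-1)}.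
Proof. by move=> f0 cf; apply: cvgV. Qed.
Lemma for_conj t f : {for t, continuous f} -> {for t, continuous (fun s => Num.conj (f s))}.
Proof.
move=> /cvgCP cf; apply/cvgCP => e /cf; apply: filterS => s.
by rewrite -conjB cabs_conj.
Qed.
Lemma for_sum t (I : Type) (r : seq I) (F : I -> T -> C) :
  (forall i, {for t, continuous (F i)}) ->
  {for t, continuous (fun s => \sum_(i <- r) F i s)}.
Proof.
move=> H; elim: r => [|i r IH].
  have -> : (fun s => \sum_(i <- [::]) F i s) = (fun=> 0).
    by apply/funext => s; rewrite big_nil.
  exact: for_cst.
have -> : (fun s => \sum_(j <- i :: r) F j s) = (fun s => F i s + \sum_(j <- r) F j s).
  by apply/funext => s; rewrite big_cons.
exact: forD (H i) IH.
Qed.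

Lemma near_eq_continuous (f1 f2 : T -> C) (x : T) :
  (\forall y \near x, f1 y = f2 y) -> {for x, continuous f1} -> {for x, continuous f2}.
Proof.
move=> N c; rewrite /prop_for /continuous_at -(nbhs_singleton N).
by apply: cvg_trans c; exact: near_eq_cvg N.
Qed.

End Continuity.

End ComplexNumbers.

(** * Real differentiability of complex-valued functions *)

Section Frechet.
Context {R : realType}.
Local Notation C := (Cplx R).

Section Rules.
Context (V : zmodType) (sz : V -> R).
Hypothesis sz_ge0 : forall h, 0 <= sz h.
Implicit Types (phi psi : V -> C) (L K : V -> C) (z h : V).

(** Differentiability on R and on C at once: sz is the absolute value of the source. *)
Definition frechet phi z L : Prop :=
  (exists M, forall h, cabs (L h) <= M * sz h) /\
  forall e : R, 0 < e -> exists2 d : R, 0 < d & forall h, sz h < d ->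
    cabs (phi (z + h) - phi z - L h) <= e * sz h.

Lemma frechet_ext phi z L K : L =1 K -> frechet phi z L -> frechet phi z K.
Proof.
move=> LK [[M hM] H]; split; first by exists M => h; rewrite -LK.
by move=> e /H[d d0 hd]; exists d => // h /hd; rewrite LK.
Qed.

Lemma frechet_near phi psi z L : phi z = psi z ->
  (exists2 d : R, 0 < d & forall h, sz h < d -> phi (z + h) = psi (z + h)) ->
  frechet phi z L -> frechet psi z L.
Proof.
move=> e0 [d d0 hd] [HM H]; split=> // e /H[d' d'0 hd'].
exists (Num.min d d'); first by rewrite lt_min d0.
by move=> h; rewrite lt_min => /andP[h1 h2]; rewrite -e0 -hd //; apply: hd'.
Qed.

Lemma frechet_bound phi z L : frechet phi z L ->
  exists2 M : R, 0 <= M & exists2 d : R, 0 < d & forall h, sz h < d ->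
    cabs (phi (z + h) - phi z) <= M * sz h.
Proof.
move=> [[M hM] /(_ 1 ltr01)[d d0 hd]].
exists (`|M| + 1); first by rewrite addr_ge0.
exists d => // h hh; have := hd _ hh; have := hM h; have := sz_ge0 h.
move=> s0 h1 h2; rewrite -[X in cabs X](subrK (L h)).
apply: (le_trans (cabsD _ _)); rewrite mulrDl addrC.
apply: lerD => //; apply: (le_trans h1); apply: ler_wpM2r => //; exact: ler_norm.
Qed.

Lemma frechet_cst z (a : C) : frechet (fun=> a) z (fun=> 0).
Proof.
split; first by exists 0 => h; rewrite cabs0 mul0r.
move=> e e0; exists 1 => // h _; rewrite !subrr cabs0.
by rewrite mulr_ge0 // ltW.
Qed.

Lemma frechetD phi psi z L K : frechet phi z L -> frechet psi z K ->
  frechet (fun h => phi h + psi h) z (fun h => L h + K h).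
Proof.
move=> [[M hM] H] [[M' hM'] H']; split.
  exists (M + M') => h; apply: (le_trans (cabsD _ _)); rewrite mulrDl.
  exact: lerD.
move=> e e0; have e2 : 0 < e / 2 by rewrite divr_gt0.
have [d d0 hd] := H _ e2; have [d' d'0 hd'] := H' _ e2.
exists (Num.min d d'); first by rewrite lt_min d0.
move=> h; rewrite lt_min => /andP[/hd h1 /hd' h2].
have -> : phi (z + h) + psi (z + h) - (phi z + psi z) - (L h + K h) =
  (phi (z + h) - phi z - L h) + (psi (z + h) - psi z - K h) by ring.
apply: (le_trans (cabsD _ _)); lra.
Qed.

Lemma frechet_conj phi z L : frechet phi z L ->
  frechet (fun h => Num.conj (phi h)) z (fun h => Num.conj (L h)).
Proof.
move=> [[M hM] H]; split; first by exists M => h; rewrite cabs_conj.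
move=> e /H[d d0 hd]; exists d => // h /hd.
by rewrite -!conjB cabs_conj.
Qed.

End Rules.

(** p and q are the Wirtinger derivatives of phi at z; q = 0 expresses complex
    differentiability. *)
Definition pdiff (phi : C -> C) z p q :=
  frechet cabs phi z (fun h => p * h + q * Num.conj h).
Definition rdiff (phi : R -> C) x l :=
  frechet Num.norm phi x (fun h => toC h * l).

Lemma frechet_comp (V : zmodType) (sz : V -> R) (sz0 : forall h, 0 <= sz h)
    (phi : C -> C) (k : V -> C) z L p q :
  pdiff phi (k z) p q -> frechet sz k z L ->
  frechet sz (fun y => phi (k y)) z (fun h => p * L h + q * Num.conj (L h)).
Proof.
move=> [_ H] fk; have [[M hM] Hk] := fk.
have M0 : exists2 M : R, 0 <= M & forall h, cabs (L h) <= M * sz h.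
  exists `|M| => // h; apply: (le_trans (hM h)).
  by apply: ler_wpM2r => //; exact: ler_norm.
move: {M hM} M0 => [M M0 hM].
set P := cabs p + cabs q.
have P0 : 0 <= P by rewrite addr_ge0 ?cabs_ge0.
have lin (w : C) : cabs (p * w + q * Num.conj w) <= P * cabs w.
  by apply: (le_trans (cabsD _ _)); rewrite !cabsM cabs_conj mulrDl.
split.
  exists (P * M) => h; apply: (le_trans (lin _)).
  by rewrite -mulrA; apply: ler_wpM2l.
move=> e e0.
have e20 : 0 < e / (2 * (M + 1)) by rewrite divr_gt0 // mulr_gt0 //; lra.
have e10 : 0 < Num.min 1 (e / (2 * (P + 1))).
  by rewrite lt_min ltr01 /= divr_gt0 // mulr_gt0 //; lra.
have [d1 d10 hd1] := Hk _ e10; have [d2 d20 hd2] := H _ e20.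
exists (Num.min d1 (d2 / (M + 1))).
  by rewrite lt_min d10 /= divr_gt0 //; lra.
move=> h; rewrite lt_min => /andP[/hd1 h1].
rewrite ltr_pdivlMr; last by lra.
move=> h2; set w := k (z + h) - k z in h1 *.
have h1a : cabs (w - L h) <= 1 * sz h.
  by apply: (le_trans h1); apply: ler_wpM2r => //; rewrite ge_min lexx.
have h1b : cabs (w - L h) <= e / (2 * (P + 1)) * sz h.
  by apply: (le_trans h1); apply: ler_wpM2r => //; rewrite ge_min lexx orbT.
have wb : cabs w <= (M + 1) * sz h.
  rewrite -(subrK (L h) w); apply: (le_trans (cabsD _ _)).
  by have := hM h; lra.
have wd : cabs w < d2 by apply: (le_lt_trans wb); rewrite mulrC.
have := hd2 _ wd; have -> : k z + w = k (z + h) by rewrite /w; ring.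
move=> h3.
have -> : phi (k (z + h)) - phi (k z) - (p * L h + q * Num.conj (L h)) =
  (phi (k (z + h)) - phi (k z) - (p * w + q * Num.conj w)) +
  (p * (w - L h) + q * Num.conj (w - L h)).
  have -> : Num.conj (w - L h) = Num.conj w - Num.conj (L h) by exact: conjB.
  by move: (Num.conj w) (Num.conj (L h)) => a b; ring.
apply: (le_trans (cabsD _ _)).
have i1 : e / (2 * (M + 1)) * cabs w <= e / 2 * sz h.
  have -> : e / 2 * sz h = e / (2 * (M + 1)) * ((M + 1) * sz h).
    by field; apply/eqP; lra.
  by apply: ler_wpM2l => //; exact: ltW.
have i2 : P * cabs (w - L h) <= e / 2 * sz h.
  have i3 : P * cabs (w - L h) <= (P + 1) * (e / (2 * (P + 1)) * sz h).
    by apply: ler_pM => //; [exact: cabs_ge0 | lra].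
  apply: (le_trans i3); rewrite le_eqVlt; apply/orP; left; apply/eqP.
  by field; apply/eqP; lra.
have := lin (w - L h); lra.
Qed.

Lemma pdiff_hol_sq z : pdiff (fun w => w ^+ 2) z (2 * z) 0.
Proof.
split.
  exists (2 * cabs z) => h; rewrite mul0r addr0 !cabsM.
  have -> : cabs (2 : C) = 2; last by [].
  by rewrite -[2]/(2%:R) -(rmorph_nat (@toC R)) cabs_toC ger0_norm.
move=> e e0; exists e => // h he.
have -> : (z + h) ^+ 2 - z ^+ 2 - (2 * z * h + 0 * Num.conj h) = h * h by ring.
by rewrite cabsM; apply: ler_wpM2r; [exact: cabs_ge0 | exact: ltW].
Qed.

Section Products.
Context (V : zmodType) (sz : V -> R).
Hypothesis sz_ge0 : forall h, 0 <= sz h.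
Implicit Types (phi psi : V -> C) (L K : V -> C) (z h : V).

Lemma frechetZ phi z L (a : C) : frechet sz phi z L ->
  frechet sz (fun h => a * phi h) z (fun h => a * L h).
Proof.
move=> [[M hM] H]; split.
  exists (cabs a * M) => h; rewrite cabsM -mulrA.
  by apply: ler_wpM2l => //; exact: cabs_ge0.
move=> e e0; have e1 : 0 < e / (cabs a + 1).
  by rewrite divr_gt0 //; have := cabs_ge0 a; lra.
have [d d0 hd] := H _ e1; exists d => // h /hd h1.
have -> : a * phi (z + h) - a * phi z - a * L h =
  a * (phi (z + h) - phi z - L h) by ring.
rewrite cabsM.
have : cabs a * cabs (phi (z + h) - phi z - L h) <=
    (cabs a + 1) * (e / (cabs a + 1) * sz h).
  by apply: ler_pM => //; [exact: cabs_ge0 | exact: cabs_ge0 | lra].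
move/le_trans; apply; rewrite le_eqVlt; apply/orP; left; apply/eqP.
by field; apply/eqP; have := cabs_ge0 a; lra.
Qed.

Lemma frechetN phi z L : frechet sz phi z L ->
  frechet sz (fun h => - phi h) z (fun h => - L h).
Proof.
move=> /(frechetZ (-1)) H; apply: frechet_ext; last first.
  by apply: frechet_near H; rewrite ?mulN1r //; exists 1 => // h _; rewrite mulN1r.
by move=> h /=; rewrite mulN1r.
Qed.

(** By polarization: 4 a b = (a + b)^2 - (a - b)^2, and squares are compositions. *)
Lemma frechetM phi psi z L K : frechet sz phi z L -> frechet sz psi z K ->
  frechet sz (fun h => phi h * psi h) z (fun h => L h * psi z + phi z * K h).
Proof.
move=> h1 h2; have h3 := frechetN h2.
have s1 := frechet_comp sz_ge0 (pdiff_hol_sq _) (frechetD h1 h2).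
have s2 := frechet_comp sz_ge0 (pdiff_hol_sq _) (frechetD h1 h3).
have s := frechetZ (4^-1) (frechetD s1 (frechetN s2)).
have E (a b : C) : 4^-1 * ((a + b) ^+ 2 - (a - b) ^+ 2) = a * b by field.
apply: frechet_ext; last first.
  by apply: frechet_near s; rewrite /= ?E //; exists 1 => // h _; rewrite E.
by move=> h /=; field.
Qed.

Lemma frechet_sum (I : Type) (r : seq I) (F : I -> V -> C) z (L : I -> V -> C) :
  (forall i, frechet sz (F i) z (L i)) ->
  frechet sz (fun h => \sum_(i <- r) F i h) z (fun h => \sum_(i <- r) L i h).
Proof.
move=> H; elim: r => [|i r IH].
  apply: frechet_ext; last first.
    by apply: frechet_near (frechet_cst sz_ge0 z 0); rewrite ?big_nil //; exists 1 => // h _; rewrite big_nil.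
  by move=> h; rewrite big_nil.
apply: frechet_ext; last first.
  by apply: frechet_near (frechetD (H i) IH); rewrite ?big_cons //; exists 1 => // h _; rewrite big_cons.
by move=> h; rewrite /= big_cons.
Qed.

End Products.

Lemma cabs_nat k : cabs (k%:R : C) = k%:R.
Proof. by rewrite -(rmorph_nat (@toC R)) cabs_toC ger0_norm. Qed.

Lemma pdiff_id z : pdiff id z 1 0.
Proof.
split; first by exists 1 => h; rewrite !mul1r mul0r addr0.
move=> e e0; exists 1 => // h _.
have -> : z + h - z - (1 * h + 0 * Num.conj h) = 0 by ring.
by rewrite cabs0 mulr_ge0 ?cabs_ge0 // ltW.
Qed.

Lemma pdiff_inv z : z != 0 -> pdiff (fun w => w^-1) z (- z ^- 2) 0.
Proof.
move=> z0; have az : 0 < cabs z by rewrite cabs_gt0.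
split.
  by exists (cabs (- z ^- 2)) => h; rewrite mul0r addr0 cabsM.
move=> e e0; exists (Num.min (cabs z / 2) (e * cabs z ^+ 3 / 2)).
  by rewrite lt_min !divr_gt0 //= mulr_gt0 // exprn_gt0.
move=> h; rewrite lt_min => /andP[h1 h2].
have zh : cabs z / 2 <= cabs (z + h).
  by have := cabs_lB z (- h); rewrite opprK cabsN; lra.
have zh0 : z + h != 0 by rewrite -cabs_gt0; lra.
have -> : (z + h)^-1 - z^-1 - (- z ^- 2 * h + 0 * Num.conj h) =
  h * (h / (z ^+ 2 * (z + h))) by field; rewrite z0 zh0.
rewrite cabsM mulrC; apply: ler_wpM2r; first exact: cabs_ge0.
rewrite cabsM cabsV cabsM cabsX ler_pdivrMr; last first.
  by rewrite mulr_gt0 ?exprn_gt0 ?cabs_gt0.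
have : e * (cabs z ^+ 2 * (cabs z / 2)) <= e * (cabs z ^+ 2 * cabs (z + h)).
  by apply: ler_wpM2l; [exact: ltW | apply: ler_wpM2l => //; exact: sqr_ge0].
apply: le_trans; move: h2; rewrite exprS => /ltW.
have -> // : e * (cabs z * cabs z ^+ 2) / 2 = e * (cabs z ^+ 2 * (cabs z / 2)) by ring.
Qed.

(** The difference of the two differentials is o(|h|) and real homogeneous, hence 0;
    the directions 1 and 'i then separate p from q. *)
Lemma pdiff_uniq phi z p q p' q' :
  pdiff phi z p q -> pdiff phi z p' q' -> p = p' /\ q = q'.
Proof.
move=> /(frechetZ (-1)) h1 h2; have {h1 h2} [_ H] := frechetD h1 h2.
have B (h : C) : (p' - p) * h + (q' - q) * Num.conj h = 0.
  apply/eqP; rewrite -cabs_eq0; apply/eqP/le_anti; rewrite cabs_ge0 andbT.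
  apply/ler_addgt0Pr => e e0; rewrite add0r.
  have e1 : 0 < e / (cabs h + 1) by rewrite divr_gt0 //; have := cabs_ge0 h; lra.
  have [d d0 /(_ (toC (d / 2 / (cabs h + 1)) * h))] := H _ e1.
  set s := d / 2 / (cabs h + 1); have ha := cabs_ge0 h.
  have s0 : 0 < s by rewrite !divr_gt0 //; lra.
  rewrite !cabsM cabs_toC ger0_norm ?(ltW s0) //.
  have hs : s * cabs h < d.
    have : s * cabs h <= s * (cabs h + 1) by apply: ler_wpM2l; [exact: ltW|lra].
    have -> : s * (cabs h + 1) = d / 2 by rewrite /s; field; apply/eqP; lra.
    by lra.
  move=> /(_ hs); rewrite conjM conj_toC.
  set X := (X in cabs X); have -> : X = - toC s * ((p' - p) * h + (q' - q) * Num.conj h).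
    by rewrite /X; ring.
  rewrite cabsM cabsN cabs_toC ger0_norm ?(ltW s0) //.
  have -> : e / (cabs h + 1) * (s * cabs h) = s * (e / (cabs h + 1) * cabs h) by ring.
  rewrite ler_pM2l // => /le_trans; apply.
  rewrite -mulrA ler_piMr ?(ltW e0) // mulrC ler_pdivrMr; lra.
have := B 1; have := B 'i; rewrite conj1 conjCi !mulr1.
move=> b2 b1; have b3 : (p' - p) - (q' - q) = 0.
  have : 'i * ((p' - p) - (q' - q)) = 0 by rewrite -[RHS]b2; ring.
  by move/eqP; rewrite mulf_eq0 (negPf (neq0Ci _)) /= => /eqP.
split; apply/eqP; rewrite eq_sym -subr_eq0; apply/eqP.
  have -> : p' - p = 2^-1 * ((p' - p + (q' - q)) + (p' - p - (q' - q))) by field.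
  by rewrite b1 b3 addr0 mulr0.
have -> : q' - q = 2^-1 * ((p' - p + (q' - q)) - (p' - p - (q' - q))) by field.
by rewrite b1 b3 subr0 mulr0.
Qed.

Lemma rdiff_cst (x : R) (a : C) : rdiff (fun=> a) x 0.
Proof.
apply: frechet_ext; last exact: (frechet_cst (@normr_ge0 _ _)).
by move=> h /=; rewrite mulr0.
Qed.
Lemma rdiffD phi psi x l k : rdiff phi x l -> rdiff psi x k ->
  rdiff (fun s => phi s + psi s) x (l + k).
Proof.
move=> h1 h2; apply: frechet_ext; last exact: frechetD h1 h2.
by move=> h /=; rewrite mulrDr.
Qed.
Lemma rdiffZ phi x l a : rdiff phi x l -> rdiff (fun s => a * phi s) x (a * l).
Proof.
move=> h1; apply: frechet_ext; last exact: frechetZ h1.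
by move=> h /=; rewrite mulrCA.
Qed.
Lemma rdiffN phi x l : rdiff phi x l -> rdiff (fun s => - phi s) x (- l).
Proof.
move=> h1; apply: frechet_ext; last exact: frechetN h1.
by move=> h /=; rewrite mulrN.
Qed.
Lemma rdiffB phi psi x l k : rdiff phi x l -> rdiff psi x k ->
  rdiff (fun s => phi s - psi s) x (l - k).
Proof. by move=> h1 /rdiffN; exact: rdiffD. Qed.
Lemma rdiffM phi psi x l k : rdiff phi x l -> rdiff psi x k ->
  rdiff (fun s => phi s * psi s) x (l * psi x + phi x * k).
Proof.
move=> h1 h2; apply: frechet_ext; last exact: (frechetM (@normr_ge0 _ _) h1 h2).
by move=> h /=; ring.
Qed.
Lemma rdiff_comp phi k x l p q : pdiff phi (k x) p q -> rdiff k x l ->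
  rdiff (fun s => phi (k s)) x (p * l + q * Num.conj l).
Proof.
move=> h1 h2; apply: frechet_ext; last exact: (frechet_comp (@normr_ge0 _ _) h1 h2).
by move=> h /=; rewrite conjM conj_toC; ring.
Qed.

Lemma pdiff_ext phi z p q p' q' : p = p' -> q = q' -> pdiff phi z p q -> pdiff phi z p' q'.
Proof. by move=> -> ->. Qed.
Lemma pdiff_near phi psi z p q :
  (\forall w \near z, phi w = psi w) -> pdiff phi z p q -> pdiff psi z p q.
Proof.
move=> /nbhsCP[e e0 he]; apply: frechet_near.
  by apply: he; rewrite subrr cabs0.
by exists e => // h hh; apply: he; rewrite addrC addKr.
Qed.
Lemma pdiff_cst z (a : C) : pdiff (fun=> a) z 0 0.
Proof.
apply: frechet_ext; last exact: (frechet_cst (@cabs_ge0 _)).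
by move=> h /=; rewrite !mul0r addr0.
Qed.
Lemma pdiffD phi psi z p q p' q' : pdiff phi z p q -> pdiff psi z p' q' ->
  pdiff (fun s => phi s + psi s) z (p + p') (q + q').
Proof.
move=> h1 h2; apply: frechet_ext; last exact: frechetD h1 h2.
by move=> h /=; ring.
Qed.
Lemma pdiffZ phi z p q a : pdiff phi z p q -> pdiff (fun s => a * phi s) z (a * p) (a * q).
Proof.
move=> h1; apply: frechet_ext; last exact: frechetZ h1.
by move=> h /=; ring.
Qed.
Lemma pdiffN phi z p q : pdiff phi z p q -> pdiff (fun s => - phi s) z (- p) (- q).
Proof.
move=> h1; apply: frechet_ext; last exact: frechetN h1.
by move=> h /=; ring.
Qed.
Lemma pdiffB phi psi z p q p' q' : pdiff phi z p q -> pdiff psi z p' q' ->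
  pdiff (fun s => phi s - psi s) z (p - p') (q - q').
Proof. by move=> h1 /pdiffN; exact: pdiffD. Qed.
Lemma pdiffM phi psi z p q p' q' : pdiff phi z p q -> pdiff psi z p' q' ->
  pdiff (fun s => phi s * psi s) z (p * psi z + phi z * p') (q * psi z + phi z * q').
Proof.
move=> h1 h2; apply: frechet_ext; last exact: (frechetM (@cabs_ge0 _) h1 h2).
by move=> h /=; ring.
Qed.
Lemma pdiff_conj phi z p q : pdiff phi z p q ->
  pdiff (fun s => Num.conj (phi s)) z (Num.conj q) (Num.conj p).
Proof.
move=> h1; apply: frechet_ext; last exact: frechet_conj h1.
by move=> h /=; rewrite conjD !conjM conjCK addrC.
Qed.
Lemma pdiff_comp phi k z a b p q : pdiff phi (k z) p q -> pdiff k z a b ->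
  pdiff (fun s => phi (k s)) z (p * a + q * Num.conj b) (p * b + q * Num.conj a).
Proof.
move=> h1 h2; apply: frechet_ext; last exact: (frechet_comp (@cabs_ge0 _) h1 h2).
by move=> h /=; rewrite conjD !conjM conjCK; ring.
Qed.
Lemma pdiff_sum (I : Type) (r : seq I) (F : I -> C -> C) z (p q : I -> C) :
  (forall i, pdiff (F i) z (p i) (q i)) ->
  pdiff (fun h => \sum_(i <- r) F i h) z (\sum_(i <- r) p i) (\sum_(i <- r) q i).
Proof.
move=> H; apply: frechet_ext; last exact: (frechet_sum (@cabs_ge0 _) r H).
by move=> h /=; rewrite big_split /= !mulr_suml.
Qed.
Lemma pdiff_continuous phi z p q : pdiff phi z p q -> {for z, continuous phi}.
Proof.
move=> /(frechet_bound (@cabs_ge0 _))[M M0 [d d0 hd]].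
apply/(@cvgCP _ _ (nbhs z)) => e e0; apply/nbhsCP.
exists (Num.min d (e / (M + 1))); first by rewrite lt_min d0 divr_gt0 //; lra.
move=> w; rewrite lt_min => /andP[h1]; rewrite ltr_pdivlMr; last by lra.
move=> h2; have := hd _ h1; rewrite (addrC z) subrK => /le_lt_trans; apply.
by apply: le_lt_trans h2; rewrite mulrC; apply: ler_wpM2l; [exact: cabs_ge0|lra].
Qed.

End Frechet.

(** * Paths in the complex plane and their primitives *)

Section Paths.
Context {R : realType}.
Local Notation C := (Cplx R).

Lemma is_deriveE (f : R -> R) (x l : R) :
  is_derive x 1 f l <-> h^-1 * (f (x + h) - f x) @[h --> 0^'] --> l.
Proof.
have E : (fun h : R => h^-1 *: ((f \o shift x) (h *: 1) - f x)) =
         (fun h : R => h^-1 * (f (x + h) - f x)).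
  by apply/funext => h /=; rewrite /shift /= [h *: 1]mulr1 (addrC h).
split=> [[df <-]|H].
  by move: df; rewrite /derive /derivable E.
have H' : (fun h : R => h^-1 *: ((f \o shift x) (h *: 1) - f x)) @ 0^' --> l.
  by rewrite E.
apply: DeriveDef; first by apply/cvg_ex; exists l.
by apply/cvg_lim.
Qed.

Lemma is_derive_epsP (f : R -> R) (x l : R) :
  is_derive x 1 f l <->
  forall e : R, 0 < e -> exists2 d : R, 0 < d & forall h, `|h| < d ->
    `|f (x + h) - f x - h * l| <= e * `|h|.
Proof.
rewrite is_deriveE; split.
  move=> /cvgrPdist_le H e e0; have := H _ e0.
  rewrite near_withinE => /nbhs_ballP[d /= d0 hd]; exists d => // h hh.
  have [->|h0] := eqVneq h 0; first by rewrite addr0 subrr mul0r subr0 normr0 mulr0.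
  have := hd h; rewrite /ball /= sub0r normrN => /(_ hh h0).
  rewrite distrC => H1.
  have -> : f (x + h) - f x - h * l = (h^-1 * (f (x + h) - f x) - l) * h by field.
  by rewrite normrM ler_wpM2r.
move=> H; apply/cvgrPdist_le => e e0; have [d d0 hd] := H _ e0.
rewrite near_withinE; apply/nbhs_ballP; exists d => //= h.
rewrite /ball /= sub0r normrN => hh h0.
have := hd _ hh; rewrite -ler_pdivrMr ?normr_gt0 // -normrV ?unitfE // -normrM.
congr (_ <= _); rewrite distrC; congr (`| _ |); by field.
Qed.

Lemma rdiff_is_derive (phi : R -> C) (x : R) (l : C) : rdiff phi x l ->
  is_derive x 1 (fun s => reC (phi s)) (reC l) /\
  is_derive x 1 (fun s => imC (phi s)) (imC l).
Proof.
move=> [_ H]; split; apply/is_derive_epsP => e /H[d d0 hd]; exists d => // h /hd.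
  apply: le_trans.
  have -> : reC (phi (x + h)) - reC (phi x) - h * reC l =
    reC (phi (x + h) - phi x - toC h * l).
    by rewrite !raddfB /= reCM reC_toC imC_toC; ring.
  exact: reC_le_cabs.
apply: le_trans.
have -> : imC (phi (x + h)) - imC (phi x) - h * imC l =
  imC (phi (x + h) - phi x - toC h * l).
  by rewrite !raddfB /= imCM reC_toC imC_toC; ring.
exact: imC_le_cabs.
Qed.

Lemma is_derive_rdiff (phi : R -> C) (x : R) (l : C) :
  is_derive x 1 (fun s => reC (phi s)) (reC l) ->
  is_derive x 1 (fun s => imC (phi s)) (imC l) -> rdiff phi x l.
Proof.
move=> /is_derive_epsP H1 /is_derive_epsP H2; split.
  by exists (cabs l) => h; rewrite cabsM cabs_toC mulrC.
move=> e e0; have e2 : 0 < e / 2 by rewrite divr_gt0.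
have [d1 d10 hd1] := H1 _ e2; have [d2 d20 hd2] := H2 _ e2.
exists (Num.min d1 d2); first by rewrite lt_min d10.
move=> h; rewrite lt_min => /andP[/hd1 h1 /hd2 h2].
apply: (le_trans (cabs_le_reim _)).
rewrite !raddfB /= reCM imCM reC_toC imC_toC !mul0r subr0 addr0; lra.
Qed.

Lemma rdiff_toC (f : R -> R) (x l : R) : is_derive x 1 f l ->
  rdiff (fun s => toC (f s)) x (toC l).
Proof.
move=> H; apply: is_derive_rdiff => //=.
exact: is_derive_cst.
Qed.

(** Rotate the increment onto the positive real axis and apply the mean value
    theorem to the real part. *)
Lemma mean_value_le (phi l : R -> C) (a b M : R) : a <= b ->
  (forall s, a <= s <= b -> rdiff phi s (l s)) ->
  (forall s, a <= s <= b -> cabs (l s) <= M) ->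
  cabs (phi b - phi a) <= M * (b - a).
Proof.
move=> ab dphi lM; have [->|w0] := eqVneq (phi b - phi a) 0.
  have := lM a; rewrite lexx ab cabs0 => /(_ isT) h.
  by rewrite mulr_ge0 ?subr_ge0 //; apply: le_trans h; exact: cabs_ge0.
set w := phi b - phi a in w0 *; have aw : 0 < cabs w by rewrite cabs_gt0.
pose u := toC (cabs w)^-1 * Num.conj w.
have au : cabs u = 1.
  by rewrite cabsM cabs_toC cabs_conj ger0_norm ?invr_ge0 ?cabs_ge0 // mulVf ?lt0r_neq0.
have uw : u * w = toC (cabs w).
  rewrite /u -mulrA (mulrC (Num.conj w)) mulconjE -rmorphM; congr toC.
  by field; rewrite gt_eqF.
have D s : a <= s <= b -> is_derive (s : R) 1 (fun s => reC (u * phi s)) (reC (u * l s)).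
  by move=> /dphi d; have [] := rdiff_is_derive (rdiffZ u d).
have cf : {within `[a, b], continuous (fun s => reC (u * phi s))}.
  by apply: derivable_within_continuous => s; rewrite in_itv /= => /D[].
have D' s : s \in `]a, b[%R -> is_derive (s : R) 1 (fun s => reC (u * phi s)) (reC (u * l s)).
  by rewrite in_itv /= => /andP[h1 h2]; apply: D; rewrite !ltW.
have [c] := MVT_segment ab D' cf; rewrite in_itv /= => cab.
rewrite -raddfB -mulrBr uw /= => ->.
apply: ler_wpM2r; first by rewrite subr_ge0.
apply: le_trans (lM _ cab); apply: le_trans (ler_norm _) _.
by apply: le_trans (reC_le_cabs _) _; rewrite cabsM au mul1r.
Qed.

Lemma rdiff_continuous (phi : R -> C) x l : rdiff phi x l -> {for x, continuous phi}.
Proof.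
move=> /(frechet_bound (@normr_ge0 _ _))[M M0 [d d0 hd]].
apply/(@cvgCP _ _ (nbhs x)) => e e0; apply/nbhs_ballP.
exists (Num.min d (e / (M + 1))) => /=.
  by rewrite lt_min d0 divr_gt0 //; lra.
move=> y; rewrite /ball /= lt_min => /andP[h1]; rewrite ltr_pdivlMr; last by lra.
rewrite distrC in h1 *; move=> h2.
have := hd _ h1; rewrite (addrC x) subrK => /le_lt_trans; apply.
by apply: le_lt_trans h2; rewrite mulrC; apply: ler_wpM2l => //; lra.
Qed.

Lemma rdiff0_eq (phi : R -> C) (a b : R) : a <= b ->
  (forall s, a <= s <= b -> rdiff phi s 0) -> phi a = phi b.
Proof.
move=> ab H; apply/eqP; rewrite eq_sym -subr_eq0 -cabs_eq0; apply/eqP/le_anti.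
rewrite cabs_ge0 andbT.
have -> : 0 = 0 * (b - a) by rewrite mul0r.
by apply: (@mean_value_le _ (fun=> 0)) => // s _; rewrite cabs0.
Qed.

Lemma local_primitive_real (f : R -> R) (N : R) : 0 < N -> continuous f ->
  exists F : R -> R, forall x : R, `|x| < N -> is_derive x 1 F (f x).
Proof.
move=> N0 cf.
exists (fun x => (\int[lebesgue_measure]_(t in [set` `[(- N)%R, x]]) f t)%R).
move=> x; rewrite ltr_norml => /andP[h1 h2].
have [] := @continuous_FTC1_closed _ f (- N) x N h2 _ h1 (cf x).
  apply: continuous_compact_integrable; first exact: segment_compact.
  exact: continuous_subspaceT.
by rewrite derive1E; exact: DeriveDef.
Qed.

Lemma local_primitive (phi : R -> C) (N : R) : 0 < N -> continuous phi ->
  exists F : R -> C, F 0 = 0 /\ forall x, `|x| < N -> rdiff F x (phi x).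
Proof.
move=> N0 cphi.
have [F1 h1] : exists F : R -> R, forall x : R, `|x| < N -> is_derive x 1 F (reC (phi x)).
  apply: local_primitive_real => // x.
  by apply: continuous_comp; [exact: cphi | exact: reC_continuous].
have [F2 h2] : exists F : R -> R, forall x : R, `|x| < N -> is_derive x 1 F (imC (phi x)).
  apply: local_primitive_real => // x.
  by apply: continuous_comp; [exact: cphi | exact: imC_continuous].
exists (fun x => toC (F1 x) + 'i * toC (F2 x) - (toC (F1 0) + 'i * toC (F2 0))).
split; first by rewrite subrr.
move=> x xN; have d1 := rdiff_toC (h1 x xN); have d2 := rdiff_toC (h2 x xN).
have := rdiffB (rdiffD d1 (rdiffZ 'i d2)) (rdiff_cst x (toC (F1 0) + 'i * toC (F2 0))).
by rewrite subr0 -CsplitE.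
Qed.

(** Primitives on growing intervals, all normalized to vanish at 0, agree on common
    domains since a function with zero derivative is constant. *)
Lemma primitive_exists (phi : R -> C) : continuous phi ->
  exists F : R -> C, forall x, rdiff F x (phi x).
Proof.
move=> cphi.
have /choice[F HF] (N : nat) : exists F : R -> C,
    F 0 = 0 /\ forall x, `|x| < N.+1%:R -> rdiff F x (phi x).
  by apply: local_primitive.
have agree (N M : nat) x : `|x| < N.+1%:R -> `|x| < M.+1%:R -> F N x = F M x.
  move=> xN xM; have [N0 dN] := HF N; have [M0 dM] := HF M.
  have D y : `|y| <= `|x| -> rdiff (fun y => F N y - F M y) y 0.
    move=> yx; have yN := le_lt_trans yx xN; have yM := le_lt_trans yx xM.
    by have := rdiffB (dN _ yN) (dM _ yM); rewrite subrr.
  apply/eqP; rewrite -subr_eq0; apply/eqP.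
  have Z : 0 = F N 0 - F M 0 by rewrite N0 M0 subrr.
  rewrite Z; have [x0|x0] := leP 0 x.
    apply/esym/(@rdiff0_eq (fun y => F N y - F M y)) => // s /andP[s1 s2].
    by apply: D; rewrite !ger0_norm.
  apply: (@rdiff0_eq (fun y => F N y - F M y)); first exact: ltW.
  move=> s /andP[s1 s2]; apply: D.
  by rewrite (ler0_norm s2) (ltr0_norm x0) lerN2.
pose n (x : R) := Num.trunc `|x|; have nP (x : R) : `|x| < (n x).+1%:R.
  by have /andP[] := truncn_itv (normr_ge0 x).
exists (fun x => F (n x) x) => x.
have xn : `|x| < (n x).+2%:R by rewrite (lt_trans (nP x)) // ltr_nat.
apply: frechet_near ((HF (n x).+1).2 x xn); first exact: agree.
exists 1 => // h h1; apply: agree; last exact: nP.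
have := ler_normD x h; have := nP x.
by rewrite -[X in _ -> _ -> _ < X]natr1; move: h1; lra.
Qed.

Definition primitive (phi : R -> C) : R -> C :=
  xget (fun=> 0) [set F | forall x, rdiff F x (phi x)].

(** The integral of a continuous path as the increment of a primitive: additivity
    in the bounds needs no order between them. *)
Definition cint (a b : R) (phi : R -> C) : C := primitive phi b - primitive phi a.

Lemma primitiveP phi : continuous phi -> forall x, rdiff (primitive phi) x (phi x).
Proof. by move=> /primitive_exists[F HF]; rewrite /primitive; case: xgetP => [_ ->|/(_ F)]. Qed.

Lemma cint_FTC phi F a b : continuous phi -> a <= b ->
  (forall x, a <= x <= b -> rdiff F x (phi x)) -> cint a b phi = F b - F a.
Proof.
move=> cphi ab dF; rewrite /cint.
have : primitive phi a - F a = primitive phi b - F b.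
  apply: (@rdiff0_eq (fun x => primitive phi x - F x)) => // x xab.
  by have := rdiffB (primitiveP cphi x) (dF _ xab); rewrite subrr.
by move/eqP; rewrite subr_eq => /eqP ->; ring.
Qed.

Lemma cintD a b c phi : cint a b phi + cint b c phi = cint a c phi.
Proof. by rewrite /cint; ring. Qed.
Lemma cintxx a phi : cint a a phi = 0.
Proof. by rewrite /cint subrr. Qed.
Lemma cintN a b phi : cint b a phi = - cint a b phi.
Proof. by rewrite /cint opprB. Qed.

Lemma cint_le a b phi M : continuous phi -> a <= b ->
  (forall x, a <= x <= b -> cabs (phi x) <= M) -> cabs (cint a b phi) <= M * (b - a).
Proof.
move=> cphi ab H; apply: (@mean_value_le _ phi) => // s _; exact: primitiveP.
Qed.

Lemma cint_lin a b phi psi (k : C) : continuous phi -> continuous psi -> a <= b ->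
  cint a b (fun x => phi x + k * psi x) = cint a b phi + k * cint a b psi.
Proof.
move=> cphi cpsi ab.
have cs : continuous (fun x => phi x + k * psi x).
  move=> x; apply: cvgD; first exact: cphi.
  by apply: cvgM; [exact: cvg_cst | exact: cpsi].
have dF x : a <= x <= b ->
    rdiff (fun x => primitive phi x + k * primitive psi x) x (phi x + k * psi x).
  by move=> _; exact: rdiffD (primitiveP cphi x) (rdiffZ k (primitiveP cpsi x)).
by rewrite (cint_FTC cs ab dF) /cint; ring.
Qed.

Lemma cint_cst a b (k : C) : a <= b -> cint a b (fun=> k) = toC (b - a) * k.
Proof.
move=> ab; have ck : continuous (fun _ : R => k) by move=> x; exact: cvg_cst.
have dF x : a <= x <= b -> rdiff (fun x => toC x * k) x k.
  move=> _; have := rdiffM (rdiff_toC (is_derive_id x (1 : R))) (rdiff_cst x k).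
  by rewrite rmorph1 mul1r mulr0 addr0.
by rewrite (cint_FTC ck ab dF) raddfB /= mulrBl.
Qed.

End Paths.

(** * Goursat's lemma *)

Section Goursat.
Context {R : realType}.
Local Notation C := (Cplx R).
Implicit Types (f k : C -> C) (a b c d x y : R).

Definition xy x y : C := toC x + 'i * toC y.

Lemma reC_xy x y : reC (xy x y) = x.
Proof. by rewrite /xy reCD reCM reCi imCi !reC_toC imC_toC; ring. Qed.
Lemma imC_xy x y : imC (xy x y) = y.
Proof. by rewrite /xy imCD imCM reCi imCi !imC_toC reC_toC; ring. Qed.
Lemma xyE z : xy (reC z) (imC z) = z.
Proof. by rewrite /xy -CsplitE. Qed.

Lemma rdiff_xyl x y : rdiff (xy ^~ y) x 1.
Proof.
have := rdiffD (rdiff_toC (is_derive_id x (1 : R))) (rdiff_cst x ('i * toC y)).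
by rewrite addr0.
Qed.
Lemma rdiff_xyr x y : rdiff (xy x) y 'i.
Proof.
have := rdiffD (rdiff_cst y (toC x)) (rdiffZ 'i (rdiff_toC (is_derive_id y (1 : R)))).
by rewrite rmorph1 mulr1 add0r.
Qed.

Lemma continuous_rowx f y : continuous f -> continuous (fun x => f (xy x y)).
Proof.
move=> cf x; apply: continuous_comp; last exact: cf.
exact: rdiff_continuous (rdiff_xyl x y).
Qed.
Lemma continuous_colx f x : continuous f -> continuous (fun y => f (xy x y)).
Proof.
move=> cf y; apply: continuous_comp; last exact: cf.
exact: rdiff_continuous (rdiff_xyr x y).
Qed.

Definition hside f a b c := cint a b (fun x => f (xy x c)).
Definition vside f a c d := cint c d (fun y => f (xy a y)).

(** The integral of f dz along the oriented boundary of [a, b] x [c, d], negated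
    when one of the two intervals is reversed. *)
Definition bdint f a b c d : C :=
  hside f a b c - hside f a b d + 'i * (vside f b c d - vside f a c d).

Lemma bdint_splitl f a m b c d : bdint f a m c d + bdint f m b c d = bdint f a b c d.
Proof. by rewrite /bdint /hside -!(cintD a m b); ring. Qed.
Lemma bdint_splitr f a b c m d : bdint f a b c m + bdint f a b m d = bdint f a b c d.
Proof. by rewrite /bdint /vside -!(cintD c m d); ring. Qed.
Lemma bdint_swapl f a b c d : bdint f b a c d = - bdint f a b c d.
Proof. by rewrite /bdint /hside !(cintN a b); ring. Qed.
Lemma bdint_swapr f a b c d : bdint f a b d c = - bdint f a b c d.
Proof. by rewrite /bdint /vside !(cintN c d); ring. Qed.
Lemma bdint_degl f a c d : bdint f a a c d = 0.
Proof. by rewrite /bdint /hside !cintxx; ring. Qed.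
Lemma bdint_degr f a b c : bdint f a b c c = 0.
Proof. by rewrite /bdint /vside !cintxx; ring. Qed.

Lemma hside_FTC f F a b c : continuous f -> a <= b ->
  (forall x, a <= x <= b -> pdiff F (xy x c) (f (xy x c)) 0) ->
  hside f a b c = F (xy b c) - F (xy a c).
Proof.
move=> cf ab dF; apply: (@cint_FTC _ _ (fun x => F (xy x c))) => //.
  exact: continuous_rowx.
move=> x /dF d; have := @rdiff_comp _ F (xy ^~ c) x _ _ _ d (rdiff_xyl x c).
by rewrite mulr1 mul0r addr0.
Qed.
Lemma vside_FTC f F a c d : continuous f -> c <= d ->
  (forall y, c <= y <= d -> pdiff F (xy a y) (f (xy a y)) 0) ->
  'i * vside f a c d = F (xy a d) - F (xy a c).
Proof.
move=> cf cd dF.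
have I2 : - 'i * 'i = 1 :> C by rewrite mulNr -expr2 sqrCi opprK.
have D y : c <= y <= d -> rdiff (fun y => - 'i * F (xy a y)) y (f (xy a y)).
  move=> /dF dy; have := rdiffZ (- 'i) (@rdiff_comp _ F (xy a) y _ _ _ dy (rdiff_xyr a y)).
  by rewrite mul0r addr0 mulrCA I2 mulr1.
rewrite /vside (cint_FTC (continuous_colx cf) cd D) -mulrBr mulrA mulrN -mulNr I2.
by rewrite mul1r.
Qed.

Lemma bdint_primitive f F a b c d : continuous f -> a <= b -> c <= d ->
  (forall z, pdiff F z (f z) 0) -> bdint f a b c d = 0.
Proof.
move=> cf ab cd dF; rewrite /bdint mulrBr.
rewrite !(hside_FTC cf ab (fun _ _ => dF _)) !(vside_FTC cf cd (fun _ _ => dF _)).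
by ring.
Qed.

Lemma pdiff_affine_primitive (u v : C) z :
  pdiff (fun z => u * z + v / 2 * z ^+ 2) z (u + v * z) 0.
Proof.
have := pdiffD (pdiffZ u (pdiff_id z)) (pdiffZ (v / 2) (pdiff_hol_sq z)).
by apply: pdiff_ext; rewrite ?mulr0 ?addr0 //; field.
Qed.

Lemma bdint_lin f k (u : C) a b c d : continuous f -> continuous k -> a <= b -> c <= d ->
  bdint (fun z => f z + u * k z) a b c d = bdint f a b c d + u * bdint k a b c d.
Proof.
move=> cf ck ab cd; rewrite /bdint /hside /vside.
rewrite !(cint_lin u (continuous_rowx cf) (continuous_rowx ck) ab).
rewrite !(cint_lin u (continuous_colx cf) (continuous_colx ck) cd).
by ring.
Qed.

Lemma bdint_le f a b c d (M : R) : continuous f -> a <= b -> c <= d ->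
  (forall x y, a <= x <= b -> c <= y <= d -> cabs (f (xy x y)) <= M) ->
  cabs (bdint f a b c d) <= M * (2 * (b - a + (d - c))).
Proof.
move=> cf ab cd fM.
have H y : c <= y <= d -> cabs (hside f a b y) <= M * (b - a).
  by move=> hy; apply: cint_le => // [|x hx]; [exact: continuous_rowx | exact: fM].
have V x : a <= x <= b -> cabs (vside f x c d) <= M * (d - c).
  by move=> hx; apply: cint_le => // [|y hy]; [exact: continuous_colx | exact: fM].
rewrite /bdint; apply: le_trans (cabsD _ _) _; rewrite cabsM cabsi mul1r.
have := cabsB (hside f a b c) (hside f a b d).
have := cabsB (vside f b c d) (vside f a c d).
have := H c; have := H d; have := V a; have := V b.
rewrite !lexx ab cd /= => /(_ isT) h1 /(_ isT) h2 /(_ isT) h3 /(_ isT) h4.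
lra.
Qed.

Lemma cabs_xy_le x y : cabs (xy x y) <= `|x| + `|y|.
Proof. by have := cabs_le_reim (xy x y); rewrite reC_xy imC_xy. Qed.

Lemma xyB x y x' y' : xy x y - xy x' y' = xy (x - x') (y - y').
Proof. by rewrite /xy !toCB; ring. Qed.

Lemma continuous_pdiff0 f p : (forall z, pdiff f z (p z) 0) -> continuous f.
Proof. by move=> H z; exact: pdiff_continuous (H z). Qed.

(** Subtracting the affine approximation of f at p, which has a primitive, leaves an
    integrand that is at most e times the half perimeter. *)
Lemma bdint_local f (p l : C) (e : R) : continuous f -> 0 < e -> pdiff f p l 0 ->
  exists2 dl : R, 0 < dl & forall a b c d, a <= reC p <= b -> c <= imC p <= d ->
    b - a + (d - c) < dl -> cabs (bdint f a b c d) <= e * (2 * (b - a + (d - c)) ^+ 2).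
Proof.
move=> cf e0 [_ /(_ _ e0)[dl dl0 H]]; exists dl => // a b c d hp hq small.
have /andP[ap pb] := hp; have /andP[cq qd] := hq.
have ab : a <= b by apply: le_trans ap pb.
have cd : c <= d by apply: le_trans cq qd.
pose k z : C := (f p - l * p) + l * z.
have dk z := pdiff_affine_primitive (f p - l * p) l z.
have ck : continuous k.
  apply: (@continuous_pdiff0 _ (fun=> l)) => z.
  have := pdiffD (pdiff_cst z (f p - l * p)) (pdiffZ l (pdiff_id z)).
  by apply: pdiff_ext; rewrite ?add0r ?mulr1 ?mulr0.
have E : bdint f a b c d = bdint (fun z => f z + -1 * k z) a b c d.
  by rewrite bdint_lin // (bdint_primitive ck ab cd dk) mulr0 addr0.
have -> : e * (2 * (b - a + (d - c)) ^+ 2) =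
  e * (b - a + (d - c)) * (2 * (b - a + (d - c))) by ring.
rewrite E; apply: bdint_le; [|exact: ab|exact: cd|].
  by move=> z; exact: (forD (cf z) (forM (@for_cst R C z (-1)) (ck z))).
move=> x y /andP[h1 h2] /andP[h3 h4].
have D : cabs (xy x y - p) <= b - a + (d - c).
  rewrite -(xyE p) xyB; apply: le_trans (cabs_xy_le _ _) _.
  by apply: lerD; rewrite ler_norml; lra.
have := H _ (le_lt_trans D small).
rewrite mul0r addr0 (addrC p) subrK.
have -> : f (xy x y) - f p - l * (xy x y - p) = f (xy x y) + -1 * k (xy x y).
  by rewrite /k; ring.
by move/le_trans; apply; apply: ler_wpM2l => //; exact: ltW.
Qed.

Let rect := (R * R * R * R)%type.

Lemma bdint_quarter f a b c d : a <= b -> c <= d -> exists a' b' c' d',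
  [/\ a <= a' /\ b' <= b, c <= c' /\ d' <= d,
      b' - a' = (b - a) / 2, d' - c' = (d - c) / 2 &
      cabs (bdint f a b c d) <= 4 * cabs (bdint f a' b' c' d')].
Proof.
move=> ab cd.
pose m := (a + b) / 2; pose n := (c + d) / 2.
have E : bdint f a b c d = (bdint f a m c n + bdint f m b c n) +
    (bdint f a m n d + bdint f m b n d).
  by rewrite !bdint_splitl bdint_splitr.
have S : cabs (bdint f a b c d) <=
  (cabs (bdint f a m c n) + cabs (bdint f m b c n)) +
  (cabs (bdint f a m n d) + cabs (bdint f m b n d)).
  by rewrite E; apply: le_trans (cabsD _ _) _; apply: lerD; exact: cabsD.
pose B := cabs (bdint f a b c d).
have am : a <= m <= b by rewrite /m; lra.
have cn : c <= n <= d by rewrite /n; lra.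
have e1 : m - a = (b - a) / 2 by rewrite /m; field.
have e2 : b - m = (b - a) / 2 by rewrite /m; field.
have e3 : n - c = (d - c) / 2 by rewrite /n; field.
have e4 : d - n = (d - c) / 2 by rewrite /n; field.
move/andP: am => [m1 m2]; move/andP: cn => [n1 n2].
have [h1|h1] := leP B (4 * cabs (bdint f a m c n)).
  by exists a, m, c, n; split.
have [h2|h2] := leP B (4 * cabs (bdint f m b c n)).
  by exists m, b, c, n; split.
have [h3|h3] := leP B (4 * cabs (bdint f a m n d)).
  by exists a, m, n, d; split.
exists m, b, n, d; split=> //=.
by move: S h1 h2 h3; rewrite /B; lra.
Qed.

(** Repeated bisection: the integral is multiplied by at least 1/4 at each step,
    while bdint_local makes it o(4^-n) around the point common to all rectangles. *)
Lemma goursat f a b c d : continuous f -> a <= b -> c <= d ->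
  (forall x y, a <= x <= b -> c <= y <= d -> exists l, pdiff f (xy x y) l 0) ->
  bdint f a b c d = 0.
Proof.
move=> cf ab cd df.
pose ok (T : rect) := let: (a, b, c, d) := T in a <= b /\ c <= d.
pose bd (T : rect) : C := let: (a, b, c, d) := T in bdint f a b c d.
pose half (T T' : rect) := let: (a, b, c, d) := T in let: (a', b', c', d') := T' in
  [/\ a <= a' /\ b' <= b, c <= c' /\ d' <= d,
      b' - a' = (b - a) / 2, d' - c' = (d - c) / 2 & cabs (bd T) <= 4 * cabs (bd T')].
have halfP (T : rect) : exists T', ok T -> half T T'.
  case: (pselect (ok T)) => [|no]; last by exists T.
  case: T => [[[a1 b1] c1] d1] [ab1 cd1].
  have [a2 [b2 [c2 [d2 h]]]] := bdint_quarter f ab1 cd1.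
  by exists (a2, b2, c2, d2).
have [next nextP] := choice halfP.
pose T n := iter n next (a, b, c, d).
have okT n : ok (T n).
  elim: n => [//|n IH]; have := nextP _ IH; rewrite /T /= -/(T n).
  case: (T n) IH => [[[a1 b1] c1] d1] /= [i1 i2].
  by case: (next _) => [[[a2 b2] c2] d2] [_ _ h1 h2 _]; split; lra.
pose A n : R := (T n).1.1.1; pose B n : R := (T n).1.1.2.
pose Cc n : R := (T n).1.2; pose D n : R := (T n).2.
have step n : half (A n, B n, Cc n, D n) (A n.+1, B n.+1, Cc n.+1, D n.+1).
  have := nextP _ (okT n); rewrite /A /B /Cc /D /= -/(T n).
  by case: (T n) => [[[a1 b1] c1] d1] /=; case: (next _) => [[[a2 b2] c2] d2].
have ok' n : A n <= B n /\ Cc n <= D n.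
  by have := okT n; rewrite /A /B /Cc /D; case: (T n) => [[[a1 b1] c1] d1].
have wA n : B n - A n = (b - a) / 2 ^+ n.
  elim: n => [|n IH]; first by rewrite expr0 divr1.
  by have [_ _ -> _ _] := step n; rewrite IH exprS; field; rewrite expf_neq0.
have wC n : D n - Cc n = (d - c) / 2 ^+ n.
  elim: n => [|n IH]; first by rewrite expr0 divr1.
  by have [_ _ _ -> _] := step n; rewrite IH exprS; field; rewrite expf_neq0.
have big n : cabs (bdint f a b c d) <= 4 ^+ n * cabs (bdint f (A n) (B n) (Cc n) (D n)).
  elim: n => [|n IH]; first by rewrite expr0 mul1r.
  apply: le_trans IH _; rewrite exprSr -mulrA.
  by have [_ _ _ _ h] := step n; apply: ler_wpM2l => //; rewrite exprn_ge0.
have monoA n m : (n <= m)%N -> A n <= A m /\ B m <= B n.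
  move/subnK => <-; elim: (m - n)%N => [|j [IH1 IH2]]; first by rewrite add0n.
  have [[h1 h2] _ _ _ _] := step (j + n)%N.
  by rewrite addSn; split; [apply: le_trans IH1 h1 | apply: le_trans h2 IH2].
have monoC n m : (n <= m)%N -> Cc n <= Cc m /\ D m <= D n.
  move/subnK => <-; elim: (m - n)%N => [|j [IH1 IH2]]; first by rewrite add0n.
  have [_ [h1 h2] _ _ _] := step (j + n)%N.
  by rewrite addSn; split; [apply: le_trans IH1 h1 | apply: le_trans h2 IH2].
have nest (L U : nat -> R) : (forall n m, (n <= m)%N -> L n <= L m /\ U m <= U n) ->
    (forall n, L n <= U n) -> exists x, forall n, L n <= x <= U n.
  move=> mono lu.
  have cross n m : L n <= U m.
    have [h1 _] := mono n (maxn n m) (leq_maxl _ _).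
    have [_ h2] := mono m (maxn n m) (leq_maxr _ _).
    exact: le_trans h1 (le_trans (lu _) h2).
  have ubd : has_ubound (range L) by exists (U 0%N) => _ [n _ <-]; exact: cross.
  exists (sup (range L)) => n; apply/andP; split.
    by apply: ub_le_sup => //; exists n.
  apply: ge_sup; first by exists (L 0%N); exists 0%N.
  by move=> _ [m _ <-]; exact: cross.
have [p hp] := nest A B monoA (fun n => (ok' n).1).
have [q hq] := nest Cc D monoC (fun n => (ok' n).2).
have [l dl] := df p q (hp 0%N) (hq 0%N).
set L := b - a + (d - c); have L0 : 0 <= L by rewrite /L; lra.
apply/eqP; rewrite -cabs_eq0; apply/eqP/le_anti; rewrite cabs_ge0 andbT.
apply/ler_addgt0Pr => e e0; rewrite add0r.
(* The bounds 4^n and (L / 2^n)^2 compensate each other. *)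
pose e1 := e / (2 * L ^+ 2 + 1).
have P0 : 0 < 2 * L ^+ 2 + 1 by have := sqr_ge0 L; lra.
have e10 : 0 < e1 by rewrite divr_gt0.
have [dd dd0 loc] := bdint_local cf e10 dl.
have [n hn] : exists n, L / 2 ^+ n < dd.
  exists (Num.trunc (L / dd)).+1; set N := Num.trunc _.
  have /andP[_ tn] : N%:R <= L / dd < N.+1%:R by apply: truncn_itv; rewrite divr_ge0 // ltW.
  rewrite ltr_pdivrMr ?exprn_gt0 //; move: tn; rewrite ltr_pdivrMr // => /lt_trans.
  rewrite (mulrC dd); apply; rewrite ltr_pM2r //.
  by rewrite -natrX ltr_nat ltn_expl.
have w : B n - A n + (D n - Cc n) = L / 2 ^+ n by rewrite wA wC /L -mulrDl.
have := loc (A n) (B n) (Cc n) (D n); rewrite reC_xy imC_xy w => /(_ (hp n) (hq n) hn).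
move=> hb; apply: le_trans (big n) _.
have : 4 ^+ n * cabs (bdint f (A n) (B n) (Cc n) (D n)) <= 4 ^+ n * (e1 * (2 * (L / 2 ^+ n) ^+ 2)).
  by apply: ler_wpM2l => //; rewrite exprn_ge0.
move/le_trans; apply.
have -> : 4 ^+ n * (e1 * (2 * (L / 2 ^+ n) ^+ 2)) = e1 * (2 * L ^+ 2).
  have -> : (4 : R) = 2 * 2 by ring.
  by rewrite exprMn; field; rewrite expf_neq0.
rewrite /e1 mulrAC ler_pdivrMr //; have := sqr_ge0 L; nra.
Qed.

End Goursat.

(** * Goursat with an exceptional point, and primitives on squares *)

Section Cauchy.
Context {R : realType}.
Local Notation C := (Cplx R).
Implicit Types (f k : C -> C) (a b c d x y r : R).

Definition insquare (z0 : C) r (z : C) : Prop :=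
  `|reC z - reC z0| < r /\ `|imC z - imC z0| < r.

Lemma hol_div (phi psi : C -> C) z (p q : C) : psi z != 0 ->
  pdiff phi z p 0 -> pdiff psi z q 0 ->
  pdiff (fun w => phi w / psi w) z ((p * psi z - phi z * q) / psi z ^+ 2) 0.
Proof.
move=> nz h1 h2; have h3 := pdiff_comp (pdiff_inv nz) h2.
by have := pdiffM h1 h3; apply: pdiff_ext; rewrite ?conj0; field.
Qed.

Lemma goursat_signed k a b c d : continuous k ->
  (forall x y, Num.min a b <= x <= Num.max a b -> Num.min c d <= y <= Num.max c d ->
    exists l, pdiff k (xy x y) l 0) -> bdint k a b c d = 0.
Proof.
move=> ck; wlog ab : a b / a <= b.
  move=> W H; have [/W|/ltW ba] := leP a b; first exact.
  apply: oppr_inj; rewrite oppr0 -bdint_swapl; apply: W => //.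
  by rewrite minC maxC.
wlog cd : c d / c <= d.
  move=> W H; have [/W|/ltW dc] := leP c d; first exact.
  apply: oppr_inj; rewrite oppr0 -bdint_swapr; apply: W => //.
  by rewrite (minC d) (maxC d).
rewrite (min_idPl ab) (max_idPr ab) (min_idPl cd) (max_idPr cd).
exact: goursat.
Qed.

Lemma subsegment_near p b s x : b != p -> 0 < s -> s < 1 ->
  Num.min p (p + s * (b - p)) <= x <= Num.max p (p + s * (b - p)) ->
  Num.min p b <= x <= Num.max p b.
Proof.
move=> bp s0 s1; have [pb|pb|e1] := ltgtP p b; last by rewrite e1 eqxx in bp.
  have h1 : 0 < s * (b - p) by rewrite mulr_gt0 // subr_gt0.
  have h2 : 0 < (1 - s) * (b - p) by rewrite mulr_gt0 // subr_gt0.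
  have b3 : p <= p + s * (b - p) by lra.
  by rewrite (min_idPl b3) (max_idPr b3) => /andP[x1 x2]; lra.
have h1 : 0 < s * (p - b) by rewrite mulr_gt0 // subr_gt0.
have h2 : 0 < (1 - s) * (p - b) by rewrite mulr_gt0 // subr_gt0.
have b3 : p + s * (b - p) <= p by lra.
by rewrite (min_idPr b3) (max_idPl b3) => /andP[x1 x2]; lra.
Qed.

Lemma subsegment_far p b s x : b != p -> 0 < s -> s < 1 ->
  Num.min (p + s * (b - p)) b <= x <= Num.max (p + s * (b - p)) b ->
  x != p /\ Num.min p b <= x <= Num.max p b.
Proof.
move=> bp s0 s1; have [pb|pb|e1] := ltgtP p b; last by rewrite e1 eqxx in bp.
  have h1 : 0 < s * (b - p) by rewrite mulr_gt0 // subr_gt0.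
  have h2 : 0 < (1 - s) * (b - p) by rewrite mulr_gt0 // subr_gt0.
  have b3 : p + s * (b - p) <= b by lra.
  rewrite (min_idPl b3) (max_idPr b3) => /andP[x1 x2]; split; last lra.
  by rewrite gt_eqF //; lra.
have h1 : 0 < s * (p - b) by rewrite mulr_gt0 // subr_gt0.
have h2 : 0 < (1 - s) * (p - b) by rewrite mulr_gt0 // subr_gt0.
have b3 : b <= p + s * (b - p) by lra.
rewrite (min_idPr b3) (max_idPl b3) => /andP[x1 x2]; split; last lra.
by rewrite lt_eqF //; lra.
Qed.

(** The rectangle minus a small one at the corner w is a union of two rectangles
    that avoid w, to which Goursat's lemma applies; by continuity at w the integral
    over the small one is of the order of its diameter. *)
Lemma bdint_corner k (w : C) b d : continuous k ->
  (forall x y, Num.min (reC w) b <= x <= Num.max (reC w) b ->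
     Num.min (imC w) d <= y <= Num.max (imC w) d -> xy x y != w ->
     exists l, pdiff k (xy x y) l 0) -> bdint k (reC w) b (imC w) d = 0.
Proof.
set p := reC w; set q := imC w => ck H.
have [->|bp] := eqVneq b p; first exact: bdint_degl.
have [->|dq] := eqVneq d q; first exact: bdint_degr.
have neqw x y : (x != p) || (y != q) -> xy x y != w.
  apply: contraTneq => /[dup] /(congr1 (@reC R)) + /(congr1 imC).
  by rewrite reC_xy imC_xy => -> ->; rewrite !eqxx.
have [dl dl0 hdl] : exists2 dl : R, 0 < dl & forall z, cabs (z - w) < dl -> cabs (k z - k w) < 1.
  have /cvgCP/(_ _ ltr01)/nbhsCP[dl dl0 hdl] := ck w.
  by exists dl.
pose M := cabs (k w) + 1; have M0 : 0 < M by rewrite /M; have := cabs_ge0 (k w); lra.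
pose S := `|b - p| + `|d - q|.
have S0 : 0 < S by rewrite /S ltr_wpDr // normr_gt0 subr_eq0.
apply/eqP; rewrite -cabs_eq0; apply/eqP/le_anti; rewrite cabs_ge0 andbT.
apply/ler_addgt0Pr => e e0; rewrite add0r.
(* The ratio of the small rectangle at w to the given one: it fits into the disc where k is
   bounded by M, and 2 M times its half perimeter is at most e. *)
pose s := Num.min (2^-1) (Num.min (dl / (2 * S)) (e / (2 * M * S))).
have s0 : 0 < s.
  rewrite !lt_min; apply/and3P; split; first by rewrite invr_gt0.
    by rewrite divr_gt0 // mulr_gt0.
  by rewrite divr_gt0 // !mulr_gt0.
have s1 : s < 1.
  by rewrite /s gt_min; apply/orP; left; lra.
have sdl : s * S <= dl / 2.
  have : s <= dl / (2 * S) by rewrite /s !ge_min lexx orbT.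
  move=> /(ler_wpM2r (ltW S0)) h; apply: le_trans h _.
  by rewrite le_eqVlt; apply/orP; left; apply/eqP; field; rewrite gt_eqF.
have se : s * (2 * M * S) <= e.
  have h : s <= e / (2 * M * S) by rewrite /s !ge_min lexx !orbT.
  by rewrite -ler_pdivlMr // !mulr_gt0.
pose b' := p + s * (b - p); pose d' := q + s * (d - q).
rewrite -(bdint_splitl k p b' b) (_ : bdint k b' b q d = 0); last first.
  apply: goursat_signed => // x y /(subsegment_far bp s0 s1)[xp hx] hy.
  by apply: H => //; apply: neqw; rewrite xp.
rewrite addr0 -(bdint_splitr k p b' q d' d) (_ : bdint k p b' d' d = 0); last first.
  apply: goursat_signed => // x y /(subsegment_near bp s0 s1) hx /(subsegment_far dq s0 s1)[yq hy].
  by apply: H => //; apply: neqw; rewrite yq orbT.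
rewrite addr0.
have small a1 b1 c1 d1 : a1 <= p <= b1 -> c1 <= q <= d1 -> b1 - a1 + (d1 - c1) <= s * S ->
    cabs (bdint k a1 b1 c1 d1) <= e.
  move=> /andP[h1 h2] /andP[h3 h4] h5.
  apply: (@le_trans _ _ (M * (2 * (b1 - a1 + (d1 - c1))))).
    apply: bdint_le; [exact: ck|exact: le_trans h1 h2|exact: le_trans h3 h4|].
    move=> x y /andP[x1 x2] /andP[y1 y2].
    have xw : cabs (xy x y - w) < dl.
      rewrite -(xyE w) xyB; apply: le_lt_trans (cabs_xy_le _ _) _.
      have : `|x - p| <= b1 - a1 by rewrite ler_norml; lra.
      have : `|y - q| <= d1 - c1 by rewrite ler_norml; lra.
      rewrite -/p -/q; lra.
    have := hdl _ xw; have := cabsD (k (xy x y) - k w) (k w); rewrite subrK /M; lra.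
  apply: le_trans se; have : M * (b1 - a1 + (d1 - c1)) <= M * (s * S).
    by apply: ler_wpM2l => //; exact: ltW.
  nra.
have nb : `|b' - p| = s * `|b - p|.
  by rewrite /b' addrC addKr normrM (gtr0_norm s0).
have nd : `|d' - q| = s * `|d - q|.
  by rewrite /d' addrC addKr normrM (gtr0_norm s0).
have sS : s * S = `|b' - p| + `|d' - q| by rewrite nb nd /S mulrDr.
have [x1|x1] := leP p b'; have [y1|y1] := leP q d'.
- apply: small; rewrite ?lexx ?x1 ?y1 // sS !ger0_norm ?subr_ge0 //.
- rewrite -cabsN -bdint_swapr; apply: small; rewrite ?lexx ?x1 ?(ltW y1) //.
  by rewrite sS ger0_norm ?subr_ge0 // ler0_norm ?subr_le0 ?(ltW y1) // opprB.
- rewrite -cabsN -bdint_swapl; apply: small; rewrite ?lexx ?y1 ?(ltW x1) //.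
  by rewrite sS ler0_norm ?subr_le0 ?(ltW x1) // opprB ger0_norm ?subr_ge0.
- rewrite -cabsN -bdint_swapl -cabsN -bdint_swapr.
  apply: small; rewrite ?lexx ?(ltW y1) ?(ltW x1) //.
  by rewrite sS !ler0_norm ?subr_le0 ?(ltW x1) ?(ltW y1) // !opprB.
Qed.

Lemma between_insquare u r a b x : `|a - u| < r -> `|b - u| < r ->
  Num.min a b <= x <= Num.max a b -> `|x - u| < r.
Proof.
rewrite !ltr_norml ge_min le_max => /andP[h1 h2] /andP[h3 h4] /andP[].
by move=> /orP[?|?] /orP[?|?]; apply/andP; split; lra.
Qed.

(** The lines through w cut the rectangle into pieces that have w as a corner. *)
Lemma bdint_punctured k (z0 w : C) r : continuous k -> insquare z0 r w ->
  (forall z, insquare z0 r z -> z != w -> exists l, pdiff k z l 0) ->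
  forall a b c d, `|a - reC z0| < r -> `|b - reC z0| < r ->
    `|c - imC z0| < r -> `|d - imC z0| < r -> bdint k a b c d = 0.
Proof.
move=> ck [w1 w2] H a b c d ha hb hc hd.
have cor b' d' : `|b' - reC z0| < r -> `|d' - imC z0| < r ->
    bdint k (reC w) b' (imC w) d' = 0.
  move=> h1 h2; apply: bdint_corner => // x y hx hy; apply: H.
  split; first by rewrite reC_xy; exact: between_insquare w1 h1 hx.
  by rewrite imC_xy; exact: between_insquare w2 h2 hy.
have E : bdint k a b c d = bdint k (reC w) b (imC w) d - bdint k (reC w) a (imC w) d -
    bdint k (reC w) b (imC w) c + bdint k (reC w) a (imC w) c.
  rewrite -(bdint_splitl k a (reC w) b c d).
  rewrite -(bdint_splitr k a (reC w) c (imC w) d) -(bdint_splitr k (reC w) b c (imC w) d).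
  rewrite (bdint_swapl k (reC w) a) (bdint_swapl k (reC w) a).
  by rewrite (bdint_swapr k (reC w) a (imC w) c) (bdint_swapr k (reC w) b (imC w) c); ring.
by rewrite E !cor //; ring.
Qed.

Lemma cint_near (phi : R -> C) a b (u : C) (e : R) : continuous phi ->
  (forall x, Num.min a b <= x <= Num.max a b -> cabs (phi x - u) <= e) ->
  cabs (cint a b phi - toC (b - a) * u) <= e * `|b - a|.
Proof.
move=> cphi; wlog ab : a b / a <= b.
  move=> W H; have [/W|/ltW ba] := leP a b; first exact.
  have := W b a ba; rewrite minC maxC => /(_ H).
  have -> : cint b a phi - toC (a - b) * u = - (cint a b phi - toC (b - a) * u).
    by rewrite cintN -(opprB b a) toCN; ring.
  by rewrite cabsN distrC.
rewrite (min_idPl ab) (max_idPr ab) => H.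
have ck : continuous (fun _ : R => u) by move=> x; exact: for_cst.
have E : cint a b phi - toC (b - a) * u = cint a b (fun x => phi x + -1 * u).
  by rewrite (cint_lin (-1) cphi ck ab) cint_cst // mulN1r.
rewrite E ger0_norm ?subr_ge0 //; apply: cint_le; [|exact: ab|].
  by move=> x; exact: (forD (cphi x) (forM (@for_cst R R x (-1)) (ck x))).
by move=> x hx; rewrite mulN1r; exact: H.
Qed.

(** The primitive is the integral along a horizontal and then a vertical segment
    from the centre; the hypothesis makes its increments integrals along segments
    that start at z. *)
Lemma square_primitive k (z0 : C) r : continuous k ->
  (forall a b c d, `|a - reC z0| < r -> `|b - reC z0| < r ->
    `|c - imC z0| < r -> `|d - imC z0| < r -> bdint k a b c d = 0) ->
  exists K, forall z, insquare z0 r z -> pdiff K z (k z) 0.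
Proof.
move=> ck H.
pose x0 := reC z0; pose y0 := imC z0.
pose K z := hside k x0 (reC z) y0 + 'i * vside k (reC z) y0 (imC z).
exists K => z [zx zy].
have r0 : 0 < r by apply: le_lt_trans zx; exact: normr_ge0.
have KB z' : insquare z0 r z' -> K z' - K z =
    hside k (reC z) (reC z') (imC z) + 'i * vside k (reC z') (imC z) (imC z').
  move=> [zx' zy'].
  have h0 : `|y0 - imC z0| < r by rewrite /y0 subrr normr0.
  have := H _ _ _ _ zx zx' h0 zy.
  rewrite /bdint /K /hside /vside.
  rewrite -(cintD x0 (reC z) (reC z')) -(cintD y0 (imC z) (imC z')).
  by move=> E0; rewrite -[RHS]addr0 -E0; ring.
split.
  by exists (cabs (k z)) => h; rewrite mul0r addr0 cabsM.
move=> e e0; have e2 : 0 < e / 2 by rewrite divr_gt0.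
have /cvgCP/(_ _ e2)/nbhsCP[dl dl0 hdl] := ck z.
exists (Num.min (dl / 2) (Num.min (r - `|reC z - x0|) (r - `|imC z - y0|))).
  by rewrite !lt_min divr_gt0 //= !subr_gt0 zx.
move=> h; rewrite !lt_min => /and3P[h1 h2 h3].
have hr := reC_le_cabs h; have hi := imC_le_cabs h.
have sq : insquare z0 r (z + h).
  rewrite /insquare !reCD !imCD; split.
    have := ler_normD (reC z - x0) (reC h); rewrite addrAC -/x0; lra.
  have := ler_normD (imC z - y0) (imC h); rewrite addrAC -/y0; lra.
rewrite (KB _ sq) mul0r addr0 reCD imCD.
have near x y : `|x - reC z| <= cabs h -> `|y - imC z| <= cabs h -> cabs (k (xy x y) - k z) <= e / 2.
  move=> hx hy; apply/ltW/hdl; rewrite -(xyE z) xyB.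
  by apply: le_lt_trans (cabs_xy_le _ _) _; lra.
have n1 := @cint_near (fun x => k (xy x (imC z))) (reC z) (reC z + reC h) (k z) (e / 2) (continuous_rowx ck).
have n2 := @cint_near (fun y => k (xy (reC z + reC h) y)) (imC z) (imC z + imC h) (k z) (e / 2) (continuous_colx ck).
have bw u v x : Num.min u (u + v) <= x <= Num.max u (u + v) -> `|x - u| <= `|v|.
  have [v0|v0] := leP 0 v.
    have uv : u <= u + v by lra.
    by rewrite (min_idPl uv) (max_idPr uv) => /andP[? ?]; rewrite (ger0_norm v0) ler_norml; lra.
  have uv : u + v <= u by lra.
  by rewrite (min_idPr uv) (max_idPl uv) => /andP[? ?]; rewrite (ltr0_norm v0) ler_norml; lra.
have {}n1 := n1 _; have {n1}/= : cabs (hside k (reC z) (reC z + reC h) (imC z) - toC (reC h) * k z) <= e / 2 * `|reC h|.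
  have := n1; rewrite (addrC (reC z)) addrK (addrC (reC h)); apply=> x /bw hx.
  by apply: near; [exact: le_trans hx hr | rewrite subrr normr0 cabs_ge0].
have {n2} : cabs (vside k (reC z + reC h) (imC z) (imC z + imC h) - toC (imC h) * k z) <= e / 2 * `|imC h|.
  have := n2; rewrite (addrC (imC z)) addrK (addrC (imC h)); apply=> y /bw hy.
  by apply: near; [rewrite addrC addKr | exact: le_trans hy hi].
set A := hside _ _ _ _; set B := vside _ _ _ _ => q2 q1.
have -> : A + 'i * B - k z * h = (A - toC (reC h) * k z) + 'i * (B - toC (imC h) * k z).
  by rewrite [in LHS](CsplitE h); ring.
apply: le_trans (cabsD _ _) _; rewrite cabsM cabsi mul1r.
nra.
Qed.

End Cauchy.

(** * The derivative of a holomorphic function is holomorphic *)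

Section HolomorphicDerivative.
Context {R : realType}.
Local Notation C := (Cplx R).
Implicit Types (f k : C -> C) (a b c d r t : R).

Definition circle (z0 : C) r t : C := z0 + toC r * xy (cos t) (sin t).

Lemma rdiff_circle (z0 : C) r t : rdiff (circle z0 r) t ('i * (circle z0 r t - z0)).
Proof.
have dc := rdiff_toC (is_derive_cos t); have ds := rdiff_toC (is_derive_sin t).
have D := rdiffD (rdiff_cst t z0) (rdiffZ (toC r) (rdiffD dc (rdiffZ 'i ds))).
suff <- : 0 + toC r * (toC (- sin t) + 'i * toC (cos t)) = 'i * (circle z0 r t - z0) :> C.
  exact: D.
have ii : 'i * 'i = -1 :> C by rewrite -expr2 sqrCi.
rewrite /circle /xy toCN.
have -> : 'i * (z0 + toC r * (toC (cos t) + 'i * toC (sin t)) - z0) =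
  toC r * ('i * toC (cos t) + 'i * 'i * toC (sin t)) by ring.
by rewrite ii; ring.
Qed.

Lemma circle_continuous (z0 : C) r : continuous (circle z0 r).
Proof. by move=> t; exact: rdiff_continuous (rdiff_circle z0 r t). Qed.

Lemma cabs_circle (z0 : C) r t : 0 <= r -> cabs (circle z0 r t - z0) = r.
Proof.
move=> r0; rewrite /circle (addrC z0) addrK cabsM cabs_toC ger0_norm //.
by rewrite cabs_sqrt reC_xy imC_xy cos2Dsin2 sqrtr1 mulr1.
Qed.

Lemma circle_2pi (z0 : C) r : circle z0 r (2 * pi) = circle z0 r 0.
Proof. by rewrite /circle mulr_natl cos2pi sin2pi cos0 sin0. Qed.

(** What is needed to differentiate w |-> ka (zeta - w) under an integral sign,
    uniformly in zeta at distance at least d from w. *)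
Definition kernel_expansion (ka ka' : C -> C) :=
  forall d, 0 < d -> exists2 B : R, 0 <= B & forall u h : C,
    d <= cabs u -> cabs h <= d / 2 -> cabs (ka (u - h) - ka u - h * ka' u) <= B * cabs h ^+ 2.

Lemma kernel_inv : kernel_expansion (fun u => u^-1) (fun u => u ^- 2).
Proof.
move=> d d0; exists (2 / d ^+ 3); first by rewrite divr_ge0 // exprn_ge0 // ltW.
move=> u h du hd.
have u0 : 0 < cabs u by apply: lt_le_trans du.
have uh : d / 2 <= cabs (u - h) by have := cabs_lB u h; lra.
have uh0 : u - h != 0 by rewrite -cabs_gt0; lra.
have un0 : u != 0 by rewrite -cabs_gt0.
have -> : (u - h)^-1 - u^-1 - h * u ^- 2 = h ^+ 2 * (u ^+ 2 * (u - h))^-1.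
  by field; rewrite un0 uh0.
rewrite cabsM mulrC cabsX; apply: ler_wpM2r; first exact: sqr_ge0.
rewrite cabsV cabsM cabsX.
have -> : 2 / d ^+ 3 = (d ^+ 2 * (d / 2))^-1 by field; rewrite gt_eqF.
rewrite lef_pV2 ?posrE ?mulr_gt0 ?exprn_gt0 ?cabs_gt0 ?divr_gt0 //.
apply: ler_pM => //; first by rewrite exprn_ge0 // ltW.
  by rewrite divr_ge0 // ltW.
by rewrite ler_pXn2r // nnegrE ltW.
Qed.

Lemma kernel_inv2 : kernel_expansion (fun u => u ^- 2) (fun u => 2 * u ^- 3).
Proof.
move=> d d0; exists (16 / d ^+ 4); first by rewrite divr_ge0 // exprn_ge0 // ltW.
move=> u h du hd.
have u0 : 0 < cabs u by apply: lt_le_trans du.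
have uh : cabs u / 2 <= cabs (u - h) by have := cabs_lB u h; lra.
have uh0 : u - h != 0 by rewrite -cabs_gt0; lra.
have un0 : u != 0 by rewrite -cabs_gt0.
have -> : (u - h) ^- 2 - u ^- 2 - h * (2 * u ^- 3) =
   h ^+ 2 * ((3 * u - 2 * h) * (u ^+ 3 * (u - h) ^+ 2)^-1).
  by field; rewrite un0 uh0.
rewrite cabsM mulrC cabsX; apply: ler_wpM2r; first exact: sqr_ge0.
rewrite cabsM cabsV cabsM !cabsX.
have n1 : cabs (3 * u - 2 * h) <= 4 * cabs u.
  by have := cabsB (3 * u) (2 * h); rewrite !cabsM !cabs_nat; lra.
have n2 : cabs u ^+ 5 / 4 <= cabs u ^+ 3 * cabs (u - h) ^+ 2.
  have -> : cabs u ^+ 5 / 4 = cabs u ^+ 3 * (cabs u / 2) ^+ 2 by field.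
  apply: ler_wpM2l; first by rewrite exprn_ge0 // ltW.
  by rewrite ler_pXn2r // nnegrE ?cabs_ge0 // divr_ge0 // cabs_ge0.
have n3 : (cabs u ^+ 3 * cabs (u - h) ^+ 2)^-1 <= (cabs u ^+ 5 / 4)^-1.
  rewrite lef_pV2 // posrE; first by rewrite mulr_gt0 // exprn_gt0 // cabs_gt0.
  by rewrite divr_gt0 // exprn_gt0.
apply: (@le_trans _ _ (4 * cabs u * (cabs u ^+ 5 / 4)^-1)).
  apply: ler_pM => //; first exact: cabs_ge0.
  by rewrite invr_ge0 mulr_ge0 // exprn_ge0 // cabs_ge0.
have -> : 4 * cabs u * (cabs u ^+ 5 / 4)^-1 = 16 / cabs u ^+ 4 by field; rewrite gt_eqF.
apply: ler_wpM2l => //; rewrite lef_pV2 ?posrE ?exprn_gt0 //.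
by rewrite ler_pXn2r // nnegrE ltW.
Qed.

Lemma path_bounded (m : R -> C) a b : a <= b -> continuous m ->
  exists2 M : R, 0 <= M & forall t, a <= t <= b -> cabs (m t) <= M.
Proof.
move=> ab cm.
have c : {within `[a, b], continuous (fun t => cabs (m t))}.
  apply: continuous_subspaceT => t.
  by apply: continuous_comp; [exact: cm | exact: cabs_continuous].
have [t0 _ H] := EVT_max ab c.
exists (cabs (m t0)); first exact: cabs_ge0.
by move=> t ht; apply: H; rewrite in_itv.
Qed.

Section Kernel.
Variables (z0 : C) (rho : R) (rho0 : 0 < rho).
Local Notation g := (circle z0 rho).
Let tau : R := 2 * pi.
Let tau0 : 0 <= tau. Proof. by rewrite /tau mulr_ge0 // pi_ge0. Qed.

Lemma circle_dist w t : cabs (w - z0) < rho -> rho - cabs (w - z0) <= cabs (g t - w).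
Proof.
move=> _; have := cabs_lB (g t - z0) (w - z0); rewrite cabs_circle ?(ltW rho0) //.
by have -> : g t - z0 - (w - z0) = g t - w by ring.
Qed.

Lemma circle_neq w t : cabs (w - z0) < rho -> g t - w != 0.
Proof. by move=> h; rewrite -cabs_gt0; have := circle_dist t h; lra. Qed.

Lemma circle_kernel_continuous w (m : R -> C) j : cabs (w - z0) < rho -> continuous m ->
  continuous (fun t => m t * (g t - w) ^- j).
Proof.
move=> h cm t; apply: (forM (cm t)).
have cw : {for t, continuous (fun _ : R => w)} by exact: for_cst.
have c1 : {for t, continuous (fun t => g t - w)} := forB (@circle_continuous z0 rho t) cw.
elim: j => [|j IH].
  rewrite (_ : (fun t => (g t - w) ^- 0) = (fun=> 1)); first exact: for_cst.
  by apply/funext => s; rewrite expr0 invr1.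
rewrite (_ : (fun t => (g t - w) ^- j.+1) = (fun t => (g t - w)^-1 * (g t - w) ^- j)).
  exact: (forM (@forV R R t (fun t => g t - w) (circle_neq t h) c1) IH).
by apply/funext => s; rewrite exprS invfM.
Qed.

Lemma kernel_pdiff (ka ka' : C -> C) (m : R -> C) w : kernel_expansion ka ka' ->
  continuous m -> cabs (w - z0) < rho ->
  (forall w, cabs (w - z0) < rho -> continuous (fun t => m t * ka (g t - w))) ->
  (forall w, cabs (w - z0) < rho -> continuous (fun t => m t * ka' (g t - w))) ->
  pdiff (fun w => cint 0 tau (fun t => m t * ka (g t - w))) w
    (cint 0 tau (fun t => m t * ka' (g t - w))) 0.
Proof.
move=> ke cm hw c1 c2; split.
  by exists (cabs (cint 0 tau (fun t => m t * ka' (g t - w)))) => h; rewrite mul0r addr0 cabsM.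
have [M M0 hM] := path_bounded tau0 cm.
set d := rho - cabs (w - z0); have d0 : 0 < d by rewrite subr_gt0.
have [B B0 hB] := ke _ d0.
move=> e e0; pose K := M * B * tau + 1.
have K0 : 0 < K.
  have : 0 <= M * B * tau by rewrite mulr_ge0 // mulr_ge0.
  by rewrite /K; move: (M * B * tau) => ?; lra.
exists (Num.min (d / 2) (e / K)); first by rewrite lt_min !divr_gt0.
move=> h; rewrite lt_min => /andP[h1 h2].
have hwh : cabs (w + h - z0) < rho.
  have -> : w + h - z0 = (w - z0) + h by ring.
  by apply: le_lt_trans (cabsD _ _) _; move: h1; rewrite /d; lra.
rewrite mul0r addr0.
pose D t := m t * ka (g t - (w + h)) + -1 * (m t * ka (g t - w)).
have cD : continuous D.
  move=> t; exact: (forD (c1 _ hwh t) (forM (@for_cst R R t (-1)) (c1 _ hw t))).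
pose D2 t := D t + - h * (m t * ka' (g t - w)).
have E : cint 0 tau (fun t => m t * ka (g t - (w + h))) - cint 0 tau (fun t => m t * ka (g t - w)) -
    cint 0 tau (fun t => m t * ka' (g t - w)) * h = cint 0 tau D2.
  rewrite /D2 (cint_lin _ cD (c2 _ hw) tau0) /D (cint_lin _ (c1 _ hwh) (c1 _ hw) tau0).
  by ring.
rewrite E; apply: (@le_trans _ _ (M * B * cabs h ^+ 2 * (tau - 0))).
  apply: cint_le; [|exact: tau0|].
    by move=> t; exact: (forD (cD t) (forM (@for_cst R R t (- h)) (c2 _ hw t))).
  move=> t /hM mt.
  have -> : D2 t = m t * (ka (g t - w - h) - ka (g t - w) - h * ka' (g t - w)).
    have e1 : g t - (w + h) = g t - w - h by ring.
    by rewrite /D2 /D e1; ring.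
  rewrite cabsM -mulrA; apply: ler_pM; rewrite ?cabs_ge0 //.
  by apply: hB; [exact: circle_dist | exact: ltW].
have hh := cabs_ge0 h.
have : cabs h * K <= e by rewrite -ler_pdivlMr // ltW.
rewrite /K subr0 expr2; nra.
Qed.

End Kernel.

Definition clampR (a r x : R) : R := Num.max (a - r) (Num.min (a + r) x).
Definition clampC (z0 : C) r z : C := xy (clampR (reC z0) r (reC z)) (clampR (imC z0) r (imC z)).

Lemma clampR_id a r x : `|x - a| <= r -> clampR a r x = x.
Proof.
rewrite ler_norml => /andP[h1 h2]; rewrite /clampR.
have h3 : x <= a + r by lra.
have h4 : a - r <= x by lra.
by rewrite (min_idPr h3) (max_idPr h4).
Qed.

Lemma clampR_in a r x : 0 <= r -> `|clampR a r x - a| <= r.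
Proof.
move=> r0; rewrite ler_norml /clampR.
by case: (leP (a + r) x) => h1; case: (leP (a - r)) => h2; lra.
Qed.

Lemma clampR_lip a r x y : 0 <= r -> `|clampR a r x - clampR a r y| <= `|x - y|.
Proof.
move=> r0; have h1 := ler_norm (x - y); have h2 := ler_norm (y - x).
rewrite (distrC y) in h2; rewrite ler_norml /clampR.
case: (leP (a + r) x) => h3; case: (leP (a + r) y) => h4.
- by case: (leP (a - r)) => h5; lra.
- by case: (leP (a - r) (a + r)) => h5; case: (leP (a - r) y) => h6; lra.
- by case: (leP (a - r) (a + r)) => h5; case: (leP (a - r) x) => h6; lra.
- by case: (leP (a - r) x) => h5; case: (leP (a - r) y) => h6; lra.
Qed.

Lemma clampC_id (z0 : C) r z : `|reC z - reC z0| <= r -> `|imC z - imC z0| <= r ->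
  clampC z0 r z = z.
Proof. by move=> h1 h2; rewrite /clampC !clampR_id // xyE. Qed.

Lemma clampC_continuous (z0 : C) r : 0 <= r -> continuous (clampC z0 r).
Proof.
move=> r0 z; apply/(@cvgCP _ _ (nbhs z)) => e e0; apply/nbhsCP.
exists (e / 2); first by rewrite divr_gt0.
move=> w wz; rewrite /clampC xyB; apply: le_lt_trans (cabs_xy_le _ _) _.
have := clampR_lip (reC z0) (reC w) (reC z) r0.
have := clampR_lip (imC z0) (imC w) (imC z) r0.
have := reC_le_cabs (w - z); have := imC_le_cabs (w - z); rewrite reCB imCB; lra.
Qed.

(** Extending f by its value at the nearest point of a small square makes it
    continuous on the whole plane, as the integrals above require. *)
Lemma hol_extend (U : set C) f (f' : C -> C) (z0 : C) : open U ->
  (forall z, U z -> pdiff f z (f' z) 0) -> U z0 ->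
  exists r, exists k, [/\ 0 < r, continuous k, forall z, insquare z0 r z -> U z,
     forall z, insquare z0 r z -> k z = f z &
     forall z, insquare z0 r z -> pdiff k z (f' z) 0].
Proof.
move=> oU df Uz0; have [e e0 he] := (openCP U).1 oU _ Uz0.
pose r := e / 4; have r0 : 0 < r by rewrite divr_gt0.
have sqU z : `|reC z - reC z0| <= r -> `|imC z - imC z0| <= r -> U z.
  move=> h1 h2; apply: he; rewrite -(xyE z) -(xyE z0) xyB.
  by apply: le_lt_trans (cabs_xy_le _ _) _; move: h1 h2; rewrite /r; lra.
exists r, (fun z => f (clampC z0 r z)).
have ceq z : insquare z0 r z -> clampC z0 r z = z.
  by move=> [h1 h2]; apply: clampC_id; exact: ltW.
split=> //.
- move=> z; apply: (@continuous_comp _ _ _ (clampC z0 r) f).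
    exact: (clampC_continuous (ltW r0)).
  apply: pdiff_continuous; apply: df; apply: sqU; rewrite ?reC_xy ?imC_xy;
  by apply: clampR_in; exact: ltW.
- by move=> z [h1 h2]; apply: sqU; exact: ltW.
- by move=> z /ceq ->.
- move=> z sz; have [h1 h2] := sz.
  have Uz : U z by apply: sqU; exact: ltW.
  apply: pdiff_near (df _ Uz); apply/nbhsCP.
  exists (Num.min (r - `|reC z - reC z0|) (r - `|imC z - imC z0|)).
    by rewrite lt_min !subr_gt0 h1.
  move=> w; rewrite lt_min => /andP[w1 w2]; rewrite ceq //.
  have := reC_le_cabs (w - z); have := imC_le_cabs (w - z); rewrite reCB imCB => i1 i2.
  split.
    have := ler_normD (reC w - reC z) (reC z - reC z0).
    by rewrite addrA subrK; lra.
  have := ler_normD (imC w - imC z) (imC z - imC z0).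
  by rewrite addrA subrK; lra.
Qed.

Lemma diffquot_hol k (w l z p : C) : z != w -> pdiff k z p 0 ->
  exists q, pdiff (fun z => if z == w then l else (k z - k w) / (z - w)) z q 0.
Proof.
move=> zw dk.
have d1 : pdiff (fun y => k y - k w) z p 0.
  by have := pdiffB dk (pdiff_cst z (k w)); rewrite !subr0.
have d2 : pdiff (fun y : C => y - w) z 1 0.
  by have := pdiffB (pdiff_id z) (pdiff_cst z w); rewrite !subr0.
have zw0 : z - w != 0 by rewrite subr_eq0.
exists ((p * (z - w) - (k z - k w) * 1) / (z - w) ^+ 2).
apply: pdiff_near (@hol_div R (fun y : C => k y - k w) (fun y : C => y - w) z p 1 zw0 d1 d2).
apply/nbhsCP.
exists (cabs (z - w)); first by rewrite cabs_gt0.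
move=> y yz; case: eqP => // yw; move: yz.
by rewrite yw cabsBC ltxx.
Qed.

Lemma diffquot_continuous k (w l : C) : continuous k -> pdiff k w l 0 ->
  continuous (fun z => if z == w then l else (k z - k w) / (z - w)).
Proof.
move=> ck [_ dk] z; have [->{z}|zw] := eqVneq z w.
  apply/(@cvgCP _ _ (nbhs w)) => e e0; rewrite eqxx.
  have e2 : 0 < e / 2 by rewrite divr_gt0.
  have [d d0 hd] := dk _ e2; apply/nbhsCP; exists d => // y yw.
  case: eqVneq => [_|ynw]; first by rewrite subrr cabs0.
  have := hd _ yw; rewrite mul0r addr0 (addrC w) subrK => h.
  have yw0 : y - w != 0 by rewrite subr_eq0.
  have -> : (k y - k w) / (y - w) - l = (k y - k w - l * (y - w)) / (y - w) by field.
  rewrite cabsM cabsV ltr_pdivrMr ?cabs_gt0 //; apply: le_lt_trans h _.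
  by rewrite ltr_pM2r ?cabs_gt0 //; lra.
have zw0 : z - w != 0 by rewrite subr_eq0.
pose q y := (k y - k w) / (y - w).
have cq : {for z, continuous q}.
  have c1 : {for z, continuous (fun y : C => k y - k w)} := forB (ck z) (@for_cst R C z (k w)).
  have c2 : {for z, continuous (fun y : C => y - w)}.
    by have := pdiffB (pdiff_id z) (pdiff_cst z w); exact: pdiff_continuous.
  exact: (forM c1 (@forV R C z (fun y => y - w) zw0 c2)).
move: cq => /(@cvgCP _ _ (nbhs z)) cq; apply/(@cvgCP _ _ (nbhs z)) => e /cq /nbhsCP[d d0 hd].
apply/nbhsCP; exists (Num.min d (cabs (z - w))); first by rewrite lt_min d0 cabs_gt0.
move=> y; rewrite lt_min => /andP[/hd h1 h2].
rewrite (negPf zw); case: eqVneq => // yw.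
by move: h2; rewrite yw cabsBC ltxx.
Qed.

(** Put N w = oint dzeta / (zeta - w) and J w = oint f dzeta / (zeta - w) on a small
    circle around z0. The difference quotient of f at w, completed by f' w, is
    continuous and holomorphic away from w, hence has a primitive; so its integral
    vanishes, which is J = f N. As N z0 = 2 pi 'i, near z0 the function f is the
    quotient J / N of two functions that can be differentiated twice under the
    integral sign. *)
Lemma hol_derivative_hol (U : set C) f (f' : C -> C) : open U ->
  (forall z, U z -> pdiff f z (f' z) 0) -> forall z, U z -> exists l, pdiff f' z l 0.
Proof.
move=> oU df z0 Uz0.
have [r [k [r0 ck sU kf dk]]] := hol_extend oU df Uz0.
pose rho := r / 2; have rho0 : 0 < rho by rewrite divr_gt0.
have tau0 : (0 : R) <= 2 * pi by rewrite mulr_ge0 // pi_ge0.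
pose g := circle z0 rho; pose g' t := 'i * (g t - z0).
have cg' : continuous g'.
  move=> t; have c1 := @circle_continuous z0 rho t.
  exact: (forM (@for_cst R R t 'i) (forB c1 (@for_cst R R t z0))).
have ckg : continuous (fun t => k (g t) * g' t).
  move=> t; have c1 : {for t, continuous (fun t => k (g t))}.
    by apply: (@continuous_comp _ _ _ g k); [exact: circle_continuous | exact: ck].
  exact: (forM c1 (cg' t)).
have nearsq w : cabs (w - z0) < r -> insquare z0 r w.
  move=> h; have := reC_le_cabs (w - z0); have := imC_le_cabs (w - z0).
  by rewrite reCB imCB => i1 i2; split; lra.
have gsq t : insquare z0 r (g t).
  by apply: nearsq; rewrite cabs_circle ?(ltW rho0) // /rho; lra.
pose J (m : R -> C) j w := cint 0 (2 * pi) (fun t => m t * (g t - w) ^- j).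
have cJ (m : R -> C) j w : continuous m -> cabs (w - z0) < rho -> continuous (fun t => m t * (g t - w) ^- j).
  by move=> cm h; exact: circle_kernel_continuous.
have J1 (m : R -> C) w : continuous m -> cabs (w - z0) < rho -> pdiff (J m 1%N) w (J m 2%N w) 0.
  move=> cm hw; apply: (kernel_pdiff rho0 kernel_inv cm hw) => v hv.
    exact: (cJ m 1%N v cm hv).
  exact: (cJ m 2%N v cm hv).
have J2 (m : R -> C) w : continuous m -> cabs (w - z0) < rho -> exists l, pdiff (J m 2%N) w l 0.
  move=> cm hw; exists (cint 0 (2 * pi) (fun t => m t * (2 * (g t - w) ^- 3))).
  apply: (kernel_pdiff rho0 kernel_inv2 cm hw) => v hv; first exact: (cJ m 2%N v cm hv).
  have -> : (fun t => m t * (2 * (g t - v) ^- 3)) = (fun t => (m t * 2) * (g t - v) ^- 3).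
    by apply/funext => t; rewrite mulrA.
  apply: (cJ (fun t => m t * 2) 3%N v _ hv) => t.
  exact: (forM (cm t) (@for_cst R R t 2)).
pose mk t := k (g t) * g' t.
have formula w : cabs (w - z0) < rho -> J mk 1%N w = f w * J g' 1%N w.
  move=> hw; have wr : cabs (w - z0) < r by move: hw; rewrite /rho; lra.
  have sw := nearsq w wr; pose q z := if z == w then f' w else (k z - k w) / (z - w).
  have cq : continuous q := diffquot_continuous ck (dk _ sw).
  have dq z : insquare z0 r z -> z != w -> exists l, pdiff q z l 0.
    by move=> /dk dz zw; exact: diffquot_hol zw dz.
  have [Q dQ] := square_primitive cq (bdint_punctured cq sw dq).
  have cqg : continuous (fun t => q (g t) * g' t).
    move=> t; have c1 : {for t, continuous (fun t => q (g t))}.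
      by apply: (@continuous_comp _ _ _ g q); [exact: circle_continuous | exact: cq].
    exact: (forM c1 (cg' t)).
  have D t : 0 <= t <= 2 * pi -> rdiff (fun t => Q (g t)) t (q (g t) * g' t).
    move=> _; have := rdiff_comp (dQ _ (gsq t)) (rdiff_circle z0 rho t).
    by rewrite mul0r addr0.
  have I0 := cint_FTC cqg tau0 D; rewrite /g circle_2pi subrr in I0.
  have E : (fun t => q (g t) * g' t) =
      (fun t => mk t * (g t - w) ^- 1 + - k w * (g' t * (g t - w) ^- 1)).
    apply/funext => t; have gw := circle_neq rho0 t hw.
    rewrite /q -subr_eq0 (negPf gw) /mk expr1; field.
    by rewrite gw.
  rewrite -/g E (cint_lin _ (cJ _ _ _ ckg hw) (cJ _ _ _ cg' hw) tau0) in I0.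
  rewrite -(kf _ sw); move/eqP: I0; rewrite mulNr subr_eq0 => /eqP.
  by [].
have N0 : J g' 1%N z0 != 0.
  have E : (fun t => g' t * (g t - z0) ^- 1) = (fun=> 'i).
    have h0 : cabs (z0 - z0) < rho by rewrite subrr cabs0.
    apply/funext => t; have gw := circle_neq rho0 t h0.
    by rewrite /g' expr1 mulfK.
  rewrite /J E cint_cst // subr0 mulf_neq0 ?neq0Ci // toC_eq0 mulf_neq0 //.
  by rewrite gt_eqF // pi_gt0.
have h0 : cabs (z0 - z0) < rho by rewrite subrr cabs0.
have cN := pdiff_continuous (J1 _ _ cg' h0).
have aN : 0 < cabs (J g' 1%N z0) by rewrite cabs_gt0.
have /(@cvgCP _ _ (nbhs z0))/(_ _ aN)/nbhsCP[d d0 hd] := cN.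
have Nn0 w : cabs (w - z0) < d -> J g' 1%N w != 0.
  move=> /hd; apply: contraTneq => ->; by rewrite sub0r cabsN ltxx.
pose F w := (J mk 2%N w * J g' 1%N w - J mk 1%N w * J g' 2%N w) / J g' 1%N w ^+ 2.
have F' : exists l, pdiff F z0 l 0.
  have [l1 d1] := J2 _ _ ckg h0; have [l2 d2] := J2 _ _ cg' h0.
  have d3 := J1 _ _ ckg h0; have d4 := J1 _ _ cg' h0.
  have [p A] : exists p, pdiff (fun w => J mk 2%N w * J g' 1%N w - J mk 1%N w * J g' 2%N w) z0 p 0.
    eexists; apply: pdiff_ext (pdiffB (pdiffM d1 d4) (pdiffM d3 d2)); first reflexivity.
    by ring.
  have [q B] : exists q, pdiff (fun w => J g' 1%N w ^+ 2) z0 q 0.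
    eexists; apply: pdiff_ext (pdiff_comp (pdiff_hol_sq (J g' 1%N z0)) d4); first reflexivity.
    by ring.
  have N2 : J g' 1%N z0 ^+ 2 != 0 by rewrite expf_neq0.
  eexists; exact: (@hol_div R (fun w => J mk 2%N w * J g' 1%N w - J mk 1%N w * J g' 2%N w)
    (fun w => J g' 1%N w ^+ 2) z0 p q N2 A B).
have [l dl] := F'; exists l; apply: pdiff_near dl; apply/nbhsCP.
exists (Num.min d rho); first by rewrite lt_min d0.
move=> w; rewrite lt_min => /andP[w1 w2].
have Nw := Nn0 _ w1.
have dw := @hol_div R (J mk 1%N) (J g' 1%N) w _ _ Nw (J1 _ _ ckg w2) (J1 _ _ cg' w2).
have dw' : pdiff f w (F w) 0.
  apply: pdiff_near dw; apply/nbhsCP.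
  exists (Num.min (d - cabs (w - z0)) (rho - cabs (w - z0))).
    by rewrite lt_min !subr_gt0 w1.
  move=> y; rewrite lt_min => /andP[y1 y2].
  have yz : cabs (y - z0) <= cabs (y - w) + cabs (w - z0).
    by have := cabsD (y - w) (w - z0); rewrite addrA subrK.
  have y3 : cabs (y - z0) < d by lra.
  have y4 : cabs (y - z0) < rho by lra.
  by rewrite (formula _ y4) mulfK // Nn0.
have wr : cabs (w - z0) < r by move: w2; rewrite /rho; lra.
by have [] := pdiff_uniq dw' (df _ (sU _ (nearsq _ wr))).
Qed.

End HolomorphicDerivative.

(** * Wirtinger derivatives of planar functions *)

Section PlanarSmooth.
Context {R : realType}.
Local Notation C := (Cplx R).
Implicit Types (phi psi p q : C -> C) (U : set C) (z : C).

(** The Wirtinger derivatives as total functions of the point, by choice. *)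
Definition pder phi z : C * C := xget (0, 0) [set pq | pdiff phi z pq.1 pq.2].
Definition pz phi z := (pder phi z).1.
Definition pzb phi z := (pder phi z).2.

Lemma pderE phi z (a b : C) : pdiff phi z a b -> pz phi z = a /\ pzb phi z = b.
Proof.
move=> H; rewrite /pz /pzb /pder; case: xgetP => [[a' b'] _ /= H'|/(_ (a, b))//].
exact: pdiff_uniq H' H.
Qed.
Lemma pzE phi z (a b : C) : pdiff phi z a b -> pz phi z = a.
Proof. by move=> /pderE[]. Qed.
Lemma pzbE phi z (a b : C) : pdiff phi z a b -> pzb phi z = b.
Proof. by move=> /pderE[]. Qed.

(** C^k regularity on a planar domain, in terms of the Wirtinger derivatives. *)
Fixpoint PCk (k : nat) U phi : Prop :=
  (forall z, U z -> {for z, continuous phi}) /\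
  if k is k'.+1 then
    (forall z, U z -> pdiff phi z (pz phi z) (pzb phi z)) /\
    PCk k' U (pz phi) /\ PCk k' U (pzb phi)
  else True.

Lemma PCk0 U phi : (forall z, U z -> {for z, continuous phi}) -> PCk 0 U phi.
Proof. by move=> c; split. Qed.

Lemma PCk_continuous k U phi : PCk k U phi -> forall z, U z -> {for z, continuous phi}.
Proof. by case: k => [|k] []. Qed.

Lemma PCk_pdiff k U phi : PCk k.+1 U phi -> forall z, U z -> pdiff phi z (pz phi z) (pzb phi z).
Proof. by case=> _ []. Qed.
Lemma PCk_pz k U phi : PCk k.+1 U phi -> PCk k U (pz phi).
Proof. by case=> _ [_ []]. Qed.
Lemma PCk_pzb k U phi : PCk k.+1 U phi -> PCk k U (pzb phi).
Proof. by case=> _ [_ []]. Qed.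

Lemma near_open U z : open U -> U z -> \forall w \near z, U w.
Proof. by move=> oU Uz; apply: open_nbhs_nbhs; split. Qed.

Lemma PCk_ext k U phi psi : open U -> (forall z, U z -> phi z = psi z) ->
  PCk k U phi -> PCk k U psi.
Proof.
move=> oU; elim: k phi psi => [|k IH] phi psi E.
  move=> [c _]; apply: PCk0 => z Uz.
  have N : \forall w \near z, phi w = psi w.
    by apply: filterS (near_open oU Uz) => w; exact: E.
  exact: (near_eq_continuous N (c z Uz)).
move=> [c [d [h1 h2]]].
have N z : U z -> \forall w \near z, phi w = psi w.
  by move=> Uz; apply: filterS (near_open oU Uz) => w; exact: E.
have D z : U z -> pdiff psi z (pz phi z) (pzb phi z).
  by move=> Uz; apply: pdiff_near (N _ Uz) (d _ Uz).
have D' z : U z -> pz psi z = pz phi z /\ pzb psi z = pzb phi z.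
  by move=> /D /pderE.
split; first by move=> z Uz; exact: near_eq_continuous (N _ Uz) (c _ Uz).
split; first by move=> z Uz; have [-> ->] := D' _ Uz; exact: D.
by split; [apply: IH h1 | apply: IH h2] => z /D'[e1 e2]; rewrite ?e1 ?e2.
Qed.

Lemma PCk_intro k U phi p q : open U -> (forall z, U z -> pdiff phi z (p z) (q z)) ->
  PCk k U p -> PCk k U q -> PCk k.+1 U phi.
Proof.
move=> oU H hp hq; split; first by move=> z /H; exact: pdiff_continuous.
split; first by move=> z /H d; have [-> ->] := pderE d.
by split; [apply: PCk_ext oU _ hp | apply: PCk_ext oU _ hq] => z /H /pderE[e1 e2]; rewrite ?e1 ?e2.
Qed.

Lemma PCk_le k U phi : PCk k.+1 U phi -> PCk k U phi.
Proof.
elim: k phi => [|k IH] phi; first by case=> c _.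
by move=> [c [d [h1 h2]]]; split=> //; split=> //; split; apply: IH.
Qed.

Lemma PCk_local k U phi : (forall z, U z -> exists2 U', U' z & PCk k U' phi) -> PCk k U phi.
Proof.
elim: k phi => [|k IH] phi H.
  by split=> // z /H[U' Uz]; move/PCk_continuous; apply.
split; first by move=> z /H[U' Uz]; move/PCk_continuous; apply.
split; first by move=> z /H[U' Uz]; move/PCk_pdiff; apply.
by split; apply: IH => z /H[U' Uz]; [move/PCk_pz | move/PCk_pzb]; exists U'.
Qed.

Section Closure.
Variables (U : set C) (oU : open U).

Lemma PCk_cst k (a : C) : PCk k U (fun=> a).
Proof.
elim: k a => [|k IH] a; first by apply: PCk0 => z _; exact: for_cst.
apply: (@PCk_intro _ _ _ (fun=> 0) (fun=> 0)) => // z _; exact: pdiff_cst.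
Qed.

Lemma PCk_id k : PCk k U id.
Proof.
case: k => [|k]; first by apply: PCk0 => z _; exact: pdiff_continuous (pdiff_id z).
apply: (@PCk_intro _ _ _ (fun=> 1) (fun=> 0)); [exact: oU | | exact: PCk_cst | exact: PCk_cst].
move=> z _; exact: pdiff_id.
Qed.

Lemma PCkD k phi psi : PCk k U phi -> PCk k U psi -> PCk k U (fun z => phi z + psi z).
Proof.
elim: k phi psi => [|k IH] phi psi.
  by move=> [c1 _] [c2 _]; apply: PCk0 => z Uz; exact: (forD (c1 _ Uz) (c2 _ Uz)).
move=> [_ [d1 [p1 q1]]] [_ [d2 [p2 q2]]].
apply: (PCk_intro oU _ (IH _ _ p1 p2) (IH _ _ q1 q2)) => z Uz.
exact: (pdiffD (d1 _ Uz) (d2 _ Uz)).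
Qed.

Lemma PCkM k phi psi : PCk k U phi -> PCk k U psi -> PCk k U (fun z => phi z * psi z).
Proof.
elim: k phi psi => [|k IH] phi psi.
  by move=> [c1 _] [c2 _]; apply: PCk0 => z Uz; exact: (forM (c1 _ Uz) (c2 _ Uz)).
move=> h1 h2; have l1 := PCk_le h1; have l2 := PCk_le h2.
move: h1 h2 => [_ [d1 [p1 q1]]] [_ [d2 [p2 q2]]].
apply: (PCk_intro oU _ (PCkD (IH _ _ p1 l2) (IH _ _ l1 p2)) (PCkD (IH _ _ q1 l2) (IH _ _ l1 q2))) => z Uz.
exact: (pdiffM (d1 _ Uz) (d2 _ Uz)).
Qed.

Lemma PCk_conj k phi : PCk k U phi -> PCk k U (fun z => Num.conj (phi z)).
Proof.
elim: k phi => [|k IH] phi.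
  by move=> [c1 _]; apply: PCk0 => z Uz; exact: (for_conj (c1 _ Uz)).
move=> [_ [d1 [p1 q1]]].
apply: (PCk_intro oU _ (IH _ q1) (IH _ p1)) => z Uz.
exact: (pdiff_conj (d1 _ Uz)).
Qed.

Lemma PCkN k phi : PCk k U phi -> PCk k U (fun z => - phi z).
Proof.
move=> h; apply: PCk_ext (PCkM (PCk_cst k (-1)) h); first exact: oU.
by move=> z _; rewrite mulN1r.
Qed.

Lemma PCkB k phi psi : PCk k U phi -> PCk k U psi -> PCk k U (fun z => phi z - psi z).
Proof. by move=> h1 /PCkN h2; exact: PCkD h1 h2. Qed.

Lemma PCkV k phi : (forall z, U z -> phi z != 0) -> PCk k U phi -> PCk k U (fun z => (phi z)^-1).
Proof.
move=> n0; elim: k phi n0 => [|k IH] phi n0.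
  by move=> [c1 _]; apply: PCk0 => z Uz; exact: (forV (n0 _ Uz) (c1 _ Uz)).
move=> h; have l := IH _ n0 (PCk_le h); move: h => [_ [d1 [p1 q1]]].
apply: (PCk_intro oU _ (PCkM (PCkN (PCkM l l)) p1) (PCkM (PCkN (PCkM l l)) q1)) => z Uz.
apply: pdiff_ext (pdiff_comp (pdiff_inv (n0 _ Uz)) (d1 _ Uz)).
  by rewrite mul0r addr0 expr2 invfM.
by rewrite mul0r addr0 expr2 invfM.
Qed.

Lemma PCk_sum k (I : Type) (r : seq I) (F : I -> C -> C) :
  (forall i, PCk k U (F i)) -> PCk k U (fun z => \sum_(i <- r) F i z).
Proof.
move=> H; elim: r => [|i r IH].
  by apply: PCk_ext (PCk_cst k 0); [exact: oU | move=> z _; rewrite big_nil].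
by apply: PCk_ext (PCkD (H i) IH); [exact: oU | move=> z _; rewrite big_cons].
Qed.

Lemma PCk_hol k (f f' : C -> C) : (forall z, U z -> pdiff f z (f' z) 0) -> PCk k U f.
Proof.
elim: k f f' => [|k IH] f f' H.
  by apply: PCk0 => z Uz; exact: pdiff_continuous (H _ Uz).
apply: (PCk_intro oU H) (PCk_cst k 0).
have H2 z : exists l, U z -> pdiff f' z l 0.
  have [Uz|nU] := pselect (U z); last by exists 0.
  by have [l hl] := hol_derivative_hol oU H Uz; exists l.
by have [f'' hf] := choice H2; exact: (IH f' f'').
Qed.

End Closure.

Lemma pz_near phi psi z : (\forall w \near z, phi w = psi w) -> pz phi z = pz psi z /\ pzb phi z = pzb psi z.
Proof.
move=> E; have E' : \forall w \near z, psi w = phi w by apply: filterS E.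
have S : [set pq | pdiff phi z pq.1 pq.2] = [set pq | pdiff psi z pq.1 pq.2].
  by apply/seteqP; split=> pq /=; apply: pdiff_near.
by rewrite /pz /pzb /pder S.
Qed.

End PlanarSmooth.

(** * Calculus in several complex variables *)

Section SeveralVariables.
Context {R : realType} {n : nat}.
Local Notation C := (Cplx R).
Local Notation Cn := 'rV[C]_n.
Implicit Types (F G : Cn -> C) (V : set Cn) (v z w : Cn).

Lemma nbhs_rowP z (A : set Cn) : nbhs z A <->
  exists2 e : R, 0 < e & forall y : Cn, (forall a, cabs (y 0 a - z 0 a) < e) -> A y.
Proof.
split.
  case/nbhs_ballP => e /= e0 eA; have [e0' ime] := gt0C e0.
  exists (reC e) => // y yz; apply: eA; split=> [//|i a]; rewrite (ord1 i).
  rewrite /ball /= cabsE cabsBC.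
  have -> : e = toC (reC e) by apply: Cext.
  by rewrite -subr_gt0 -toCB toC_gt0 subr_gt0; exact: yz.
case=> e e0 eA; apply/nbhs_ballP; exists (toC e) => /=; first by rewrite toC_gt0.
move=> y [_ yz]; apply: eA => a; have := yz 0 a.
by rewrite /ball /= cabsE cabsBC -subr_gt0 -toCB toC_gt0 subr_gt0.
Qed.

Lemma rquot_rdiff v F z l :
  rquot v F z h @[h --> (0 : R)^'] --> l <-> rdiff (fun s => F (z + toC s *: v)) 0 l.
Proof.
have E h : h != 0 -> F (z + toC (0 + h) *: v) - F (z + toC 0 *: v) - toC h * l =
    toC h * (rquot v F z h - l).
  move=> h0; rewrite add0r toC0 scale0r addr0 /rquot mulrBr mulrA -toCM divff //.
  by rewrite toC1 mul1r.
split.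
  move=> /cvgCP H; split; first by exists (cabs l) => h; rewrite cabsM cabs_toC mulrC.
  move=> e /H; rewrite near_withinE => /nbhs_ballP[d /= d0 hd]; exists d => // h hh.
  have [->|h0] := eqVneq h 0.
    by rewrite addr0 subrr toC0 mul0r subr0 cabs0 normr0 mulr0.
  rewrite E // cabsM cabs_toC mulrC; apply: ler_wpM2r => //; apply/ltW/hd => //.
  by rewrite /ball /= sub0r normrN.
move=> [_ H]; apply/cvgCP => e e0; have e2 : 0 < e / 2 by rewrite divr_gt0.
have [d d0 hd] := H _ e2; rewrite near_withinE; apply/nbhs_ballP; exists d => //= h.
rewrite /ball /= sub0r normrN => /hd + h0; rewrite E // cabsM cabs_toC (mulrC `|h|).
by rewrite ler_pM2r ?normr_gt0 //; lra.
Qed.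

Lemma rderivable_rdiff v F z : rderivable v F z ->
  rdiff (fun s => F (z + toC s *: v)) 0 (rderive v F z).
Proof. by move=> H; apply/rquot_rdiff. Qed.

Lemma rdiff_rderivable v F z l : rdiff (fun s => F (z + toC s *: v)) 0 l ->
  rderivable v F z /\ rderive v F z = l.
Proof.
move=> /rquot_rdiff H; split; first by apply/cvg_ex; exists l.
by apply/cvg_lim => //; exact: norm_hausdorff.
Qed.

Lemma Ck0 V F : (forall z, V z -> {for z, continuous F}) -> Ck 0 V F.
Proof. by move=> c; split. Qed.

Lemma Ck_continuous k V F : Ck k V F -> forall z, V z -> {for z, continuous F}.
Proof. by case: k => [|k] []. Qed.

Lemma near_open_row V z : open V -> V z -> \forall w \near z, V w.
Proof. by move=> oV Vz; apply: open_nbhs_nbhs; split. Qed.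

Lemma rdiff_near (phi psi : R -> C) (x : R) l :
  (\forall s \near x, phi s = psi s) -> rdiff phi x l -> rdiff psi x l.
Proof.
move=> /nbhs_ballP[d /= d0 hd]; apply: frechet_near.
  by apply: hd; exact: ballxx.
by exists d => // h hh; apply: hd; rewrite /ball /= opprD addrA subrr sub0r normrN.
Qed.

Lemma line_near V z v : open V -> V z -> \forall s \near (0 : R), V (z + toC s *: v).
Proof.
move=> oV Vz; have /nbhs_rowP[e e0 he] := near_open_row oV Vz.
pose M := 1 + \sum_a cabs (v 0 a).
have M0 : 0 < M by rewrite ltr_pwDl // sumr_ge0 // => a _; exact: cabs_ge0.
apply/nbhs_ballP; exists (e / M); first by rewrite /= divr_gt0.
move=> s; rewrite /ball /= sub0r normrN ltr_pdivlMr // => hs; apply: he => a.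
rewrite !mxE addrAC subrr add0r cabsM cabs_toC; apply: le_lt_trans hs.
apply: ler_wpM2l => //; rewrite /M (bigD1 a) //= addrCA lerDl addr_ge0 // sumr_ge0 // => b _.
exact: cabs_ge0.
Qed.

Lemma rderive_ext V F G v z : open V -> V z -> (forall w, V w -> F w = G w) ->
  rderivable v F z -> rderivable v G z /\ rderive v G z = rderive v F z.
Proof.
move=> oV Vz E /rderivable_rdiff d; apply: rdiff_rderivable.
by apply: rdiff_near d; apply: filterS (line_near v oV Vz) => s; exact: E.
Qed.

Lemma Ck_ext k V F G : open V -> (forall w, V w -> F w = G w) -> Ck k V F -> Ck k V G.
Proof.
move=> oV; elim: k F G => [|k IH] F G E [c H].
  apply: Ck0 => z Vz.
  have N : \forall w \near z, F w = G w.
    by apply: filterS (near_open_row oV Vz) => w; exact: E.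
  exact: (near_eq_continuous N (c z Vz)).
split.
  move=> z Vz.
  have N : \forall w \near z, F w = G w.
    by apply: filterS (near_open_row oV Vz) => w; exact: E.
  exact: (near_eq_continuous N (c z Vz)).
move=> v; have [d h] := H v; split.
  by move=> z Vz; have [] := rderive_ext oV Vz E (d _ Vz).
by apply: IH h => z Vz; have [_ ->] := rderive_ext oV Vz E (d _ Vz).
Qed.

Lemma Ck_intro k V F (D : Cn -> Cn -> C) : open V ->
  (forall z, V z -> {for z, continuous F}) ->
  (forall v z, V z -> rdiff (fun s => F (z + toC s *: v)) 0 (D v z)) ->
  (forall v, Ck k V (D v)) -> Ck k.+1 V F.
Proof.
move=> oV c d h; split; first exact: c.
move=> v; split.
  by move=> z Vz; have [] := rdiff_rderivable (d v z Vz).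
by apply: Ck_ext (h v) => // z Vz; have [_ ->] := rdiff_rderivable (d v z Vz).
Qed.

Lemma Ck_le k V F : Ck k.+1 V F -> Ck k V F.
Proof.
elim: k F => [|k IH] F; first by case=> c _.
move=> [c H]; split; first exact: c.
by move=> v; have [d h] := H v; split; [exact: d | exact: IH h].
Qed.

Lemma Ck_rdiff k V F : Ck k.+1 V F -> forall v z, V z ->
  rdiff (fun s => F (z + toC s *: v)) 0 (rderive v F z).
Proof. by move=> [_ H] v z Vz; apply: rderivable_rdiff; have [d _] := H v; exact: d. Qed.

Lemma Ck_rderive k V F v : Ck k.+1 V F -> Ck k V (rderive v F).
Proof. by move=> [_ /(_ v)[]]. Qed.

Section CkClosure.
Variables (V : set Cn) (oV : open V).

Let base (z v : Cn) : z + toC 0 *: v = z.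
Proof. by rewrite toC0 scale0r addr0. Qed.

Lemma Ck_cst k (a : C) : Ck k V (fun=> a).
Proof.
elim: k a => [|k IH] a; first by apply: Ck0 => z _; exact: for_cst.
apply: (@Ck_intro _ _ _ (fun _ _ => 0) oV).
- by move=> z _; exact: for_cst.
- by move=> v z _; exact: rdiff_cst.
- by move=> v; exact: IH.
Qed.

Lemma CkD k F G : Ck k V F -> Ck k V G -> Ck k V (fun z => F z + G z).
Proof.
elim: k F G => [|k IH] F G.
  by move=> [c1 _] [c2 _]; apply: Ck0 => z Vz; exact: (forD (c1 _ Vz) (c2 _ Vz)).
move=> h1 h2; apply: (@Ck_intro _ _ _ (fun v z => rderive v F z + rderive v G z) oV).
- by move=> z Vz; exact: (forD (Ck_continuous h1 Vz) (Ck_continuous h2 Vz)).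
- by move=> v z Vz; exact: (rdiffD (Ck_rdiff h1 v Vz) (Ck_rdiff h2 v Vz)).
- by move=> v; apply: IH; exact: Ck_rderive.
Qed.

Lemma CkM k F G : Ck k V F -> Ck k V G -> Ck k V (fun z => F z * G z).
Proof.
elim: k F G => [|k IH] F G.
  by move=> [c1 _] [c2 _]; apply: Ck0 => z Vz; exact: (forM (c1 _ Vz) (c2 _ Vz)).
move=> h1 h2.
apply: (@Ck_intro _ _ _ (fun v z => rderive v F z * G z + F z * rderive v G z) oV).
- by move=> z Vz; exact: (forM (Ck_continuous h1 Vz) (Ck_continuous h2 Vz)).
- by move=> v z Vz; have := (rdiffM (Ck_rdiff h1 v Vz) (Ck_rdiff h2 v Vz)); rewrite base.
- move=> v; apply: CkD; apply: IH; try exact: Ck_rderive; exact: Ck_le.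
Qed.

Lemma CkZ k (a : C) F : Ck k V F -> Ck k V (fun z => a * F z).
Proof. by move=> h; exact: CkM (Ck_cst k a) h. Qed.

Lemma CkN k F : Ck k V F -> Ck k V (fun z => - F z).
Proof.
by move=> h; apply: Ck_ext (CkZ (-1) h) => // z _; rewrite mulN1r.
Qed.

Lemma CkB k F G : Ck k V F -> Ck k V G -> Ck k V (fun z => F z - G z).
Proof. by move=> h1 /CkN h2; exact: CkD h1 h2. Qed.

Lemma rdiff_conj (phi : R -> C) (x : R) l : rdiff phi x l -> rdiff (fun s => Num.conj (phi s)) x (Num.conj l).
Proof.
move=> h; apply: frechet_ext; last exact: frechet_conj h.
by move=> s /=; rewrite conjM conj_toC.
Qed.

Lemma Ck_conj k F : Ck k V F -> Ck k V (fun z => Num.conj (F z)).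
Proof.
elim: k F => [|k IH] F.
  by move=> [c1 _]; apply: Ck0 => z Vz; exact: (for_conj (c1 _ Vz)).
move=> h1; apply: (@Ck_intro _ _ _ (fun v z => Num.conj (rderive v F z)) oV).
- by move=> z Vz; exact: (for_conj (Ck_continuous h1 Vz)).
- by move=> v z Vz; exact: (rdiff_conj (Ck_rdiff h1 v Vz)).
- by move=> v; apply: IH; exact: Ck_rderive.
Qed.

Lemma CkV k F : (forall z, V z -> F z != 0) -> Ck k V F -> Ck k V (fun z => (F z)^-1).
Proof.
move=> n0; elim: k F n0 => [|k IH] F n0.
  by move=> [c1 _]; apply: Ck0 => z Vz; exact: (forV (n0 _ Vz) (c1 _ Vz)).
move=> h1; have l := IH _ n0 (Ck_le h1).
apply: (@Ck_intro _ _ _ (fun v z => - ((F z)^-1 * (F z)^-1) * rderive v F z) oV).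
- by move=> z Vz; exact: (forV (n0 _ Vz) (Ck_continuous h1 Vz)).
- move=> v z Vz; have n0' : F (z + toC 0 *: v) != 0 by rewrite base; exact: n0.
  have := rdiff_comp (pdiff_inv n0') (Ck_rdiff h1 v Vz).
  by rewrite base mul0r addr0 expr2 invfM.
- by move=> v; apply: CkM; [apply: CkN; exact: CkM | exact: Ck_rderive].
Qed.

Lemma Ck_sum k (I : Type) (r : seq I) (P : pred I) (F : I -> Cn -> C) :
  (forall i, Ck k V (F i)) -> Ck k V (fun z => \sum_(i <- r | P i) F i z).
Proof.
move=> H; elim: r => [|i r IH].
  by apply: Ck_ext (Ck_cst k 0) => // z _; rewrite big_nil.
case Pi: (P i).
  by apply: Ck_ext (CkD (H i) IH) => // z _; rewrite big_cons Pi.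
by apply: Ck_ext IH => // z _; rewrite big_cons Pi.
Qed.

Lemma Ck_prod k (I : Type) (r : seq I) (P : pred I) (F : I -> Cn -> C) :
  (forall i, Ck k V (F i)) -> Ck k V (fun z => \prod_(i <- r | P i) F i z).
Proof.
move=> H; elim: r => [|i r IH].
  by apply: Ck_ext (Ck_cst k 1) => // z _; rewrite big_nil.
case Pi: (P i).
  by apply: Ck_ext (CkM (H i) IH) => // z _; rewrite big_cons Pi.
by apply: Ck_ext IH => // z _; rewrite big_cons Pi.
Qed.

Lemma Ck_det k m (G : Cn -> 'M[C]_m) : (forall i j, Ck k V (fun z => G z i j)) ->
  Ck k V (fun z => \det (G z)).
Proof.
move=> H; apply: Ck_sum => s; apply: CkM; first exact: Ck_cst.
by apply: Ck_prod => i; exact: H.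
Qed.

Lemma Ck_re k F : Ck k V F -> Ck k V (fun z => toC (reC (F z))).
Proof.
move=> h; apply: Ck_ext (CkZ 2^-1 (CkD h (Ck_conj h))) => // z _.
rewrite [in LHS](CsplitE (F z)) conjD conjM conjCi !conj_toC; by field.
Qed.

Lemma Ck_ln k (h : Cn -> R) : (forall z, V z -> 0 < h z) ->
  Ck k V (fun z => toC (h z)) -> Ck k V (fun z => toC (ln (h z))).
Proof.
move=> h0 H.
have cln z : V z -> Ck 0 V (fun z => toC (h z)) -> {for z, continuous (fun z => toC (ln (h z)))}.
  move=> Vz [c _].
  have ch : {for z, continuous h}.
    have -> : h = (fun z => reC (toC (h z))) by [].
    apply: (@continuous_comp _ _ _ (fun z => toC (h z)) (@reC R)); first exact: c.
    exact: reC_continuous.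
  apply: (@continuous_comp _ _ _ (fun z => ln (h z)) (@toC R)); last exact: toC_continuous.
  apply: (@continuous_comp _ _ _ h (@ln R)); first exact: ch.
  by apply: continuous_ln; exact: h0.
have H0 : Ck 0 V (fun z => toC (h z)) by case: (k) H => [|j] [].
case: k H => [|k] H; first by apply: Ck0 => z Vz; exact: cln.
apply: (@Ck_intro _ _ _ (fun v z => (toC (h z))^-1 * rderive v (fun z => toC (h z)) z) oV).
- by move=> z Vz; exact: cln.
- move=> v z Vz; have d := Ck_rdiff H v Vz.
  have [d1 d2] := rdiff_is_derive d.
  have hz : 0 < h (z + toC 0 *: v) by rewrite base; exact: h0.
  set D := rderive v _ _ in d d1 d2 *.
  have imD : imC D = 0.
    by move: d2 => /= [] _ <-; exact: derive_cst.
  have DE : D = toC (reC D) by apply: Cext; rewrite ?reC_toC ?imC_toC.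
  have dl := is_derive1_ln hz.
  have dc := @is_derive1_comp _ (@ln R) (fun s : R => h (z + toC s *: v)) 0 _ _ dl d1.
  have := rdiff_toC dc; rewrite /= base.
  by rewrite toCM toCV -DE.
- move=> v; apply: CkM; last exact: Ck_rderive.
  by apply: CkV; [move=> z /h0; rewrite toC_eq0 => /gt_eqF -> | exact: Ck_le].
Qed.

Lemma Ck_dz k a F : Ck k.+1 V F -> Ck k V (dz a F).
Proof.
by move=> h; apply: CkZ; apply: CkB; [|apply: CkZ]; exact: Ck_rderive.
Qed.
Lemma Ck_dzbar k a F : Ck k.+1 V F -> Ck k V (dzbar a F).
Proof.
by move=> h; apply: CkZ; apply: CkD; [|apply: CkZ]; exact: Ck_rderive.
Qed.

End CkClosure.
End SeveralVariables.

(** * The chain rule along holomorphic curves *)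

Section ChainRule.
Context {R : realType} {n : nat}.
Local Notation C := (Cplx R).
Local Notation Cn := 'rV[C]_n.
Implicit Types (F G : Cn -> C) (V : set Cn) (v z w : Cn).

Lemma rdiff_shift (phi : R -> C) (s : R) l : rdiff (fun t => phi (s + t)) 0 l -> rdiff phi s l.
Proof.
move=> [b H]; split=> // e /H[d d0 hd]; exists d => // h /hd.
by rewrite add0r addr0.
Qed.

Lemma finite_radius (m : nat) (P : 'I_m -> R -> Prop) :
  (forall a, exists2 d : R, 0 < d & P a d) ->
  (forall a d d', d' <= d -> P a d -> P a d') ->
  exists2 d : R, 0 < d & forall a, P a d.
Proof.
move=> H mono.
have [f hf] := choice (fun a => let: ex_intro2 d d0 pd := H a in ex_intro (fun d => 0 < d /\ P a d) d (conj d0 pd)).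
exists (\big[Num.min/1]_a f a).
  by elim/big_ind: _ => // [x y x0 y0|a _]; [rewrite lt_min x0 | have [] := hf a].
move=> a; have [_ pa] := hf a; apply: mono pa; exact: bigmin_le_cond.
Qed.

(** The mean value inequality along the line through y; the continuity of the
    directional derivative gives uniformity in y near z. *)
Lemma line_estimate V F z v (e : R) : open V -> Ck 1 V F -> V z -> 0 < e ->
  exists2 d : R, 0 < d & forall y : Cn, (forall a, cabs (y 0 a - z 0 a) < d) ->
    forall x : R, `|x| < d -> cabs (F (y + toC x *: v) - F y - toC x * rderive v F z) <= e * `|x|.
Proof.
move=> oV hF Vz e0.
have cG := Ck_continuous (Ck_rderive v hF) Vz.
have /nbhs_rowP[e1 e10 he1] : \forall w \near z, V w /\ cabs (rderive v F w - rderive v F z) < e.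
  have N1 := near_open_row oV Vz.
  have N2 : \forall w \near z, cabs (rderive v F w - rderive v F z) < e.
    by move/(@cvgCP _ _ (nbhs z)): cG; apply.
  by apply: filterS2 N1 N2 => w; split.
pose M := 1 + \sum_a cabs (v 0 a).
have S0 : 0 <= \sum_a cabs (v 0 a) by apply: sumr_ge0 => a _; exact: cabs_ge0.
have M0 : 0 < M by rewrite /M; lra.
have Mv a : cabs (v 0 a) <= M - 1.
  have : cabs (v 0 a) <= \sum_b cabs (v 0 b).
    by rewrite (bigD1 a) //= lerDl sumr_ge0 // => b _; exact: cabs_ge0.
  by rewrite /M; lra.
exists (e1 / M); first by rewrite divr_gt0.
move=> y hy x hx.
have inN s : `|s| <= `|x| -> V (y + toC s *: v) /\ cabs (rderive v F (y + toC s *: v) - rderive v F z) < e.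
  move=> sx; apply: he1 => a; rewrite !mxE addrAC.
  apply: le_lt_trans (cabsD _ _) _; rewrite cabsM cabs_toC.
  have h1 : `|s| * cabs (v 0 a) <= e1 / M * (M - 1).
    by apply: ler_pM => //; [exact: cabs_ge0 | apply: le_trans sx (ltW hx)].
  have h2 := hy a; have : e1 / M * (M - 1) + e1 / M = e1 by field; rewrite gt_eqF.
  lra.
pose phi s := F (y + toC s *: v) - toC s * rderive v F z.
have D s : `|s| <= `|x| -> rdiff phi s (rderive v F (y + toC s *: v) - rderive v F z).
  move=> /inN[Vs _]; apply: rdiffB.
    apply: rdiff_shift; have := Ck_rdiff hF v Vs.
    apply: frechet_near; first by rewrite addr0 toC0 scale0r addr0.
    by exists 1; [exact: ltr01 | move=> h _; rewrite !add0r toCD scalerDl addrA].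
  have := rdiffM (rdiff_toC (is_derive_id s (1 : R))) (rdiff_cst s (rderive v F z)).
  by rewrite toC1 mul1r mulr0 addr0.
have L s : `|s| <= `|x| -> cabs (rderive v F (y + toC s *: v) - rderive v F z) <= e.
  by move=> /inN[_ /ltW].
have -> : F (y + toC x *: v) - F y - toC x * rderive v F z = phi x - phi 0.
  by rewrite /phi toC0 scale0r mul0r !subr0 addr0; ring.
have [x0|x0] := leP 0 x.
  apply: le_trans (@mean_value_le _ phi _ 0 x e x0 _ _) _; last by rewrite subr0 ger0_norm.
    by move=> s /andP[s0 sx]; apply: D; rewrite !ger0_norm.
  by move=> s /andP[s0 sx]; apply: L; rewrite !ger0_norm.
rewrite cabsBC; apply: le_trans (@mean_value_le _ phi _ x 0 e (ltW x0) _ _) _.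
- by move=> s /andP[s0 sx]; apply: D; rewrite !ler0_norm ?lerN2 // ltW.
- by move=> s /andP[s0 sx]; apply: L; rewrite !ler0_norm ?lerN2 // ltW.
- by rewrite sub0r ltr0_norm.
Qed.

Lemma dz_dzbar_comb F z a (w : C) :
  dz a F z * w + dzbar a F z * Num.conj w =
  toC (reC w) * rderive (delta_mx 0 a) F z + toC (imC w) * rderive ('i *: delta_mx 0 a) F z.
Proof.
rewrite /dz /dzbar [in LHS](CsplitE w) conjD conjM conjCi !conj_toC.
set A := rderive _ F z; set B := rderive _ F z.
move: (toC (reC w)) (toC (imC w)) => x y.
have ii : 'i * 'i = -1 :> C by rewrite -expr2 sqrCi.
have -> : 2^-1 * (A - 'i * B) * (x + 'i * y) + 2^-1 * (A + 'i * B) * (x + - 'i * y) =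
  x * A - 'i * 'i * (y * B) by field.
by rewrite ii; ring.
Qed.

Lemma two_steps (u0 u1 u2 A B : C) (x y : R) :
  cabs (u1 - u0 - A) <= x -> cabs (u2 - u1 - B) <= y -> cabs (u2 - u0 - (A + B)) <= x + y.
Proof.
move=> h1 h2; have -> : u2 - u0 - (A + B) = (u1 - u0 - A) + (u2 - u1 - B) by ring.
by apply: le_trans (cabsD _ _) _; exact: lerD.
Qed.

(** Continuous first partial derivatives make F real differentiable: go from z to
    z + w by changing one real coordinate at a time. *)
Lemma Ck1_frechet V F z (e : R) : open V -> Ck 1 V F -> V z -> 0 < e ->
  exists2 d : R, 0 < d & forall w : Cn, (forall a, cabs (w 0 a) < d) ->
    cabs (F (z + w) - F z - \sum_a (dz a F z * w 0 a + dzbar a F z * Num.conj (w 0 a)))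
      <= e * \sum_a cabs (w 0 a).
Proof.
move=> oV hF Vz e0; have e2 : 0 < e / 2 by rewrite divr_gt0.
pose P a d := forall y : Cn, (forall b, cabs (y 0 b - z 0 b) < d) -> forall x : R, `|x| < d ->
  cabs (F (y + toC x *: delta_mx 0 a) - F y - toC x * rderive (delta_mx 0 a) F z) <= e / 2 * `|x| /\
  cabs (F (y + toC x *: ('i *: delta_mx 0 a)) - F y - toC x * rderive ('i *: delta_mx 0 a) F z) <= e / 2 * `|x|.
have [d d0 hd] : exists2 d : R, 0 < d & forall a, P a d.
  apply: finite_radius => [a|a d d' dd' H y hy x hx].
    have [d1 d10 h1] := line_estimate (delta_mx 0 a) oV hF Vz e2.
    have [d2 d20 h2] := line_estimate ('i *: delta_mx 0 a) oV hF Vz e2.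
    exists (Num.min d1 d2); first by rewrite lt_min d10.
    move=> y hy x; rewrite lt_min => /andP[x1 x2].
    by split; [apply: h1 => // b | apply: h2 => // b]; have := hy b; rewrite lt_min => /andP[].
  by apply: H => [b|]; apply: lt_le_trans dd'.
exists d => // w hw.
(* Y m has the first m coordinates of z + w and the other ones of z. *)
pose Y (m : nat) : Cn := \row_a (z 0 a + if (a < m)%N then w 0 a else 0).
have Y0 : Y 0%N = z by apply/rowP => a; rewrite mxE ltn0 addr0.
have Yn : Y n = z + w by apply/rowP => a; rewrite !mxE ltn_ord.
have YS (a : 'I_n) : Y a.+1 = Y a + toC (reC (w 0 a)) *: delta_mx 0 a + toC (imC (w 0 a)) *: ('i *: delta_mx 0 a).
  apply/rowP => b; rewrite !mxE eqxx /=.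
  have [->|ba] := eqVneq b a.
    by rewrite ltnSn ltnn addr0 !mulr1 -addrA (mulrC _ 'i) -CsplitE.
  by rewrite !mulr0 !addr0 ltnS leq_eqVlt (inj_eq val_inj) (negPf ba).
have YB m b : cabs (Y m 0 b - z 0 b) < d.
  by rewrite mxE addrC addKr; case: ifP => _ //; rewrite cabs0.
have YB' (a : 'I_n) b : cabs ((Y a + toC (reC (w 0 a)) *: delta_mx 0 a) 0 b - z 0 b) < d.
  rewrite !mxE eqxx /=; have [->|ba] := eqVneq b a.
    rewrite ltnn addr0 mulr1 addrC addKr cabs_toC.
    exact: le_lt_trans (reC_le_cabs _) (hw a).
  by rewrite mulr0 addr0 addrC addKr; case: ifP => _ //; rewrite cabs0.
have T : F (z + w) - F z = \sum_(a < n) (F (Y a.+1) - F (Y a)).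
  rewrite -Yn -Y0 -(big_mkord xpredT (fun m => F (Y m.+1) - F (Y m))).
  by rewrite (telescope_sumr (fun m => F (Y m))).
rewrite T -sumrB mulr_sumr; apply: le_trans (cabs_sum _ _ _) _; apply: ler_sum => a _.
rewrite dz_dzbar_comb YS.
have rd : `|reC (w 0 a)| < d by exact: le_lt_trans (reC_le_cabs _) (hw a).
have id : `|imC (w 0 a)| < d by exact: le_lt_trans (imC_le_cabs _) (hw a).
have [h1 _] := hd a _ (YB a) _ rd; have [_ h2] := hd a _ (YB' a) _ id.
apply: le_trans (two_steps h1 h2) _.
have m1 := ler_wpM2l (ltW e2) (reC_le_cabs (w 0 a)).
have m2 := ler_wpM2l (ltW e2) (imC_le_cabs (w 0 a)).
have -> : e * cabs (w 0 a) = e / 2 * cabs (w 0 a) + e / 2 * cabs (w 0 a) by field.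
exact: lerD.
Qed.

Lemma Ck1_chain (W : zmodType) (sz : W -> R) (sz0 : forall h, 0 <= sz h) V F
    (c : W -> Cn) t (L : 'I_n -> W -> C) : open V -> Ck 1 V F -> V (c t) ->
  (forall a, frechet sz (fun s => c s 0 a) t (L a)) ->
  frechet sz (fun s => F (c s)) t
    (fun h => \sum_a (dz a F (c t) * L a h + dzbar a F (c t) * Num.conj (L a h))).
Proof.
move=> oV hF Vct hc.
have bnd a : exists2 M : R, 0 <= M & exists2 d : R, 0 < d & forall h, sz h < d ->
    cabs (c (t + h) 0 a - c t 0 a) <= M * sz h := frechet_bound sz0 (hc a).
have linb a : exists2 M : R, 0 <= M & forall h, cabs (L a h) <= M * sz h.
  have [[M hM] _] := hc a; exists `|M| => // h; apply: le_trans (hM h) _.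
  by apply: ler_wpM2r => //; exact: ler_norm.
pose M a := sval (cid2 (bnd a)); pose ML a := sval (cid2 (linb a)).
have M0 a : 0 <= M a by rewrite /M; case: (cid2 (bnd a)).
have hM a : exists2 d : R, 0 < d & forall h, sz h < d ->
    cabs (c (t + h) 0 a - c t 0 a) <= M a * sz h by rewrite /M; case: (cid2 (bnd a)).
have hML a h : cabs (L a h) <= ML a * sz h by rewrite /ML; case: (cid2 (linb a)).
pose P a := cabs (dz a F (c t)) + cabs (dzbar a F (c t)).
have P0 a : 0 <= P a by rewrite addr_ge0 ?cabs_ge0.
have lin a (w : C) : cabs (dz a F (c t) * w + dzbar a F (c t) * Num.conj w) <= P a * cabs w.
  by apply: (le_trans (cabsD _ _)); rewrite /P !cabsM cabs_conj mulrDl.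
split.
  exists (\sum_a P a * ML a) => h; apply: le_trans (cabs_sum _ _ _) _; rewrite mulr_suml.
  apply: ler_sum => a _; apply: le_trans (lin a _) _.
  by rewrite -mulrA; apply: ler_wpM2l.
move=> e e0; pose SM := \sum_a M a; pose SP := \sum_a P a.
have SM0 : 0 <= SM by apply: sumr_ge0.
have SP0 : 0 <= SP by apply: sumr_ge0.
pose e1 := e / (2 * (SM + 1)); pose e2 := e / (2 * (SP + 1)).
have e10 : 0 < e1 by rewrite divr_gt0 // mulr_gt0 //; lra.
have e20 : 0 < e2 by rewrite divr_gt0 // mulr_gt0 //; lra.
have [d1 d10 hd1] := Ck1_frechet oV hF Vct e10.
pose Q a d := forall h, sz h < d -> [/\ cabs (c (t + h) 0 a - c t 0 a) <= M a * sz h,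
  cabs (c (t + h) 0 a - c t 0 a - L a h) <= e2 * sz h & cabs (c (t + h) 0 a - c t 0 a) < d1].
have [d d0 hd] : exists2 d : R, 0 < d & forall a, Q a d.
  apply: finite_radius => [a|a d d' dd' H h hh]; last by apply: H; apply: lt_le_trans dd'.
  have [d2 d20 hd2] := hM a; have [_ /(_ _ e20)[d3 d30 hd3]] := hc a.
  exists (Num.min (Num.min d2 d3) (d1 / (M a + 1))).
    by rewrite !lt_min d20 d30 divr_gt0 //; have := M0 a; lra.
  move=> h; rewrite !lt_min => /andP[/andP[h2 h3]].
  rewrite ltr_pdivlMr; last by have := M0 a; lra.
  move=> h1; have B := hd2 _ h2; split=> //; first exact: hd3.
  apply: le_lt_trans B _; apply: le_lt_trans h1; rewrite mulrC.
  by apply: ler_wpM2l => //; lra.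
exists d => // h hh; pose w := c (t + h) - c t.
have wE a : w 0 a = c (t + h) 0 a - c t 0 a by rewrite !mxE.
have ctE : c t + w = c (t + h) by rewrite /w addrC subrK.
have := hd1 w; rewrite ctE => /(_ _)/[dup] H1.
have {}H1 := H1 (fun a => let: And3 _ _ x := hd a h hh in eq_ind_r (fun u => cabs u < d1) x (wE a)).
move=> _.
set S1 := \sum_a _ in H1; set S2 := \sum_a _.
have -> : F (c (t + h)) - F (c t) - S2 = (F (c (t + h)) - F (c t) - S1) + (S1 - S2) by ring.
apply: le_trans (cabsD _ _) _.
have B1 : e1 * \sum_a cabs (w 0 a) <= e / 2 * sz h.
  have : \sum_a cabs (w 0 a) <= SM * sz h.
    by rewrite mulr_suml; apply: ler_sum => a _; rewrite wE; have [] := hd a h hh.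
  move=> /(ler_wpM2l (ltW e10)) /le_trans; apply.
  have : SM * sz h <= (SM + 1) * sz h by apply: ler_wpM2r => //; lra.
  move=> /(ler_wpM2l (ltW e10)) /le_trans; apply.
  by rewrite le_eqVlt; apply/orP; left; apply/eqP; rewrite /e1; field; apply/eqP; lra.
have B2 : cabs (S1 - S2) <= e / 2 * sz h.
  rewrite /S1 /S2 -sumrB; apply: le_trans (cabs_sum _ _ _) _.
  apply: (@le_trans _ _ (SP * (e2 * sz h))).
    rewrite mulr_suml; apply: ler_sum => a _.
    have -> : dz a F (c t) * w 0 a + dzbar a F (c t) * Num.conj (w 0 a) -
      (dz a F (c t) * L a h + dzbar a F (c t) * Num.conj (L a h)) =
      dz a F (c t) * (w 0 a - L a h) + dzbar a F (c t) * Num.conj (w 0 a - L a h).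
      by rewrite conjB; ring.
    apply: le_trans (lin a _) _; apply: ler_wpM2l => //.
    by rewrite wE; have [] := hd a h hh.
  have : SP * (e2 * sz h) <= (SP + 1) * (e2 * sz h).
    by apply: ler_wpM2r; [rewrite mulr_ge0 // ltW | lra].
  move=> /le_trans; apply.
  by rewrite le_eqVlt; apply/orP; left; apply/eqP; rewrite /e2; field; apply/eqP; lra.
by move: H1; rewrite (_ : e * sz h = e / 2 * sz h + e / 2 * sz h); [lra | field].
Qed.

Lemma curve_pdiff V F (c : C -> Cn) (c' : 'I_n -> C -> C) t : open V -> Ck 1 V F -> V (c t) ->
  (forall a, pdiff (fun s => c s 0 a) t (c' a t) 0) ->
  pdiff (fun s => F (c s)) t (\sum_a dz a F (c t) * c' a t)
    (\sum_a dzbar a F (c t) * Num.conj (c' a t)).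
Proof.
move=> oV hF Vc hc; apply: frechet_ext; last exact: (Ck1_chain (@cabs_ge0 _) oV hF Vc hc).
move=> h /=; rewrite !mulr_suml -big_split /=; apply: eq_bigr => a _.
by rewrite mul0r addr0 conjM; ring.
Qed.

Section AlongCurve.
Variables (V : set Cn) (U : set C) (c : C -> Cn) (c' : 'I_n -> C -> C).
Hypotheses (oV : open V) (oU : open U) (cV : forall s, U s -> V (c s)).
Hypothesis hc : forall a s, U s -> pdiff (fun s => c s 0 a) s (c' a s) 0.

Lemma curve_continuous s : U s -> {for s, continuous c}.
Proof.
move=> Us A /nbhs_rowP[e e0 he]; apply/nbhsCP.
have [d d0 hd] : exists2 d : R, 0 < d & forall a, forall w : C, cabs (w - s) < d ->
    cabs (c w 0 a - c s 0 a) < e.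
  apply: finite_radius => [a|a d d' dd' H w wd]; last by apply: H; apply: lt_le_trans dd'.
  have := pdiff_continuous (hc a Us); move/(@cvgCP _ _ (nbhs s))/(_ _ e0)/nbhsCP => [d d0 hd].
  by exists d.
by exists d => // w wd; apply: he => a; exact: hd.
Qed.

Lemma curve_hol_derivative k a : PCk k U (c' a).
Proof.
have H s : exists l, U s -> pdiff (c' a) s l 0.
  have [Us|nU] := pselect (U s); last by exists 0.
  by have [l hl] := hol_derivative_hol oU (hc a) Us; exists l.
have [c'' hc''] := choice H.
by apply: (PCk_hol oU) => s Us; exact: hc''.
Qed.

Lemma PCk_curve k F : Ck k V F -> PCk k U (fun s => F (c s)).
Proof.
elim: k F => [|k IH] F hF.
  apply: PCk0 => s Us; apply: (@continuous_comp _ _ _ c F).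
    exact: curve_continuous Us.
  exact: (Ck_continuous hF (cV Us)).
have h1 : Ck 1 V F.
  by elim: (k) hF => [//|j IHj] /Ck_le.
apply: (PCk_intro oU (fun t Ut => curve_pdiff oV h1 (cV Ut) (fun a => hc a Ut))).
  by apply: (PCk_sum oU) => a; apply: (PCkM oU); [apply: IH; exact: Ck_dz | exact: curve_hol_derivative].
apply: (PCk_sum oU) => a; apply: (PCkM oU); first by apply: IH; exact: Ck_dzbar.
by apply: (PCk_conj oU); exact: curve_hol_derivative.
Qed.

Lemma pzb_curve F s : Ck 1 V F -> U s ->
  pzb (fun s => F (c s)) s = \sum_b dzbar b F (c s) * Num.conj (c' b s).
Proof. by move=> hF Us; exact: pzbE (curve_pdiff oV hF (cV Us) (fun a => hc a Us)). Qed.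

Lemma hol_deriv_pdiff a s : U s -> pdiff (c' a) s (pz (c' a) s) 0.
Proof.
move=> Us; have [l hl] := hol_derivative_hol oU (hc a) Us.
by have -> : pz (c' a) s = l by exact: pzE hl.
Qed.

(** dbar F is contracted with the conjugate of c', whose d vanishes: the second
    derivatives of the curve do not enter. *)
Lemma curve_ddbar F s : Ck 2 V F -> U s ->
  pz (pzb (fun s => F (c s))) s =
  \sum_b \sum_a dz a (dzbar b F) (c s) * c' a s * Num.conj (c' b s).
Proof.
move=> hF Us.
have E : \forall w \near s, pzb (fun s => F (c s)) w = \sum_b dzbar b F (c w) * Num.conj (c' b w).
  apply: filterS (near_open oU Us) => w Uw; exact: pzb_curve (Ck_le hF) Uw.
have [-> _] := pz_near E.
have D := pdiff_sum (index_enum 'I_n) (fun b => pdiffM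
  (curve_pdiff oV (Ck_dzbar oV b hF) (cV Us) (fun a => hc a Us))
  (pdiff_conj (hol_deriv_pdiff b Us))).
rewrite (pzE D); apply: eq_bigr => b _.
by rewrite conj0 mulr0 addr0 mulr_suml.
Qed.

End AlongCurve.

End ChainRule.

(** * Hermitian forms and the norm of the curvature tensor *)

Section CauchySchwarz.
Context {R : realType}.
Local Notation C := (Cplx R).

(** Lagrange's identity. *)
Lemma cauchy_schwarz_real (I : finType) (a b : I -> R) :
  (\sum_i a i * b i) ^+ 2 <= (\sum_i a i ^+ 2) * (\sum_i b i ^+ 2).
Proof.
have : 0 <= \sum_i \sum_j (a i * b j - a j * b i) ^+ 2.
  by apply: sumr_ge0 => i _; apply: sumr_ge0 => j _; exact: sqr_ge0.
have -> : \sum_i \sum_j (a i * b j - a j * b i) ^+ 2 =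
    2 * ((\sum_i a i ^+ 2) * (\sum_i b i ^+ 2)) - 2 * (\sum_i a i * b i) ^+ 2.
  have e1 : (\sum_i a i ^+ 2) * (\sum_i b i ^+ 2) = \sum_i \sum_j a i ^+ 2 * b j ^+ 2.
    by rewrite big_distrlr.
  have e2 : (\sum_i a i ^+ 2) * (\sum_i b i ^+ 2) = \sum_i \sum_j a j ^+ 2 * b i ^+ 2.
    by rewrite e1 exchange_big.
  have e3 : (\sum_i a i * b i) ^+ 2 = \sum_i \sum_j (a i * b i) * (a j * b j).
    by rewrite expr2 big_distrlr.
  have -> : 2 * ((\sum_i a i ^+ 2) * (\sum_i b i ^+ 2)) =
     \sum_i \sum_j a i ^+ 2 * b j ^+ 2 + \sum_i \sum_j a j ^+ 2 * b i ^+ 2.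
    by rewrite -e1 -e2; ring.
  rewrite e3 mulr_sumr -big_split /= -sumrB; apply: eq_bigr => i _.
  rewrite mulr_sumr -big_split /= -sumrB; apply: eq_bigr => j _; ring.
by lra.
Qed.

Lemma cauchy_schwarz (I : finType) (a b : I -> C) :
  cabs (\sum_i a i * b i) ^+ 2 <= (\sum_i cabs (a i) ^+ 2) * (\sum_i cabs (b i) ^+ 2).
Proof.
apply: le_trans (cauchy_schwarz_real (fun i => cabs (a i)) (fun i => cabs (b i))).
rewrite ler_pXn2r ?nnegrE ?cabs_ge0 ?sumr_ge0 // => [|i _]; last by rewrite mulr_ge0 ?cabs_ge0.
apply: le_trans (cabs_sum _ _ _) _; apply: ler_sum => i _; by rewrite cabsM.
Qed.

Section Sesquilinear.
Context {n : nat}.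
Implicit Types (A Q : 'M[C]_n) (u v w : 'rV[C]_n).

Definition sesq u A w : C := (u *m A *m (conj_mx w)^T) 0 0.

Lemma sesqE u A w : sesq u A w = \sum_a \sum_b u 0 a * A a b * Num.conj (w 0 b).
Proof.
rewrite /sesq mxE exchange_big; apply: eq_bigr => b _.
by rewrite !mxE mulr_suml.
Qed.

Definition hermitian A := (conj_mx A)^T = A.
Definition posdef A := forall v, v != 0 -> 0 < herm_form A v.

Lemma conj_mxM m p q (A : 'M[C]_(m, p)) (B : 'M[C]_(p, q)) :
  conj_mx (A *m B) = conj_mx A *m conj_mx B.
Proof. exact: map_mxM. Qed.
Lemma conj_mxK m p (A : 'M[C]_(m, p)) : conj_mx (conj_mx A) = A.
Proof. by apply/matrixP => i j; rewrite !mxE conjCK. Qed.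
Lemma conj_mxT m p (A : 'M[C]_(m, p)) : conj_mx A^T = (conj_mx A)^T.
Proof. by apply/matrixP => i j; rewrite !mxE. Qed.

Lemma trmxCE m p (A : 'M[C]_(m, p)) : (A ^t*)%sesqui = (conj_mx A)^T.
Proof. exact: conj_mxT. Qed.

(** Diagonalize by a unitary matrix and take square roots of the eigenvalues. *)
Lemma hermitian_factor A : hermitian A -> posdef A ->
  exists Q, A = Q *m (conj_mx Q)^T.
Proof.
move=> hA pA.
have nA : A \is normalmx.
  by apply/normalmxP; rewrite trmxCE hA.
have /orthomx_spectralP := nA.
have uP := spectral_unitarymx A; set P := spectralmx A in uP *.
set d := spectral_diag A => AE.
rewrite (invmx_unitary uP) in AE.
have PP : P *m (conj_mx P)^T = 1%:M.
  by have /unitarymxP := uP; rewrite trmxCE.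
rewrite trmxCE in AE.
have dE i : herm_form A (row i P) = d 0 i.
  have rP : row i P *m (conj_mx P)^T = delta_mx 0 i.
    by rewrite -row_mul PP rowE mulmx1.
  have rP' : P *m (conj_mx (row i P))^T = (delta_mx 0 i)^T.
    have -> : P *m (conj_mx (row i P))^T = (conj_mx (row i P *m (conj_mx P)^T))^T.
      by rewrite conj_mxM trmx_mul conj_mxT conj_mxK trmxK.
    by rewrite rP; congr (_^T); apply/matrixP => a b; rewrite !mxE rmorph_nat.
  rewrite /herm_form AE !mulmxA rP -[_ *m P *m _]mulmxA rP'.
  rewrite -rowE mxE (bigD1 i) //= !mxE !eqxx /= mulr1n mulr1 big1 ?addr0 // => j ji.
  by rewrite !mxE eqxx /= (negPf ji) mulr0.
have d0 i : 0 < d 0 i.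
  rewrite -dE; apply: pA; apply/eqP => r0.
  have : (row i P *m (conj_mx P)^T) 0 i = 1.
    by rewrite -row_mul PP !mxE eqxx.
  by rewrite r0 mul0mx mxE => /eqP; rewrite eq_sym oner_eq0.
pose s : 'rV[C]_n := \row_i sqrtC (d 0 i).
exists ((conj_mx P)^T *m diag_mx s).
have cs : (conj_mx (diag_mx s))^T = diag_mx s.
  apply/matrixP => i j; rewrite !mxE.
  have [->|ji] := eqVneq j i; last by rewrite !mulr0n conj0.
  rewrite !mulr1n; apply: CrealP; apply: ger0_real; rewrite sqrtC_ge0.
  exact: ltW.
rewrite conj_mxM trmx_mul cs conj_mxT conj_mxK trmxK !mulmxA -(mulmxA (conj_mx P)^T (diag_mx s)).
rewrite mulmx_diag [LHS]AE; congr (_ *m diag_mx _ *m _).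
by apply/rowP => i; rewrite !mxE -expr2 sqrtCK.
Qed.

Lemma sesq_factor Q A u w : A = Q *m (conj_mx Q)^T ->
  sesq u A w = \sum_r (u *m Q) 0 r * Num.conj ((w *m Q) 0 r).
Proof.
move=> ->; rewrite /sesq !mulmxA -mulmxA -trmx_mul -conj_mxM mxE.
by apply: eq_bigr => r _; rewrite !mxE.
Qed.

Lemma sesq_factor_diag Q A u : A = Q *m (conj_mx Q)^T ->
  sesq u A u = toC (\sum_r cabs ((u *m Q) 0 r) ^+ 2).
Proof.
move=> /sesq_factor ->; rewrite rmorph_sum /=.
by apply: eq_bigr => r _; rewrite mulconjE.
Qed.

Lemma sesq_cauchy_schwarz A u w : hermitian A -> posdef A ->
  cabs (sesq u A w) ^+ 2 <= reC (sesq u A u) * reC (sesq w A w).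
Proof.
move=> hA pA; have [Q AE] := hermitian_factor hA pA.
rewrite (sesq_factor _ _ AE) !(sesq_factor_diag _ AE) !reC_toC.
apply: le_trans (cauchy_schwarz _ _) _.
by under [X in _ * X <= _]eq_bigr do rewrite cabs_conj.
Qed.

Lemma sesq_real_ge0 A u : hermitian A -> posdef A ->
  sesq u A u = toC (reC (sesq u A u)) /\ 0 <= reC (sesq u A u).
Proof.
move=> hA pA; have [Q AE] := hermitian_factor hA pA.
rewrite (sesq_factor_diag _ AE) reC_toC; split=> //.
by apply: sumr_ge0 => r _; exact: sqr_ge0.
Qed.

Lemma posdef_unit A : hermitian A -> posdef A -> A \in unitmx.
Proof.
move=> hA pA; rewrite -row_free_unit; apply/inj_row_free => v vA.
apply/eqP/negPn/negP => /pA; rewrite /herm_form vA mul0mx mxE ltxx //.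
Qed.

Lemma posdef_det_gt0 A : hermitian A -> posdef A -> \det A = toC (reC (\det A)) /\ 0 < reC (\det A).
Proof.
move=> hA pA; have [Q AE] := hermitian_factor hA pA.
have E : \det A = toC (cabs (\det Q) ^+ 2).
  by rewrite AE det_mulmx det_tr /conj_mx det_map_mx mulconjE.
have := posdef_unit hA pA; rewrite unitmxE unitfE E toC_eq0 => n0.
by rewrite reC_toC; split=> //; rewrite lt_neqAle eq_sym n0 sqr_ge0.
Qed.

Let I4 := ('I_n * 'I_n * 'I_n * 'I_n)%type.

Lemma sum4_pair (F : 'I_n -> 'I_n -> 'I_n -> 'I_n -> C) :
  \sum_a \sum_b \sum_c \sum_d F a b c d = \sum_(x : I4) F x.1.1.1 x.1.1.2 x.1.2 x.2.
Proof.
rewrite (pair_bigA _ (fun a b => \sum_c \sum_d F a b c d)) /=.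
rewrite (pair_bigA _ (fun (x : 'I_n * 'I_n) c => \sum_d F x.1 x.2 c d)) /=.
by rewrite (pair_bigA _ (fun (x : 'I_n * 'I_n * 'I_n) d => F x.1.1 x.1.2 x.2 d)).
Qed.

(** In a frame that is unitary for A the right-hand side is the Euclidean norm of
    the components of T times |v|^4, and this is the Cauchy-Schwarz inequality. *)
Lemma tensor_bound A (T : 'I_n -> 'I_n -> 'I_n -> 'I_n -> C) v
    (ginv : 'I_n -> 'I_n -> C) :
  hermitian A -> posdef A -> (forall p q, ginv p q = invmx A q p) ->
  cabs (\sum_a \sum_b \sum_c \sum_d T a b c d * v 0 a * Num.conj (v 0 b) * v 0 c * Num.conj (v 0 d))
  <= Num.sqrt (reC (\sum_a \sum_b \sum_c \sum_d \sum_e \sum_f \sum_k \sum_l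
      ginv a e * ginv f b * ginv c k * ginv l d * T a b c d * Num.conj (T e f k l)))
    * reC (sesq v A v) ^+ 2.
Proof.
move=> hA pA giA; have [Q AE] := hermitian_factor hA pA.
have uA := posdef_unit hA pA.
have uQ : Q \in unitmx by move: uA; rewrite AE unitmx_mul => /andP[].
pose W := invmx Q.
have giE p q : ginv p q = \sum_r W r p * Num.conj (W r q).
  have -> : ginv p q = ((conj_mx W)^T *m W) q p.
    rewrite giA; suff -> : invmx A = (conj_mx W)^T *m W by [].
    have uQt : (conj_mx Q)^T \in unitmx by rewrite unitmx_tr map_unitmx.
    have iW : invmx ((conj_mx Q)^T) = (conj_mx W)^T.
      by rewrite -trmx_inv /W /conj_mx map_invmx.
    have e1 : ((conj_mx W)^T *m W) *m A = 1%:M.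
      by rewrite AE mulmxA -(mulmxA _ W Q) mulVmx // mulmx1 -iW mulVmx.
    by rewrite -[RHS](mulmxK uA) e1 mul1mx.
  by rewrite mxE; apply: eq_bigr => r _; rewrite !mxE mulrC.
pose y := v *m Q.
have vE a : v 0 a = \sum_r y 0 r * W r a.
  by have -> : v = y *m W; [rewrite /y /W mulmxK | rewrite mxE].
pose Phi (s x : I4) := W s.1.1.1 x.1.1.1 * Num.conj (W s.1.1.2 x.1.1.2) * W s.1.2 x.1.2 * Num.conj (W s.2 x.2).
pose S (x : I4) := T x.1.1.1 x.1.1.2 x.1.2 x.2.
pose Y (s : I4) := y 0 s.1.1.1 * Num.conj (y 0 s.1.1.2) * y 0 s.1.2 * Num.conj (y 0 s.2).
have big4 (f1 f2 f3 f4 : 'I_n -> C) : (\sum_r f1 r) * (\sum_r f2 r) * (\sum_r f3 r) * (\sum_r f4 r) =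
    \sum_(s : I4) f1 s.1.1.1 * f2 s.1.1.2 * f3 s.1.2 * f4 s.2.
  rewrite -(sum4_pair (fun a b c d => f1 a * f2 b * f3 c * f4 d)).
  rewrite big_distrlr /= !mulr_suml; apply: eq_bigr => a _.
  rewrite !mulr_suml; apply: eq_bigr => b _.
  rewrite [X in X * _]mulr_sumr mulr_suml; apply: eq_bigr => c _.
  by rewrite mulr_sumr.
have KE (x z : I4) : ginv x.1.1.1 z.1.1.1 * ginv z.1.1.2 x.1.1.2 * ginv x.1.2 z.1.2 * ginv z.2 x.2 =
    \sum_s Phi s x * Num.conj (Phi s z).
  rewrite !giE big4; apply: eq_bigr => s _; rewrite /Phi !conjM !conjCK; ring.
have E8 : \sum_a \sum_b \sum_c \sum_d \sum_e \sum_f \sum_k \sum_l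
      ginv a e * ginv f b * ginv c k * ginv l d * T a b c d * Num.conj (T e f k l) =
    toC (\sum_s cabs (\sum_x Phi s x * S x) ^+ 2).
  rewrite (sum4_pair (fun a b c d => \sum_e \sum_f \sum_k \sum_l
      ginv a e * ginv f b * ginv c k * ginv l d * T a b c d * Num.conj (T e f k l))).
  under eq_bigr => x _ do rewrite (sum4_pair (fun e f k l =>
     ginv x.1.1.1 e * ginv f x.1.1.2 * ginv x.1.2 k * ginv l x.2 * T x.1.1.1 x.1.1.2 x.1.2 x.2 * Num.conj (T e f k l))).
  under eq_bigr => x _ do under eq_bigr => z _ do rewrite KE !mulr_suml.
  rewrite rmorph_sum /=.
  under [RHS]eq_bigr => s _ do rewrite -mulconjE conj_sum big_distrlr /=.
  rewrite [RHS]exchange_big /=; apply: eq_bigr => x _.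
  rewrite [RHS]exchange_big /=; apply: eq_bigr => z _.
  apply: eq_bigr => s _; rewrite (conjM (Phi s z) (S z)) /S.
  by move: (Phi s x) (Num.conj (Phi s z)) => ? ?; ring.
have vT : \sum_a \sum_b \sum_c \sum_d T a b c d * v 0 a * Num.conj (v 0 b) * v 0 c * Num.conj (v 0 d) =
    \sum_s (\sum_x Phi s x * S x) * Y s.
  rewrite (sum4_pair (fun a b c d => T a b c d * v 0 a * Num.conj (v 0 b) * v 0 c * Num.conj (v 0 d))).
  under [RHS]eq_bigr => s _ do rewrite mulr_suml.
  rewrite [RHS]exchange_big /=; apply: eq_bigr => x _.
  have -> : T x.1.1.1 x.1.1.2 x.1.2 x.2 * v 0 x.1.1.1 * Num.conj (v 0 x.1.1.2) * v 0 x.1.2 * Num.conj (v 0 x.2) =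
     S x * (v 0 x.1.1.1 * Num.conj (v 0 x.1.1.2) * v 0 x.1.2 * Num.conj (v 0 x.2)) by rewrite /S; ring.
  rewrite !vE !conj_sum big4 mulr_sumr; apply: eq_bigr => s _.
  by rewrite /Phi /Y !conjM; ring.
have YE : \sum_s cabs (Y s) ^+ 2 = reC (sesq v A v) ^+ 4.
  rewrite (sesq_factor_diag _ AE) reC_toC; apply: toC_inj.
  rewrite rmorph_sum toCX rmorph_sum /=.
  have -> : forall X : C, X ^+ 4 = X * X * X * X by move=> X; ring.
  rewrite big4; apply: eq_bigr => s _.
  by rewrite /Y !cabsM !cabs_conj -!toCM; congr toC; ring.
rewrite E8 vT reC_toC.
have P0 : 0 <= \sum_s cabs (\sum_x Phi s x * S x) ^+ 2 by apply: sumr_ge0 => s _; exact: sqr_ge0.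
have [_ E0] := sesq_real_ge0 v hA pA.
rewrite -(@ler_pXn2r _ 2) ?nnegrE ?cabs_ge0 ?mulr_ge0 ?sqrtr_ge0 ?sqr_ge0 //.
rewrite exprMn sqr_sqrtr // -exprM -YE.
exact: cauchy_schwarz.
Qed.

End Sesquilinear.
End CauchySchwarz.

(** * The Bochner inequality for the energy density *)

Section Bochner.
Context {R : realType} {n : nat}.
Local Notation C := (Cplx R).
Local Notation Cn := 'rV[C]_n.

Lemma rderive_conj (V : set Cn) (F : Cn -> C) v z : open V -> Ck 1 V F -> V z ->
  rderive v (fun w => Num.conj (F w)) z = Num.conj (rderive v F z).
Proof.
move=> oV hF Vz; have d := rdiff_conj (Ck_rdiff hF v Vz).
by have [_ ->] := @rdiff_rderivable _ _ v (fun w => Num.conj (F w)) z _ d.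
Qed.

Lemma dzbar_conj (V : set Cn) (F : Cn -> C) a z : open V -> Ck 1 V F -> V z ->
  dzbar a (fun w => Num.conj (F w)) z = Num.conj (dz a F z).
Proof.
move=> oV hF Vz; rewrite /dzbar /dz !(rderive_conj _ oV hF Vz).
rewrite !conjM conjB conjM conjCi conjV mulNr opprK.
by have -> : Num.conj (2 : C) = 2 by exact: (rmorph_nat Num.conj 2).
Qed.

Variables (V : set Cn) (U : set C) (c : C -> Cn) (c' : 'I_n -> C -> C).
Hypotheses (oV : open V) (oU : open U) (cV : forall s, U s -> V (c s)).
Hypothesis hc : forall a s, U s -> pdiff (fun s => c s 0 a) s (c' a s) 0.
Variable G : Cn -> 'M[C]_n.
Hypothesis smG : forall a b, smooth_on V (fun z => G z a b).

Definition energy (s : C) : C := herm_form (G (c s)) (\row_a c' a s).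

Lemma energyE s : energy s = \sum_a \sum_b c' a s * G (c s) a b * Num.conj (c' b s).
Proof.
rewrite /energy -[LHS]/(sesq _ _ _) sesqE; apply: eq_bigr => a _; apply: eq_bigr => b _.
by rewrite !mxE.
Qed.

Let Gc a b s := G (c s) a b.
Let T a b s := \sum_d dz d (fun z => G z a b) (c s) * c' d s.
Let S a b s := \sum_d dzbar d (fun z => G z a b) (c s) * Num.conj (c' d s).
Let Q a b s := \sum_d \sum_e dz e (dzbar d (fun z => G z a b)) (c s) * c' e s * Num.conj (c' d s).

Lemma energy_PS k : PCk k U energy.
Proof.
apply: (PCk_ext oU (phi := fun s => \sum_a \sum_b c' a s * G (c s) a b * Num.conj (c' b s))).
  by move=> s _; rewrite energyE.
apply: (PCk_sum oU) => a; apply: (PCk_sum oU) => b.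
have h a0 : PCk k U (c' a0) := curve_hol_derivative oU hc k a0.
apply: (PCkM oU); last exact: (PCk_conj oU (h b)).
apply: (PCkM oU); first exact: h.
exact: (PCk_curve oV oU cV hc (smG a b k)).
Qed.

Let c'' a s := pz (c' a) s.
Let dc' a s (Us : U s) : pdiff (c' a) s (c'' a s) 0 := hol_deriv_pdiff oU hc a Us.
Let dG a b s (Us : U s) : pdiff (Gc a b) s (T a b s) (S a b s) :=
  curve_pdiff oV (smG a b 1) (cV Us) (fun a => hc a Us).

Lemma energy_pdiff s : U s -> pdiff energy s
  (\sum_a \sum_b (c'' a s * Gc a b s + c' a s * T a b s) * Num.conj (c' b s))
  (\sum_a \sum_b (c' a s * S a b s * Num.conj (c' b s) + c' a s * Gc a b s * Num.conj (c'' b s))).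
Proof.
move=> Us.
have D := pdiff_sum (index_enum 'I_n) (fun a => pdiff_sum (index_enum 'I_n) (fun b =>
  pdiffM (pdiffM (dc' a Us) (dG a b Us)) (pdiff_conj (dc' b Us)))).
have N : \forall w \near s, \sum_a \sum_b c' a w * Gc a b w * Num.conj (c' b w) = energy w.
  by apply: filterS (near_open oU Us) => w _; rewrite energyE.
apply: pdiff_ext (pdiff_near N D); apply: eq_bigr => a _; apply: eq_bigr => b _.
  by rewrite conj0 mulr0 addr0.
by rewrite mul0r add0r.
Qed.

Lemma energy_ddbar s : U s -> pz (pzb energy) s =
  \sum_a \sum_b ((c'' a s * S a b s + c' a s * Q a b s) * Num.conj (c' b s) +
                 (c'' a s * Gc a b s + c' a s * T a b s) * Num.conj (c'' b s)).
Proof.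
move=> Us.
have N : \forall w \near s, pzb energy w =
  \sum_a \sum_b (c' a w * S a b w * Num.conj (c' b w) + c' a w * Gc a b w * Num.conj (c'' b w)).
  by apply: filterS (near_open oU Us) => w Uw; exact: pzbE (energy_pdiff Uw).
have [-> _] := pz_near N.
have dS a b : exists q, pdiff (S a b) s (Q a b s) q.
  have D := pdiff_sum (index_enum 'I_n) (fun d => pdiffM
    (curve_pdiff oV (Ck_dzbar oV d (smG a b 2)) (cV Us) (fun a => hc a Us))
    (pdiff_conj (dc' d Us))).
  eexists; apply: pdiff_ext D; last reflexivity.
  by apply: eq_bigr => d _; rewrite conj0 mulr0 addr0 mulr_suml.
have dc'' b : exists l, pdiff (c'' b) s l 0 by exact: hol_derivative_hol oU (fun w Uw => dc' b Uw) _ Us.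
pose qS a b := projT1 (cid (dS a b)); have hS a b : pdiff (S a b) s (Q a b s) (qS a b) := projT2 (cid (dS a b)).
pose l b := projT1 (cid (dc'' b)); have hl b : pdiff (c'' b) s (l b) 0 := projT2 (cid (dc'' b)).
have D := pdiff_sum (index_enum 'I_n) (fun a => pdiff_sum (index_enum 'I_n) (fun b =>
  pdiffD (pdiffM (pdiffM (dc' a Us) (hS a b)) (pdiff_conj (dc' b Us)))
         (pdiffM (pdiffM (dc' a Us) (dG a b Us)) (pdiff_conj (hl b))))).
rewrite (pzE D); apply: eq_bigr => a _; apply: eq_bigr => b _.
by rewrite conj0 !mulr0 !addr0.
Qed.

Hypothesis hermG : forall z, V z -> hermitian (G z).
Hypothesis posG : forall z, V z -> posdef (G z).

Lemma S_adjoint a b s : U s -> S a b s = Num.conj (T b a s).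
Proof.
move=> Us; rewrite /S /T conj_sum; apply: eq_bigr => d _; rewrite conjM; congr (_ * _).
have Vs := cV Us.
rewrite -(dzbar_conj d oV (smG b a 1) Vs).
have E w : V w -> G w a b = Num.conj (G w b a).
  by move=> /hermG h; rewrite -{1}h !mxE.
have X v : rderive v (fun z => G z a b) (c s) = rderive v (fun w => Num.conj (G w b a)) (c s).
  have [h _] := (smG a b 1).2 v.
  by have [_ /esym] := @rderive_ext _ _ V (fun z => G z a b) (fun w => Num.conj (G w b a)) v (c s) oV Vs E (h _ Vs).
by rewrite /dzbar !X.
Qed.

Lemma energy_real s : U s -> energy s = toC (reC (energy s)) /\ 0 <= reC (energy s).
Proof. by move=> Us; apply: sesq_real_ge0; [apply: hermG | apply: posG]; exact: cV. Qed.

(** Let D be the covariant derivative of the velocity v. Then pz energy = <D, v> and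
    the complex Hessian of the energy is <D, D> - Rm (v, v, v, v), which tensor_bound
    controls; B is <D, D>. *)
Lemma energy_bochner s : U s -> exists2 B : R, 0 <= B &
  cabs (pz energy s) ^+ 2 <= B * reC (energy s) /\
  B - riemann_norm G (c s) * reC (energy s) ^+ 2 <= reC (pz (pzb energy) s).
Proof.
move=> Us; have hG := hermG (cV Us); have pG := posG (cV Us).
have uG := posdef_unit hG pG.
pose v : 'rV[C]_n := \row_a c' a s; pose A : 'rV[C]_n := \row_a c'' a s.
pose g := G (c s).
pose Tm : 'M[C]_n := \matrix_(a, b) T a b s.
pose Sm : 'M[C]_n := \matrix_(a, b) S a b s.
pose Qm : 'M[C]_n := \matrix_(a, b) Q a b s.
have SE : Sm = (conj_mx Tm)^T.
  by apply/matrixP => a b; rewrite !mxE S_adjoint.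
(* The covariant derivative of the velocity: second derivative plus Christoffel term. *)
pose D := A + v *m Tm *m invmx g.
have sesqDl u w (M : 'M[C]_n) x : sesq (u + w) M x = sesq u M x + sesq w M x.
  by rewrite /sesq !mulmxDl mxE.
have conj_mxD p q (M N : 'M[C]_(p, q)) : conj_mx (M + N) = conj_mx M + conj_mx N.
  exact: map_mxD.
have sesqDr u w (M : 'M[C]_n) x : sesq x M (u + w) = sesq x M u + sesq x M w.
  by rewrite /sesq conj_mxD linearD /= mulmxDr mxE.
have ig : (conj_mx (invmx g))^T = invmx g.
  by rewrite /conj_mx map_invmx trmx_inv -/(conj_mx g) [X in invmx X]hG.
have gi : (invmx g) *m g = 1%:M by rewrite mulVmx.
have gi' : g *m (invmx g) = 1%:M by rewrite mulmxV.
have e1 x : sesq (v *m Tm *m invmx g) g x = sesq v Tm x.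
  by rewrite /sesq -(mulmxA _ (invmx g) g) gi mulmx1.
have e2 x : sesq x g (v *m Tm *m invmx g) = sesq x Sm v.
  rewrite /sesq !conj_mxM !trmx_mul ig -SE !mulmxA -(mulmxA x g) gi' mulmx1.
  by rewrite -!mulmxA.
have pzE : pz energy s = sesq D g v.
  have [-> _] := pderE (energy_pdiff Us).
  rewrite /D sesqDl e1 !sesqE -big_split; apply: eq_bigr => a _ /=.
  by rewrite -big_split; apply: eq_bigr => b _ /=; rewrite !mxE mulrDl.
pose Rv := \sum_a \sum_b \sum_k \sum_l riemann G (c s) a b k l * v 0 a * Num.conj (v 0 b) * v 0 k * Num.conj (v 0 l).
have RvE : Rv = - sesq v Qm v + sesq v (Tm *m invmx g *m Sm) v.
  rewrite /Rv !sesqE -sumrN -big_split; apply: eq_bigr => a _ /=.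
  rewrite -sumrN -big_split; apply: eq_bigr => b _ /=.
  have -> : (Tm *m invmx g *m Sm) a b =
     \sum_k \sum_l (\sum_p \sum_q invmx g q p * dz k (fun w => G w a q) (c s) * dzbar l (fun w => G w p b) (c s)) * v 0 k * Num.conj (v 0 l).
    rewrite mxE.
    have -> : \sum_k \sum_l (\sum_p \sum_q invmx g q p * dz k (fun w => G w a q) (c s) * dzbar l (fun w => G w p b) (c s)) * v 0 k * Num.conj (v 0 l) =
      \sum_p \sum_q (\sum_k dz k (fun w => G w a q) (c s) * v 0 k) * invmx g q p * (\sum_l dzbar l (fun w => G w p b) (c s) * Num.conj (v 0 l)).
      under eq_bigr => k _ do under eq_bigr => l _ do rewrite !mulr_suml.
      under eq_bigr => k _ do rewrite exchange_big /=.
      rewrite exchange_big /=; apply: eq_bigr => p _.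
      under eq_bigr => k _ do under eq_bigr => l _ do rewrite !mulr_suml.
      under eq_bigr => k _ do rewrite exchange_big /=.
      rewrite exchange_big /=; apply: eq_bigr => q _.
      rewrite !mulr_suml; apply: eq_bigr => k _.
      by rewrite mulr_sumr; apply: eq_bigr => l _; ring.
    apply: eq_bigr => p _; rewrite !mxE mulr_suml; apply: eq_bigr => q _; rewrite !mxE.
    congr (_ * _ * _); first by apply: eq_bigr => k _; rewrite mxE.
    by apply: eq_bigr => l _; rewrite mxE.
  have -> : Qm a b = \sum_k \sum_l dz k (dzbar l (fun z => G z a b)) (c s) * v 0 k * Num.conj (v 0 l).
    rewrite mxE /Q exchange_big; apply: eq_bigr => k _; apply: eq_bigr => l _.
    by rewrite !mxE.
  rewrite !mulr_sumr !mulr_suml -sumrN -big_split; apply: eq_bigr => k _ /=.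
  rewrite !mulr_sumr !mulr_suml -sumrN -big_split; apply: eq_bigr => l _ /=.
  by rewrite /riemann; ring.
have ddE : pz (pzb energy) s = sesq D g D - Rv.
  rewrite (energy_ddbar Us) RvE /D sesqDl e1 !sesqDr !e2.
  have -> : sesq v Tm (v *m Tm *m invmx g) = sesq v (Tm *m invmx g *m Sm) v.
    by rewrite /sesq !conj_mxM !trmx_mul ig -SE !mulmxA.
  have -> : forall x1 x2 x3 x4 x5 : C, x1 + x2 + (x3 + x4) - (- x5 + x4) = x2 + x5 + (x1 + x3).
    by move=> *; ring.
  rewrite !sesqE -!big_split; apply: eq_bigr => a _ /=.
  rewrite -!big_split; apply: eq_bigr => b _ /=; rewrite !mxE /Gc /g; ring.
exists (reC (sesq D g D)); first by have [] := sesq_real_ge0 D hG pG.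
split; first by rewrite pzE; exact: sesq_cauchy_schwarz.
rewrite ddE reCB; apply: lerB => //.
apply: le_trans (ler_norm _) _; apply: le_trans (reC_le_cabs _) _.
exact: (@tensor_bound _ _ g (riemann G (c s)) v (fun p q => invmx g q p) hG pG (fun p q => erefl)).
Qed.

End Bochner.

(** * Integration over the plane *)

Section PlaneIntegrals.
Context {R : realType}.
Local Notation C := (Cplx R).
Local Notation mu := (@lebesgue_measure R).
Local Notation mu2 := (mu \x mu)%E.

(** The rational rectangles form a countable basis of the plane. *)
Lemma open_measurable2 (U : set (R * R)) : open U -> measurable U.
Proof.
move=> oU.
pose Q := (rat * rat * rat * rat)%type.
pose B (q : Q) : set (R * R) :=
  `]ratr q.1.1.1, ratr q.1.1.2[%classic `*` `]ratr q.1.2, ratr q.2[%classic.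
pose BU q := if pselect (B q `<=` U) then B q else set0.
have -> : U = \bigcup_q BU q.
  apply/seteqP; split=> [[x y] Uxy|p [q _]]; last first.
    by rewrite /BU; case: pselect => [qU /qU|].
  have : nbhs (x, y) U by apply: open_nbhs_nbhs; split.
  move=> /nbhs_ballP[e /= e0 he].
  have lt1 (u : R) : u - e < u by lra.
  have lt2 (u : R) : u < u + e by lra.
  have [a] := rat_in_itvoo (lt1 x); rewrite in_itv /= => /andP[a1 a2].
  have [b] := rat_in_itvoo (lt2 x); rewrite in_itv /= => /andP[b1 b2].
  have [c] := rat_in_itvoo (lt1 y); rewrite in_itv /= => /andP[c1 c2].
  have [d] := rat_in_itvoo (lt2 y); rewrite in_itv /= => /andP[d1 d2].
  have sub : B (a, b, c, d) `<=` U.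
    move=> [x' y'] [/=]; rewrite !in_itv /= => /andP[h1 h2] /andP[h3 h4].
    by apply: he; split; rewrite /ball /= ltr_norml; lra.
  exists (a, b, c, d) => //; rewrite /BU; case: pselect => [h|/(_ sub)//].
  by split; rewrite /= in_itv /= ?a2 ?c2.
apply: countable_bigcupT_measurable => [|q]; first exact: countableP.
by rewrite /BU; case: pselect => h; [exact: measurableX | exact: measurable0].
Qed.

Lemma continuous_measurable2 (F : R * R -> R) : continuous F -> measurable_fun setT F.
Proof.
move=> cF; apply: (measurability _ (measurable_realfun.RGenOInfty.measurableE R)) => //.
move=> /= _ [_ [a ->] <-]; rewrite setTI; apply: open_measurable2.
by apply: (open_comp (fun x _ => cF x)); exact: interval_open.
Qed.

Lemma oneDsqr_gt0 (x : R) : 0 < oneDsqr x.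
Proof. by apply: lt_le_trans (oneDsqr_ge1 x). Qed.

(** An integrable majorant of (1 + |z|^2)^-2 whose integral is a product. *)
Definition weight (p : R * R) : R := (oneDsqr p.1)^-1 * (oneDsqr p.2)^-1.

Lemma weight_ge0 p : 0 <= weight p.
Proof. by rewrite mulr_ge0 // invr_ge0 ltW // oneDsqr_gt0. Qed.

Lemma weight_continuous : continuous weight.
Proof.
move=> p; apply: cvgM.
  apply: (@continuous_comp _ _ _ (fun p : R * R => p.1) (fun x => (oneDsqr x)^-1)); first exact: cvg_fst.
  exact: continuous_oneDsqrV.
apply: (@continuous_comp _ _ _ (fun p : R * R => p.2) (fun x => (oneDsqr x)^-1)); first exact: cvg_snd.
exact: continuous_oneDsqrV.
Qed.

Lemma integralT_oneDsqr : (\int[mu]_x ((oneDsqr x)^-1)%:E = pi%:E)%E.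
Proof.
rewrite ge0_symfun_integralT.
- rewrite -set_itvcy integral0y_oneDsqr -EFinM; congr EFin; by field.
- by move=> x; rewrite invr_ge0 ltW // oneDsqr_gt0.
- exact: continuous_oneDsqrV.
- by move=> x /=; rewrite /oneDsqr sqrrN.
Qed.

Lemma weight_integrable : mu2.-integrable setT (EFin \o weight).
Proof.
have /measurable_EFinP mw := continuous_measurable2 weight_continuous.
apply/integrable12ltyP => //.
have E x : (\int[mu]_y `|(EFin \o weight) (x, y)| = ((oneDsqr x)^-1 * pi)%:E)%E.
  rewrite EFinM -integralT_oneDsqr -ge0_integralZl //=.
  - by apply: eq_integral => y _; rewrite /= ger0_norm ?weight_ge0 // EFinM.
  - by apply/measurable_EFinP; exact: continuous_measurable_fun continuous_oneDsqrV.
under eq_integral do rewrite E mulrC EFinM.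
rewrite ge0_integralZl //=.
- by rewrite integralT_oneDsqr -EFinM ltry.
- by apply/measurable_EFinP; exact: continuous_measurable_fun continuous_oneDsqrV.
- by rewrite lee_fin pi_ge0.
Qed.

Lemma decay_integrable (F : R * R -> R) (K : R) : continuous F ->
  (forall p, `|F p| <= K * weight p) -> mu2.-integrable setT (EFin \o F).
Proof.
move=> cF FK.
have iK : mu2.-integrable setT (fun p => K%:E * (weight p)%:E)%E.
  by apply: integrableZl => //; exact: weight_integrable.
apply: le_integrable iK => //.
  by apply/measurable_EFinP; exact: continuous_measurable2 cF.
move=> p _; rewrite /= lee_fin; apply: le_trans (FK p) _; exact: ler_norm.
Qed.

Definition side (M : R) : set R := `[- M, M]%classic.
Definition box (M : R) : set (R * R) := side M `*` side M.

Lemma side_measurable M : measurable (side M).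
Proof. exact: measurable_itv. Qed.

Lemma box_measurable M : measurable (box M).
Proof. by apply: measurableX; exact: side_measurable. Qed.

Lemma in_box M (p : R * R) : box M p <-> (- M <= p.1 <= M) /\ (- M <= p.2 <= M).
Proof. by rewrite /box /side /setX /= !in_itv. Qed.

Lemma box_finite M : (mu2 (box M) < +oo)%E.
Proof.
rewrite product_measure1E; [|exact: side_measurable|exact: side_measurable].
rewrite /side /= !lebesgue_measure_itv /=.
by case: ifP => _; rewrite -?EFinM ?mule0 ltry.
Qed.

Lemma box_compact M : compact (box M).
Proof. by apply: compact_setX; exact: segment_compact. Qed.

Lemma box_bounded (F : R * R -> R) M : continuous F -> exists2 K : R, 0 <= K &
  forall p, box M p -> `|F p| <= K.
Proof.
move=> cF; have cb : compact (F @` box M).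
  by apply: continuous_compact; [exact: continuous_subspaceT | exact: box_compact].
have [N [_ hN]] := compact_bounded cb.
exists (`|N| + 1); first by rewrite addr_ge0.
by move=> p bp; apply: hN; [rewrite (le_lt_trans (ler_norm _)) // ltrDl | exists p].
Qed.

Lemma box_integrable (F : R * R -> R) M : continuous F -> mu2.-integrable (box M) (EFin \o F).
Proof.
move=> cF; have [K K0 hK] := box_bounded M cF.
apply: measurable_bounded_integrable; [exact: box_measurable | exact: box_finite | |].
  apply: measurable_funTS; exact: continuous_measurable2.
exists K; split; first exact: num_real.
by move=> x Kx p bp; apply: le_trans (hK p bp) (ltW Kx).
Qed.

Lemma slice_x (X : R * R -> R) (y : R) : continuous X -> continuous (fun x => X (x, y)).
Proof.
move=> cX x; apply: (@continuous_comp _ _ _ (fun x : R => (x, y)) X); last exact: cX.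
by apply: (@cvg_pair _ _ _ _ (nbhs x) (nbhs y)); [exact: cvg_id | exact: cvg_cst].
Qed.

Lemma slice_y (X : R * R -> R) (x : R) : continuous X -> continuous (fun y => X (x, y)).
Proof.
move=> cX y; apply: (@continuous_comp _ _ _ (fun y : R => (x, y)) X); last exact: cX.
by apply: (@cvg_pair _ _ _ _ (nbhs x) (nbhs y)); [exact: cvg_cst | exact: cvg_id].
Qed.

Lemma side_FTC (h h' : R -> R) (M : R) : 0 < M -> continuous h' ->
  (forall x : R, is_derive x 1 h (h' x)) ->
  (\int[mu]_(x in side M) (h' x)%:E = (h M - h (- M))%:E)%E.
Proof.
move=> M0 ch' dh; have NM : - M < M by lra.
have dd x : derivable h x 1 by have [] := dh x.
have cc : continuous h by move=> x; exact/differentiable_continuous/derivable1_diffP.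
rewrite EFinB (@continuous_FTC2 _ _ h) //.
- exact: continuous_subspaceT.
- by split; [move=> x _; exact: dd | exact: cvg_at_right_filter (cc _) | exact: cvg_at_left_filter (cc _)].
- by move=> x _; rewrite derive1E; have [] := dh x.
Qed.

Lemma side_integral_le (D : R -> R) (M K : R) : 0 < M -> 0 <= K -> continuous D ->
  (forall y, - M <= y <= M -> `|D y| <= K) ->
  `|fine (\int[mu]_(y in side M) (D y)%:E)| <= 2 * K * M.
Proof.
move=> M0 K0 cD bD; have NM : - M < M by lra.
have mS := side_measurable M.
have mD : measurable_fun (side M) (EFin \o D).
  by apply/measurable_EFinP; apply: measurable_funTS; exact: continuous_measurable_fun.
have B : (`|\int[mu]_(y in side M) (D y)%:E| <= (2 * K * M)%:E)%E.
  apply: (@le_trans _ _ (\int[mu]_(y in side M) `|(EFin \o D) y|)%E).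
    by apply: le_abse_integral.
  have KE : (0 <= K%:E)%E by rewrite lee_fin.
  have H : (\int[mu]_(y in side M) `|(EFin \o D) y| <= K%:E * mu (side M))%E.
    apply: integral_le_bound => //; apply: aeW => y /=.
    by rewrite /side /= in_itv /= => /bD h; rewrite lee_fin.
  apply: le_trans H _.
  rewrite /side /= lebesgue_measure_itv /= lte_fin NM -EFinD -EFinM lee_fin; lra.
have fin : (\int[mu]_(y in side M) (D y)%:E)%E \is a fin_num.
  by rewrite fin_num_abs (le_lt_trans B) // ltry.
by move: B; rewrite -[X in abse X](fineK fin) /= lee_fin.
Qed.

Lemma restrict_box_x (X : R * R -> R) (M y : R) :
  (fun x => ((EFin \o X) \_ (box M)) (x, y)) =
  if y \in side M then (EFin \o (fun x => X (x, y))) \_ (side M) else cst 0%E.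
Proof.
apply/funext => x; case: ifPn => ym; rewrite ?patchE.
  by congr (if _ then _ else _); apply/idP/idP => /set_mem h; apply/mem_set;
    [case: h | split=> //; exact: set_mem].
by rewrite memNset // => -[_ h]; case/negP: ym; exact: mem_set.
Qed.

Lemma restrict_box_y (X : R * R -> R) (M x : R) :
  (fun y => ((EFin \o X) \_ (box M)) (x, y)) =
  if x \in side M then (EFin \o (fun y => X (x, y))) \_ (side M) else cst 0%E.
Proof.
apply/funext => y; case: ifPn => xm; rewrite ?patchE.
  by congr (if _ then _ else _); apply/idP/idP => /set_mem h; apply/mem_set;
    [case: h | split=> //; exact: set_mem].
by rewrite memNset // => -[h _]; case/negP: xm; exact: mem_set.
Qed.

Lemma restricted_box_integrable (X : R * R -> R) (M : R) : continuous X ->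
  mu2.-integrable setT ((EFin \o X) \_ (box M)).
Proof.
move=> cX; apply/integrable_restrict => //; rewrite ?setTI; first exact: box_measurable.
exact: box_integrable.
Qed.

Lemma box_integral_x (r X : R * R -> R) (M K : R) : 0 < M -> continuous r -> continuous X ->
  (forall x y : R, is_derive x 1 (fun x : R => r (x, y)) (X (x, y))) ->
  (forall y, - M <= y <= M -> `|r (M, y)| <= K /\ `|r (- M, y)| <= K) ->
  `|\int[mu2]_(p in box M) X p| <= 4 * K * M.
Proof.
move=> M0 cr cX dr bK.
have K0 : 0 <= K by have [|h _] := bK 0; [lra | exact: le_trans h].
pose D y := r (M, y) - r (- M, y).
have E : (\int[mu2]_(p in box M) (X p)%:E = \int[mu]_(y in side M) (D y)%:E)%E.
  rewrite integral_mkcond -(integral21_prod_meas1 (restricted_box_integrable M cX)).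
  rewrite [RHS]integral_mkcond; apply: eq_integral => y _; rewrite patchE /fubini_G restrict_box_x.
  case: ifP => _; last exact: integral0.
  by rewrite -integral_mkcond; exact: (side_FTC M0 (slice_x (y := y) cX) (fun x => dr x y)).
rewrite /Rintegral E (_ : 4 * K * M = 2 * (2 * K) * M); last by ring.
apply: side_integral_le => //; first by rewrite mulr_ge0.
  by move=> y; apply: cvgB; exact: slice_y.
by move=> y /bK[h1 h2]; apply: le_trans (ler_normB _ _) _; lra.
Qed.

Lemma box_integral_y (r X : R * R -> R) (M K : R) : 0 < M -> continuous r -> continuous X ->
  (forall x y : R, is_derive y 1 (fun y : R => r (x, y)) (X (x, y))) ->
  (forall x, - M <= x <= M -> `|r (x, M)| <= K /\ `|r (x, - M)| <= K) ->
  `|\int[mu2]_(p in box M) X p| <= 4 * K * M.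
Proof.
move=> M0 cr cX dr bK.
have K0 : 0 <= K by have [|h _] := bK 0; [lra | exact: le_trans h].
pose D x := r (x, M) - r (x, - M).
have E : (\int[mu2]_(p in box M) (X p)%:E = \int[mu]_(x in side M) (D x)%:E)%E.
  rewrite integral_mkcond -(integral12_prod_meas1 (restricted_box_integrable M cX)).
  rewrite [RHS]integral_mkcond; apply: eq_integral => x _; rewrite patchE /fubini_F restrict_box_y.
  case: ifP => _; last exact: integral0.
  by rewrite -integral_mkcond; exact: (side_FTC M0 (slice_y (x := x) cX) (fun y => dr x y)).
rewrite /Rintegral E (_ : 4 * K * M = 2 * (2 * K) * M); last by ring.
apply: side_integral_le => //; first by rewrite mulr_ge0.
  by move=> x; apply: cvgB; exact: slice_x.
by move=> x /bK[h1 h2]; apply: le_trans (ler_normB _ _) _; lra.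
Qed.

Lemma xy_continuous : continuous (fun p : R * R => xy p.1 p.2 : C).
Proof.
move=> p.
have c1 : {for p, continuous (fun p : R * R => toC p.1)}.
  by apply: (@continuous_comp _ _ _ (fun p : R * R => p.1) (@toC R)); [exact: cvg_fst | exact: toC_continuous].
have c2 : {for p, continuous (fun p : R * R => toC p.2)}.
  by apply: (@continuous_comp _ _ _ (fun p : R * R => p.2) (@toC R)); [exact: cvg_snd | exact: toC_continuous].
exact: (forD c1 (forM (@for_cst R _ p 'i) c2)).
Qed.

Lemma plane_continuous (g : C -> C) : continuous g ->
  continuous (fun p : R * R => reC (g (xy p.1 p.2))).
Proof.
move=> cg p; apply: (@continuous_comp _ _ _ (fun p : R * R => xy p.1 p.2) (fun z => reC (g z))).
  exact: xy_continuous.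
by apply: (@continuous_comp _ _ _ g (@reC R)); [exact: cg | exact: reC_continuous].
Qed.

Lemma plane_continuous_im (g : C -> C) : continuous g ->
  continuous (fun p : R * R => imC (g (xy p.1 p.2))).
Proof.
move=> cg p; apply: (@continuous_comp _ _ _ (fun p : R * R => xy p.1 p.2) (fun z => imC (g z))).
  exact: xy_continuous.
by apply: (@continuous_comp _ _ _ g imC); [exact: cg | exact: imC_continuous].
Qed.

Lemma half_sum_le (a b c : R) : `|a| <= c -> `|b| <= c -> 2^-1 * `|a + b| <= c.
Proof.
have := ler_normD a b; move: (`|a|) (`|b|) (`|a + b|) => u v w; lra.
Qed.

(** 2 Re q_z is the divergence of the vector field (Re q, Im q), and the boundary of
    the box, where q is O(M^-2), has length 8 M. *)
Lemma box_flux (q : C -> C) (K : R) : PCk 1 setT q ->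
  (forall z, 1 <= cabs z -> cabs (q z) <= K / cabs z ^+ 2) ->
  forall M, 1 <= M -> `|\int[mu2]_(p in box M) reC (pz q (xy p.1 p.2))| <= 4 * K / M.
Proof.
move=> hq decay M M1.
have M0 : 0 < M by lra.
have cq : continuous q by move=> z; exact: (PCk_continuous hq I).
have cp : continuous (pz q) by move=> z; exact: (PCk_continuous (PCk_pz hq) I).
have cb : continuous (pzb q) by move=> z; exact: (PCk_continuous (PCk_pzb hq) I).
have dq z : pdiff q z (pz q z) (pzb q z) by exact: (PCk_pdiff hq I).
have c1 : continuous (fun z => pz q z + pzb q z) by move=> z; exact: (forD (cp z) (cb z)).
have c2 : continuous (fun z => pz q z - pzb q z) by move=> z; exact: (forB (cp z) (cb z)).
have K0 : 0 <= K.
  have := decay 1; rewrite cabs1 expr1n divr1 lexx => /(_ isT); apply: le_trans; exact: cabs_ge0.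
have bnd x y : (`|x| = M) \/ (`|y| = M) -> cabs (q (xy x y)) <= K / M ^+ 2.
  move=> xyM; have zM : M <= cabs (xy x y).
    have := reC_le_cabs (xy x y); have := imC_le_cabs (xy x y); rewrite reC_xy imC_xy.
    by case: xyM => ->.
  apply: le_trans (decay _ (le_trans M1 zM)) _; apply: ler_wpM2l => //.
  rewrite lef_pV2 ?posrE ?exprn_gt0 //; last by lra.
  by rewrite ler_pXn2r // nnegrE; lra.
have nM : `|M| = M by rewrite ger0_norm // ltW.
have nNM : `|- M| = M by rewrite normrN.
have I1 := @box_integral_x (fun p => reC (q (xy p.1 p.2))) (fun p => reC (pz q (xy p.1 p.2) + pzb q (xy p.1 p.2)))
  M (K / M ^+ 2) M0 (plane_continuous cq) (plane_continuous c1).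
have I2 := @box_integral_y (fun p => imC (q (xy p.1 p.2))) (fun p => reC (pz q (xy p.1 p.2) - pzb q (xy p.1 p.2)))
  M (K / M ^+ 2) M0 (plane_continuous_im cq) (plane_continuous c2).
have {}I1 : `|\int[mu2]_(p in box M) reC (pz q (xy p.1 p.2) + pzb q (xy p.1 p.2))| <= 4 * (K / M ^+ 2) * M.
  apply: I1 => [x y|y _] /=.
    have [+ _] := rdiff_is_derive (@rdiff_comp _ q (xy ^~ y) x _ _ _ (dq (xy x y)) (rdiff_xyl x y)).
    by rewrite mulr1 conj1 mulr1.
  by split; apply: le_trans (reC_le_cabs _) _; apply: bnd; left.
have {}I2 : `|\int[mu2]_(p in box M) reC (pz q (xy p.1 p.2) - pzb q (xy p.1 p.2))| <= 4 * (K / M ^+ 2) * M.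
  apply: I2 => [x y|x _] /=.
    have [_] := rdiff_is_derive (@rdiff_comp _ q (xy x) y _ _ _ (dq (xy x y)) (rdiff_xyr x y)).
    rewrite conjCi; have -> : pz q (xy x y) * 'i + pzb q (xy x y) * - 'i = 'i * (pz q (xy x y) - pzb q (xy x y)) by ring.
    by rewrite imCM reCi imCi mul0r mul1r add0r.
  by split; apply: le_trans (imC_le_cabs _) _; apply: bnd; right.
have E : \int[mu2]_(p in box M) reC (pz q (xy p.1 p.2)) =
  2^-1 * (\int[mu2]_(p in box M) reC (pz q (xy p.1 p.2) + pzb q (xy p.1 p.2)) +
          \int[mu2]_(p in box M) reC (pz q (xy p.1 p.2) - pzb q (xy p.1 p.2))).
  rewrite -RintegralD; [|exact: box_measurable|exact: box_integrable (plane_continuous c1)|exact: box_integrable (plane_continuous c2)].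
  rewrite -RintegralZl; [|exact: box_measurable|]; last first.
    apply: box_integrable; move=> p.
    by apply: cvgD; [exact: (plane_continuous c1) | exact: (plane_continuous c2)].
  by apply: eq_Rintegral => p _; rewrite reCD reCB; field.
rewrite E normrM ger0_norm ?invr_ge0 //.
have -> : 4 * K / M = 4 * (K / M ^+ 2) * M by field; rewrite gt_eqF.
exact: half_sum_le I1 I2.
Qed.

Lemma Rintegral_le0_of_boxes (F : R * R -> R) (K : R) : continuous F ->
  mu2.-integrable setT (EFin \o F) ->
  (forall M, 1 <= M -> \int[mu2]_(p in box M) F p <= K / M) ->
  \int[mu2]_p F p <= 0.
Proof.
move=> cF iF H.
pose fn (n : nat) := (EFin \o F) \_ (box n.+1%:R).
have mn n : measurable_fun setT (fn n).
  apply/(measurable_restrictT _ (box_measurable _)).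
  by apply: measurable_funTS; apply/measurable_EFinP; exact: continuous_measurable2.
have mF : measurable_fun setT (EFin \o F) by apply/measurable_EFinP; exact: continuous_measurable2.
have cvgn (p : R * R) : setT p -> fn ^~ p @ \oo --> (EFin \o F) p.
  move=> _; apply: cvg_near_cst.
  exists (Num.trunc (`|p.1| + `|p.2|)) => // m /= hm.
  rewrite /fn patchE mem_set //.
  have /andP[_ t] := truncn_itv (addr_ge0 (normr_ge0 p.1) (normr_ge0 p.2)).
  have t2 : `|p.1| + `|p.2| <= m.+1%:R.
    by apply: le_trans (ltW t) _; rewrite ler_nat.
  have n1 := normr_ge0 p.1; have n2 := normr_ge0 p.2.
  by apply/in_box; rewrite -!ler_norml; split; lra.
have dom n (p : R * R) : setT p -> (`|fn n p| <= `|(EFin \o F) p|)%E.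
  by move=> _; rewrite /fn patchE; case: ifP => // _; rewrite abse0 abse_ge0.
have L : (\int[mu2]_p fn n p @[n --> \oo] --> \int[mu2]_p (EFin \o F) p)%E.
  have H1 := @dominated_cvg _ _ R mu2 setT measurableT fn (EFin \o F) (fun p => `|(EFin \o F) p|)%E.
  apply: (H1 mn cvgn _ (integrable_abse iF) dom) => p _; exact: isT.
have E n : (\int[mu2]_p fn n p = (\int[mu2]_(p in box n.+1%:R) F p)%:E)%E.
  rewrite /fn -integral_mkcond /Rintegral fineK //.
  by apply: integrable_fin_num; [exact: box_measurable | exact: box_integrable].
have fL : (\int[mu2]_p (EFin \o F) p)%E \is a fin_num by exact: integrable_fin_num.
have L2 : \int[mu2]_(p in box n.+1%:R) F p @[n --> \oo] --> \int[mu2]_p F p.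
  have -> : (fun n : nat => \int[mu2]_(p in box n.+1%:R) F p) = fine \o (fun n => \int[mu2]_p fn n p)%E.
    by apply/funext => n /=; rewrite E.
  rewrite /Rintegral; apply: fine_cvg; rewrite fineK; last exact: fL.
  exact: L.
rewrite leNgt; apply/negP => pos.
have [n hn] : exists n : nat, K / n.+1%:R < \int[mu2]_(p in box n.+1%:R) F p.
  set J := \int[mu2]_p F p in L2 pos *; clearbody J.
  have J2 : 0 < J / 2 by rewrite divr_gt0.
  have /cvgrPdist_lt/(_ _ J2)[N _ hN] := L2.
  pose n := maxn N (Num.trunc (`|K| / (J / 2))).
  exists n; have := hN n (leq_maxl _ _); rewrite ltr_norml => /andP[h1 h2].
  have : K / n.+1%:R < J / 2.
    rewrite ltr_pdivrMr // mulrC -ltr_pdivrMr //.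
    apply: (@le_lt_trans _ _ (`|K| / (J / 2))).
      by apply: ler_wpM2r; [rewrite invr_ge0 ltW | exact: ler_norm].
    have /andP[_ t] : (Num.trunc (`|K| / (J / 2)))%:R <= `|K| / (J / 2) < (Num.trunc (`|K| / (J / 2))).+1%:R.
      by apply: truncn_itv; rewrite divr_ge0 // ltW.
    by apply: lt_le_trans t _; rewrite ler_nat ltnS leq_maxr.
  move=> h3; apply: lt_trans h3 _; rewrite ltrBlDr in h2; move: (J) h2 => j h2; move: h2.
  by set I := Rintegral _ _ _; clearbody I => h2; lra.
by have := H n.+1%:R; rewrite ler1n => /(_ isT); rewrite leNgt hn.
Qed.

End PlaneIntegrals.

(** * Functions and densities on the Riemann sphere *)

Section Sphere.
Context {R : realType}.
Local Notation C := (Cplx R).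
Local Notation mu := (@lebesgue_measure R).
Local Notation mu2 := (mu \x mu)%E.

(** The Fubini-Study area form is, up to a constant, dx dy / rho. *)
Definition rho (z : C) : R := (1 + cabs z ^+ 2) ^+ 2.

Lemma rho_ge1 z : 1 <= rho z.
Proof. by rewrite /rho expr2; have := sqr_ge0 (cabs z); nra. Qed.

Lemma rho_gt0 z : 0 < rho z.
Proof. by apply: lt_le_trans (rho_ge1 z). Qed.

Lemma rho_inv z : z != 0 -> rho z^-1 = rho z / cabs z ^+ 4.
Proof.
move=> z0; rewrite /rho cabsV; have : cabs z != 0 by rewrite cabs_eq0.
by move: (cabs z) => r r0; field.
Qed.

Lemma rhoV_le_weight (p : R * R) : (rho (xy p.1 p.2))^-1 <= weight p.
Proof.
case: p => x y /=; rewrite /weight -invfM lef_pV2 ?posrE ?rho_gt0 ?mulr_gt0 ?oneDsqr_gt0 //=.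
rewrite /rho sqr_cabs reC_xy imC_xy /oneDsqr.
by have := sqr_ge0 x; have := sqr_ge0 y; nra.
Qed.

Lemma disc_bounded (g : R -> C -> C) (a b : R) :
  (forall t z, a <= t <= b -> {for (t, z), continuous (fun p : R * C => g p.1 p.2)}) ->
  exists2 K : R, 0 <= K & forall t z, a <= t <= b -> cabs z <= 1 -> cabs (g t z) <= K.
Proof.
move=> cg.
pose F (p : R * (R * R)) : R := cabs (g p.1 (xy p.2.1 p.2.2)).
have cA : compact (`[a, b]%classic `*` box (1 : R)).
  by apply: compact_setX; [exact: segment_compact | exact: box_compact].
have cF : {within `[a, b]%classic `*` box (1 : R), continuous F}.
  apply: continuous_in_subspaceT => -[t p] /set_mem[/= + _]; rewrite in_itv /= => tab.
  have c0 : {for (t, p), continuous (fun q : R * (R * R) => xy q.2.1 q.2.2 : C)}.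
    apply: (@continuous_comp _ _ _ (fun q : R * (R * R) => q.2) (fun q : R * R => xy q.1 q.2 : C)).
      exact: cvg_snd.
    exact: xy_continuous.
  have c1 : {for (t, p), continuous (fun q : R * (R * R) => (q.1, xy q.2.1 q.2.2 : C))}.
    apply: (@cvg_pair _ _ _ _ (nbhs t) (nbhs (xy p.1 p.2 : C))); [exact: cvg_fst | exact: c0].
  apply: (@continuous_comp _ _ _ (fun q : R * (R * R) => (q.1, xy q.2.1 q.2.2 : C))
            (fun q : R * C => cabs (g q.1 q.2)) (t, p) c1).
  apply: (@continuous_comp _ _ _ (fun q : R * C => g q.1 q.2) cabs (t, xy p.1 p.2) (cg _ _ tab)).
  exact: cabs_continuous.
have cb := continuous_compact cF cA.
have [N [_ hN]] := compact_bounded cb.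
exists (`|N| + 1); first by rewrite addr_ge0.
move=> t z tab z1; apply: le_trans (ler_norm _) _.
apply: hN; first by rewrite (le_lt_trans (ler_norm _)) // ltrDl.
exists (t, (reC z, imC z)).
  have := reC_le_cabs z; have := imC_le_cabs z => h1 h2.
  split; first by rewrite /= in_itv.
  by apply/in_box => /=; rewrite -!ler_norml; split; lra.
rewrite /F /=; congr (cabs (g t _)); apply: Cext; [exact: reC_xy | exact: imC_xy].
Qed.

(** The two closed unit discs are compact and cover the sphere; on the second one
    the Jacobian |z|^-4 of the inversion is comparable to 1 / rho. *)
Lemma sphere_density_bound (g0 g1 : R -> C -> C) (a b : R) :
  (forall t z, a <= t <= b -> {for (t, z), continuous (fun p : R * C => g0 p.1 p.2)}) ->
  (forall t z, a <= t <= b -> {for (t, z), continuous (fun p : R * C => g1 p.1 p.2)}) ->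
  (forall t z, a <= t <= b -> z != 0 -> cabs (g0 t z) = cabs (g1 t z^-1) / cabs z ^+ 4) ->
  exists2 K : R, 0 <= K & forall t z, a <= t <= b -> cabs (g0 t z) <= K / rho z.
Proof.
move=> c0 c1 E; have [K0 K00 h0] := disc_bounded c0; have [K1 K10 h1] := disc_bounded c1.
exists (4 * (K0 + K1)); first by rewrite mulr_ge0 // addr_ge0.
move=> t z tab; rewrite ler_pdivlMr ?rho_gt0 //.
have r0 := cabs_ge0 z; have [z1|z1] := leP (cabs z) 1.
  have g0K := h0 _ _ tab z1; have g00 := cabs_ge0 (g0 t z).
  have r4 : rho z <= 4.
    rewrite /rho; move: (cabs z) r0 z1 => r r0 r1; have : r ^+ 2 <= 1 by nra.
    by move: (r ^+ 2) (sqr_ge0 r) => s s0 s1; nra.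
  apply: (@le_trans _ _ (K0 * 4)); last by lra.
  by apply: ler_pM => //; exact: ltW (rho_gt0 z).
have z0 : z != 0 by rewrite -cabs_gt0; lra.
have zi : cabs z^-1 <= 1 by rewrite cabsV invf_le1; lra.
rewrite (E _ _ tab z0); have g1K := h1 _ _ tab zi; have g10 := cabs_ge0 (g1 t z^-1).
have p4 : 0 < cabs z ^+ 4 by rewrite exprn_gt0 //; lra.
have -> : cabs (g1 t z^-1) / cabs z ^+ 4 * rho z = cabs (g1 t z^-1) * (rho z / cabs z ^+ 4).
  by rewrite mulrAC mulrA.
have r4 : rho z / cabs z ^+ 4 <= 4.
  rewrite ler_pdivrMr // /rho; move: (cabs z) z1 => r r1.
  have : 1 <= r ^+ 2 by nra.
  rewrite (_ : r ^+ 4 = r ^+ 2 * r ^+ 2); last by ring.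
  by move: (r ^+ 2) => s s1; nra.
apply: (@le_trans _ _ (K1 * 4)); last by lra.
by apply: ler_pM => //; rewrite divr_ge0 // ltW // rho_gt0.
Qed.

Lemma const_time_continuous (g : C -> C) (t : R) (z : C) : continuous g ->
  {for (t, z), continuous (fun p : R * C => g p.2)}.
Proof.
move=> cg; apply: (@continuous_comp _ _ _ (fun p : R * C => p.2) g); first exact: cvg_snd.
exact: cg.
Qed.

(** The inversion is holomorphic with derivative - z^-2, whose conjugate multiplies
    dbar. *)
Lemma inversion_pzb (phi0 phi1 : C -> C) : PCk 1 setT phi0 -> PCk 1 setT phi1 ->
  (forall z, z != 0 -> phi0 z = phi1 z^-1) ->
  forall z, z != 0 -> pzb phi0 z = pzb phi1 z^-1 * Num.conj (- z ^- 2).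
Proof.
move=> h0 h1 E z z0.
have d := pdiff_comp (PCk_pdiff h1 (I : setT z^-1)) (pdiff_inv z0).
have N : \forall w \near z, phi1 w^-1 = phi0 w.
  have o : \forall w \near z, w != 0.
    apply/nbhsCP; exists (cabs z); first by rewrite cabs_gt0.
    by move=> w; apply: contraTneq => ->; rewrite sub0r cabsN ltxx.
  by apply: filterS o => w /E ->.
by rewrite (pzbE (pdiff_near N d)) mulr0 add0r.
Qed.

Lemma inversion_ddbar (phi0 phi1 : C -> C) : PCk 2 setT phi0 -> PCk 2 setT phi1 ->
  (forall z, z != 0 -> phi0 z = phi1 z^-1) ->
  forall z, z != 0 -> cabs (pz (pzb phi0) z) = cabs (pz (pzb phi1) z^-1) / cabs z ^+ 4.
Proof.
move=> h0 h1 E z z0.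
have E1 := inversion_pzb (PCk_le h0) (PCk_le h1) E.
have o : \forall w \near z, w != 0.
  apply/nbhsCP; exists (cabs z); first by rewrite cabs_gt0.
  by move=> w; apply: contraTneq => ->; rewrite sub0r cabsN ltxx.
have N : \forall w \near z, pzb phi1 w^-1 * Num.conj (- w ^- 2) = pzb phi0 w.
  by apply: filterS o => w /E1 ->.
have d1 := pdiff_comp (PCk_pdiff (PCk_pzb h1) (I : setT z^-1)) (pdiff_inv z0).
have d2 : pdiff (fun w => - (w^-1 * w^-1)) z (- (- z ^- 2 * z^-1 + z^-1 * - z ^- 2))
    (- (0 * z^-1 + z^-1 * 0)) by exact: (pdiffN (pdiffM (pdiff_inv z0) (pdiff_inv z0))).
have N2 : \forall w \near z, Num.conj (- (w^-1 * w^-1)) = Num.conj (- w ^- 2).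
  by apply: filterE => w; rewrite expr2 invfM.
have d3 := pdiff_near N2 (pdiff_conj d2).
have := pzE (pdiff_near N (pdiffM d1 d3)).
rewrite !(mul0r, mulr0, addr0, oppr0, conj0) => ->.
by rewrite !cabsM cabs_conj !cabsN !cabsV !cabsX -mulrA -invfM -exprD.
Qed.

(** dbar phi0 is a smooth (0,1)-form near infinity, where the conjugate differential of
    the coordinate 1 / z is - zbar^-2 dzbar. *)
Lemma sphere_flux_decay (phi0 phi1 : C -> C) : PCk 1 setT phi0 -> PCk 1 setT phi1 ->
  (forall z, z != 0 -> phi0 z = phi1 z^-1) ->
  exists2 K : R, 0 <= K & forall z, 1 <= cabs z -> cabs (pzb phi0 z) <= K / cabs z ^+ 2.
Proof.
move=> h0 h1 E; have E1 := inversion_pzb h0 h1 E.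
have cb : continuous (pzb phi1) by move=> z; exact: (PCk_continuous (PCk_pzb h1) I).
have [K K0 hK] := @disc_bounded (fun _ => pzb phi1) 0 0 (fun t z _ => const_time_continuous (t := t) cb).
exists K => // z z1; have z0 : z != 0 by rewrite -cabs_gt0; lra.
rewrite (E1 _ z0) cabsM cabs_conj cabsN cabsV cabsX; apply: ler_wpM2r.
  by rewrite invr_ge0 exprn_ge0 // cabs_ge0.
by apply: (hK 0); rewrite ?lexx // cabsV invf_le1; lra.
Qed.

Lemma ddbar_integrable (phi0 phi1 : C -> C) : PCk 2 setT phi0 -> PCk 2 setT phi1 ->
  (forall z, z != 0 -> phi0 z = phi1 z^-1) ->
  mu2.-integrable setT (EFin \o (fun p => reC (pz (pzb phi0) (xy p.1 p.2)))).
Proof.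
move=> h0 h1 E.
have c0 : continuous (pz (pzb phi0)) by move=> z; exact: (PCk_continuous (PCk_pz (PCk_pzb h0)) I).
have c1 : continuous (pz (pzb phi1)) by move=> z; exact: (PCk_continuous (PCk_pz (PCk_pzb h1)) I).
have [K K0 hK] := @sphere_density_bound (fun _ => pz (pzb phi0)) (fun _ => pz (pzb phi1)) 0 0
  (fun t z _ => const_time_continuous (t := t) c0) (fun t z _ => const_time_continuous (t := t) c1)
  (fun t z _ => inversion_ddbar h0 h1 E (z := z)).
apply: (@decay_integrable _ _ K (plane_continuous c0)) => p.
apply: le_trans (reC_le_cabs _) _; apply: le_trans (hK 0 _ _) _; first by rewrite lexx.
by apply: ler_wpM2l => //; exact: rhoV_le_weight.
Qed.

(** Stokes' theorem: d dbar phi0 is the differential of dbar phi0, whose flux through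
    the boundary of a large square tends to 0. *)
Lemma sphere_ddbar_integral (phi0 phi1 : C -> C) : PCk 2 setT phi0 -> PCk 2 setT phi1 ->
  (forall z, z != 0 -> phi0 z = phi1 z^-1) ->
  \int[mu2]_p reC (pz (pzb phi0) (xy p.1 p.2)) = 0.
Proof.
have half (f0 f1 : C -> C) : PCk 2 setT f0 -> PCk 2 setT f1 ->
    (forall z, z != 0 -> f0 z = f1 z^-1) ->
    \int[mu2]_p reC (pz (pzb f0) (xy p.1 p.2)) <= 0.
  move=> h0 h1 E; have [K K0 hK] := sphere_flux_decay (PCk_le h0) (PCk_le h1) E.
  have c0 : continuous (pz (pzb f0)) by move=> z; exact: (PCk_continuous (PCk_pz (PCk_pzb h0)) I).
  apply: (@Rintegral_le0_of_boxes _ _ (4 * K) (plane_continuous c0) (ddbar_integrable h0 h1 E)) => M M1.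
  exact: le_trans (ler_norm _) (box_flux (PCk_pzb h0) hK M1).
move=> h0 h1 E; apply/eqP; rewrite eq_le (half _ _ h0 h1 E) /=.
have NN (f : C -> C) z : PCk 2 setT f -> pz (pzb (fun z => - f z)) z = - pz (pzb f) z.
  move=> h; have E1 : \forall w \near z, - pzb f w = pzb (fun z => - f z) w.
    by apply: filterE => w; rewrite (pzbE (pdiffN (PCk_pdiff h (I : setT w)))).
  by rewrite (pzE (pdiff_near E1 (pdiffN (PCk_pdiff (PCk_pzb h) (I : setT z))))).
have := half _ _ (PCkN openT h0) (PCkN openT h1) (fun z z0 => congr1 -%R (E z z0)).
have -> : (fun p : R * R => reC (pz (pzb (fun z => - phi0 z)) (xy p.1 p.2))) =
    (fun p => - 1 * reC (pz (pzb phi0) (xy p.1 p.2))).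
  by apply/funext => p; rewrite NN // reCN mulN1r.
rewrite RintegralZl //; last exact: ddbar_integrable h0 h1 E.
by rewrite mulN1r oppr_le0.
Qed.

End Sphere.

(** * Holomorphic curves in a complex manifold *)

Section HolomorphicCurves.
Context {R : realType} {n : nat} {X : topologicalType}.
Local Notation C := (Cplx R).
Local Notation Cn := 'rV[C]_n.

Lemma differentiable_pdiff (c : C -> Cn) z : differentiable c z ->
  forall a, pdiff (fun s => c s 0 a) z (derive1 c z 0 a) 0.
Proof.
move=> /derivable1_diffP dc a.
have D : (fun h : C => h^-1 *: ((c \o shift z) (h *: 1) - c z)) @ 0^' --> derive1 c z.
  by rewrite derive1E; exact: dc.
split; first by exists (cabs (derive1 c z 0 a)) => h; rewrite mul0r addr0 cabsM.
move=> e e0.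
have N : nbhs (derive1 c z) [set y : Cn | cabs (y 0 a - derive1 c z 0 a) < e].
  by apply/nbhs_rowP; exists e => // y; apply.
have /nbhsCP[d d0 hd] := D _ N.
exists d => // h hh; have [->|h0] := eqVneq h 0.
  have c0 : cabs (0 : C) = 0 by apply/eqP; rewrite cabs_eq0.
  by rewrite !(addr0, subrr, mulr0, mul0r, subr0, c0).
have /= := hd h; rewrite subr0 => /(_ hh h0); rewrite /= !mxE [h *: 1]mulr1 => H.
have -> : c (z + h) 0 a - c z 0 a - (derive1 c z 0 a * h + 0 * Num.conj h) =
   h * (h^-1 * (c (h + z) 0 a - c z 0 a) - derive1 c z 0 a).
  by rewrite mul0r addr0 mulrBr mulrA divff // mul1r (addrC z) [h * _]mulrC.
by rewrite cabsM mulrC; apply: ler_wpM2r; [exact: cabs_ge0 | exact: ltW].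
Qed.

Lemma derive1_comp_jacobian (c : C -> Cn) (tau : Cn -> Cn) z :
  differentiable c z -> differentiable tau (c z) ->
  derive1 (tau \o c) z = derive1 c z *m jacobian tau (c z).
Proof.
move=> dc dt; have dtc := differentiable_comp dc dt.
rewrite (derive1E (tau \o c)) (derive1E c) (deriveE _ dtc) (deriveE _ dc).
have e := diff_comp dc dt.
have e1 := congr1 (fun f => f (1 : C)) e.
apply: etrans e1 _.
symmetry.
exact: (mul_rV_lin1 ('d tau (c z)) ('d c z (1 : C))).
Qed.

Lemma derive1_near (c1 c2 : C -> Cn) z : (\forall w \near z, c1 w = c2 w) ->
  derive1 c1 z = derive1 c2 z.
Proof. by move=> E; rewrite !derive1E; exact: (@near_eq_derive _ _ _ c1 c2 z 1 E). Qed.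

Lemma herm_form_pull (J A : 'M[C]_n) (v : Cn) :
  herm_form (J *m A *m (conj_mx J)^T) v = herm_form A (v *m J).
Proof. by rewrite /herm_form conj_mxM trmx_mul !mulmxA. Qed.

Variable M : complex_manifold R n X.
Local Notation I := (cindex M).

(** The value on the velocity of the form with local coefficients A, each point being
    read in the chart selected at its image, as in pullback_integral. *)
Definition density (A : I -> Cn -> 'M[C]_n) (u : C -> X) (z : C) : C :=
  herm_form (A (chart_at M (u z)) (chart (chart_at M (u z)) (u z))) (velocity M u z).

Lemma cimage_chart (i : I) x : cdom i x -> cimage i (chart i x).
Proof. by move=> ix; exists x. Qed.

Section OneCurve.
Variables (u : C -> X) (hu : holomorphic_curve M u).

Lemma curve_chart_open (i : I) : open [set z | cdom i (u z)].
Proof. by have [cu _] := hu; apply: (open_comp (fun x _ => cu x)); exact: cdom_open. Qed.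

Lemma curve_chart_pdiff (i : I) a z : cdom i (u z) ->
  pdiff (fun s => chart i (u s) 0 a) z (derive1 (chart i \o u) z 0 a) 0.
Proof. by move=> iz; have [_ d] := hu; exact: differentiable_pdiff (d _ _ iz) a. Qed.

Lemma chart_change_near (i j : I) z : cdom i (u z) -> cdom j (u z) ->
  \forall w \near z, chart j (u w) = transition i j (chart i (u w)).
Proof.
move=> iz jz; have N := near_open (curve_chart_open (i := i)) iz.
by apply: filterS N => w iw; rewrite /transition /= chartK.
Qed.

Lemma coverlap_curve (i j : I) z : cdom i (u z) -> cdom j (u z) -> coverlap i j (chart i (u z)).
Proof. by move=> iz jz; exists (u z). Qed.

Lemma velocity_change (i j : I) z : cdom i (u z) -> cdom j (u z) ->
  derive1 (chart j \o u) z =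
  derive1 (chart i \o u) z *m jacobian (transition i j) (chart i (u z)).
Proof.
move=> iz jz; have [_ d] := hu.
have := @derive1_comp_jacobian (chart i \o u) (transition i j) z (d _ _ iz) (transition_holomorphic (coverlap_curve iz jz)).
move=> <-; apply: derive1_near; exact: chart_change_near iz jz.
Qed.

(** The Jacobian of the change of charts acts on the velocity and on the form in
    opposite ways. *)
Lemma density_chart (A : I -> Cn -> 'M[C]_n) (i : I) z :
  (forall i j z, coverlap i j z ->
     A i z = jacobian (transition i j) z *m A j (transition i j z)
               *m (conj_mx (jacobian (transition i j) z))^T) ->
  cdom i (u z) ->
  density A u z = herm_form (A i (chart i (u z))) (derive1 (chart i \o u) z).
Proof.
move=> hA iz; set j := chart_at M (u z).
have jz : cdom j (u z) := cdom_chart_at M (u z).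
have tE : transition i j (chart i (u z)) = chart j (u z) by rewrite /transition /= chartK.
rewrite (hA i j _ (coverlap_curve iz jz)) herm_form_pull tE /density /velocity -/j.
exact: congr1 (velocity_change iz jz).
Qed.

End OneCurve.

Lemma velocity_inversion (u0 u1 : C -> X) : holomorphic_curve M u0 -> holomorphic_curve M u1 ->
  (forall w, w != 0 -> u1 w = u0 w^-1) -> forall w, w != 0 ->
  velocity M u1 w = - w ^- 2 *: velocity M u0 w^-1.
Proof.
move=> h0 h1 E w w0; apply/rowP => a; rewrite mxE mulrC /velocity (E _ w0).
set i := chart_at M _; have iz : cdom i (u0 w^-1) := cdom_chart_at M _.
have iz1 : cdom i (u1 w) by rewrite E.
have o : \forall v \near w, v != 0.
  apply/nbhsCP; exists (cabs w); first by rewrite cabs_gt0.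
  by move=> v; apply: contraTneq => ->; rewrite sub0r cabsN ltxx.
have N : \forall v \near w, chart i (u0 v^-1) 0 a = chart i (u1 v) 0 a.
  by apply: filterS o => v v0; rewrite E.
have d := pdiff_near N (pdiff_comp (curve_chart_pdiff h0 a iz) (pdiff_inv w0)).
have [e _] := pdiff_uniq (curve_chart_pdiff h1 a iz1) d.
apply: etrans e _; rewrite mul0r addr0.
reflexivity.
Qed.

(** The chart of X depends on the point of X only; so this is the factor - w^-2 of the
    velocity, squared in modulus. *)
Lemma density_inversion (u0 u1 : C -> X) (A : I -> Cn -> 'M[C]_n) :
  holomorphic_curve M u0 -> holomorphic_curve M u1 ->
  (forall w, w != 0 -> u1 w = u0 w^-1) -> forall w, w != 0 ->
  density A u1 w = toC ((cabs w ^+ 4)^-1) * density A u0 w^-1.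
Proof.
move=> h0 h1 E w w0; rewrite /density (velocity_inversion h0 h1 E w0) (E _ w0).
move: (A _ _) (velocity _ _ _) => B v; rewrite /herm_form.
have -> : conj_mx (- w ^- 2 *: v) = Num.conj (- w ^- 2) *: conj_mx v.
  by apply/matrixP => a b; rewrite !mxE conjM.
rewrite linearZ /= -!scalemxAl -scalemxAr !mxE mulrA; congr (_ * _).
by rewrite mulconjE cabsN cabsV cabsX exprVn -exprM.
Qed.

End HolomorphicCurves.

(** * Metrics along a holomorphic curve *)

Section MetricAlongCurve.
Context {R : realType} {n : nat} {X : topologicalType}.
Local Notation C := (Cplx R).
Local Notation Cn := 'rV[C]_n.

Lemma ddbar_local (U : set C) (phi psi : C -> C) z : open U ->
  (forall w, U w -> phi w = psi w) -> U z ->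
  pz phi z = pz psi z /\ pz (pzb phi) z = pz (pzb psi) z.
Proof.
move=> oU E Uz.
have N w : U w -> \forall v \near w, phi v = psi v.
  by move=> Uw; apply: filterS (near_open oU Uw) => v /E.
split; first by have [] := pz_near (N z Uz).
have N2 : \forall w \near z, pzb phi w = pzb psi w.
  by apply: filterS (near_open oU Uz) => w Uw; have [] := pz_near (N w Uw).
by have [] := pz_near N2.
Qed.

Lemma pz_ddbarB (U : set C) (phi psi : C -> C) z : open U -> U z ->
  PCk 2 U phi -> PCk 2 U psi ->
  pz (pzb (fun w => phi w - psi w)) z = pz (pzb phi) z - pz (pzb psi) z.
Proof.
move=> oU Uz h1 h2.
have N : \forall w \near z, pzb phi w - pzb psi w = pzb (fun w => phi w - psi w) w.
  apply: filterS (near_open oU Uz) => w Uw.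
  by rewrite (pzbE (pdiffB (PCk_pdiff h1 Uw) (PCk_pdiff h2 Uw))).
exact: pzE (pdiff_near N (pdiffB (PCk_pdiff (PCk_pzb h1) Uz) (PCk_pdiff (PCk_pzb h2) Uz))).
Qed.

Lemma ln_scale_sub (r a b : R) : 0 < r -> 0 < a -> 0 < b ->
  ln (r * a) - ln (r * b) = ln a - ln b.
Proof. by move=> r0 a0 b0; rewrite !lnM ?posrE // opprD addrACA subrr add0r. Qed.

Variable M : complex_manifold R n X.
Local Notation I := (cindex M).
Variables (u : C -> X) (hu : holomorphic_curve M u).

Let U (i : I) : set C := [set z | cdom i (u z)].
Let oU i : open (U i) := curve_chart_open hu (i := i).
Let c (i : I) (s : C) : Cn := chart i (u s).
Let c' (i : I) (a : 'I_n) (s : C) : C := derive1 (chart i \o u) s 0 a.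
Let V (i : I) : set Cn := cimage i.
Let oV i : open (V i) := @cimage_open _ _ _ M i.
Let cV i s : U i s -> V i (c i s).
Proof. exact: cimage_chart. Qed.
Let hc i a s : U i s -> pdiff (fun s => c i s 0 a) s (c' i a s) 0.
Proof. exact: (@curve_chart_pdiff _ _ _ _ u hu i a s). Qed.
Let at_ s : I := chart_at M (u s).
Let U_at s : U (at_ s) s := cdom_chart_at M (u s).

Lemma velocity_row i s : \row_a c' i a s = derive1 (chart i \o u) s.
Proof. by apply/rowP => a; rewrite mxE. Qed.

Lemma ddbar_log_along (h : Cn -> R) i z : (forall w, V i w -> 0 < h w) ->
  smooth_on (V i) (fun w => toC (h w)) -> U i z ->
  PCk 2 (U i) (fun s => toC (ln (h (c i s)))) /\
  pz (pzb (fun s => toC (ln (h (c i s))))) z =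
    - herm_form (minus_ddbar_log h (c i z)) (derive1 (chart i \o u) z).
Proof.
move=> h0 sh Uz; have hl : Ck 2 (V i) (fun w => toC (ln (h w))) := Ck_ln (@oV i) h0 (sh 2%N).
split; first exact: PCk_curve (@oV i) (@oU i) (@cV i) (@hc i) _ _ hl.
rewrite (curve_ddbar (@oV i) (@oU i) (@cV i) (@hc i) hl Uz) -[herm_form _ _]/(sesq _ _ _) sesqE.
rewrite exchange_big -sumrN /=; apply: eq_bigr => a _; rewrite -sumrN; apply: eq_bigr => b _.
by rewrite !mxE mulrN mulNr opprK [c' i a z * _]mulrC.
Qed.

Section Metric.
Variables (g : I -> Cn -> 'M[C]_n) (kg : kahler_metric g).

Let smG i : forall a b, smooth_on (V i) (fun z => g i z a b).
Proof. by case: kg => h _ _ _ _; exact: h. Qed.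
Let hermG i z : V i z -> hermitian (g i z).
Proof. by case: kg => _ h _ _ _; exact: h. Qed.
Let posG i z : V i z -> posdef (g i z).
Proof. by case: kg => _ _ h _ _ Vz v; exact: h. Qed.

Lemma density_energy i s : U i s -> density g u s = energy (c i) (c' i) (g i) s.
Proof.
move=> Us; rewrite /energy velocity_row; apply: density_chart => //.
by case: kg => _ _ _ h _; exact: h.
Qed.

Lemma density_PS k : PCk k setT (density g u).
Proof.
apply: PCk_local => z _; exists (U (at_ z)) => //.
apply: (PCk_ext (@oU (at_ z)) (phi := energy (c (at_ z)) (c' (at_ z)) (g (at_ z)))).
  by move=> s Us; rewrite (@density_energy (at_ z) s Us).
have H := energy_PS (@oV (at_ z)) (@oU (at_ z)) (@cV (at_ z)) (@hc (at_ z)) (@smG (at_ z)) k.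
exact: H.
Qed.

Lemma density_real s : density g u s = toC (reC (density g u s)) /\ 0 <= reC (density g u s).
Proof.
rewrite (@density_energy (at_ s) s (U_at s)).
exact: (energy_real (c' (at_ s)) (@cV (at_ s)) (@hermG (at_ s)) (@posG (at_ s)) (U_at s)).
Qed.

Lemma density_gt0 s : (0 < reC (density g u s)) = (velocity M u s != 0).
Proof.
have [v0|v0] := eqVneq (velocity M u s) 0.
  by rewrite /density v0 /herm_form !mul0mx mxE ltxx.
by have [] := gt0C (posG (cV (U_at s)) v0).
Qed.

Lemma density_bochner s : exists2 B : R, 0 <= B &
  cabs (pz (density g u) s) ^+ 2 <= B * reC (density g u s) /\
  B - riemann_norm (g (at_ s)) (chart (at_ s) (u s)) * reC (density g u s) ^+ 2 <=
    reC (pz (pzb (density g u)) s).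
Proof.
have [-> ->] := ddbar_local (@oU (at_ s)) (@density_energy (at_ s)) (U_at s).
rewrite (@density_energy (at_ s) s (U_at s)).
exact: (energy_bochner (@oV (at_ s)) (@oU (at_ s)) (@cV (at_ s)) (@hc (at_ s)) (@smG (at_ s)) (@hermG (at_ s)) (@posG (at_ s)) (U_at s)).
Qed.

Variables (h : I -> Cn -> R) (hh : hermitian_metric (anticanonical_bundle (M := M)) h).

Let det_pos i z : V i z -> 0 < reC (\det (g i z)).
Proof. by move=> Vz; have [] := posdef_det_gt0 (hermG Vz) (posG Vz). Qed.
Let h_pos i z : V i z -> 0 < h i z.
Proof. by case: hh => _ H _; exact: H. Qed.

(** The logarithm of the quotient of the two metrics h and det g on the anticanonical
    bundle. *)
Definition potential (s : C) : C :=
  toC (ln (h (at_ s) (c (at_ s) s)) - ln (reC (\det (g (at_ s) (c (at_ s) s))))).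

(** Both metrics are multiplied by the squared modulus of the Jacobian determinant. *)
Lemma potential_change i j z : coverlap i j z ->
  ln (h i z) - ln (reC (\det (g i z))) =
  ln (h j (transition i j z)) - ln (reC (\det (g j (transition i j z)))).
Proof.
move=> ijz.
have Vi : V i z by case: ijz => x [ix jx] <-; exists x.
have Vj : V j (transition i j z).
  by case: ijz => x [ix jx] <-; exists x => //; rewrite /transition /= chartK.
have Eh := (let: And3 _ _ e := hh in e) i j z ijz.
have Eg := (let: And5 _ _ _ e _ := kg in e) i j z ijz.
have hi := h_pos Vi; have hj := h_pos Vj; have gi := det_pos Vi; have gj := det_pos Vj.
pose J : C := \det (jacobian (transition i j) z).
pose r := cabs J ^+ 2.
have {}Eh : h i z = r * h j (transition i j z).
  by apply: toC_inj; rewrite Eh cabsE toCM toCX.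
have {}Eg : reC (\det (g i z)) = r * reC (\det (g j (transition i j z))).
  rewrite Eg !det_mulmx det_tr /conj_mx det_map_mx -/J mulrAC mulconjE reCZ //.
have r0 : 0 < r.
  rewrite lt_neqAle exprn_ge0 ?cabs_ge0 // andbT; apply/eqP => r0.
  by move: hi; rewrite Eh -r0 mul0r ltxx.
rewrite Eh Eg; exact: ln_scale_sub.
Qed.

Lemma potential_chart i s : U i s ->
  potential s = toC (ln (h i (c i s))) - toC (ln (reC (\det (g i (c i s))))).
Proof.
move=> Us; rewrite -toCB /potential.
have tE : transition (at_ s) i (c (at_ s) s) = c i s.
  by rewrite /transition /= chartK //; exact: U_at.
have E := potential_change (coverlap_curve (U_at s) Us); rewrite tE in E.
exact: congr1 (@toC R) _ _ E.
Qed.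

Let log_h i z (Uz : U i z) := ddbar_log_along (@h_pos i) ((let: And3 e _ _ := hh in e) i) Uz.
Let log_det i z (Uz : U i z) := ddbar_log_along (@det_pos i)
  (fun k => Ck_re (@oV i) (Ck_det (@oV i) (fun a b => @smG i a b k))) Uz.

Lemma potential_PS : PCk 2 setT potential.
Proof.
apply: PCk_local => z _; exists (U (at_ z)); first exact: U_at.
have [p1 _] := @log_h (at_ z) z (U_at z); have [p2 _] := @log_det (at_ z) z (U_at z).
apply: (PCk_ext (@oU (at_ z))) (PCkB (@oU (at_ z)) p1 p2) => s Us.
by rewrite (@potential_chart (at_ z) s Us).
Qed.

Lemma potential_ddbar s :
  pz (pzb potential) s = density (fun i => ricci (g i)) u s - density (chern_form h) u s.
Proof.
have [p1 e1] := @log_h (at_ s) s (U_at s); have [p2 e2] := @log_det (at_ s) s (U_at s).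
have [_ ->] := ddbar_local (@oU (at_ s)) (@potential_chart (at_ s)) (U_at s).
rewrite (pz_ddbarB (@oU (at_ s)) (U_at s) p1 p2) e1 e2 opprK addrC.
by [].
Qed.

End Metric.
End MetricAlongCurve.

(** * The flow along a holomorphic curve *)

Section FlowAlongCurve.
Context {R : realType} {n : nat} {X : topologicalType}.
Local Notation C := (Cplx R).
Local Notation Cn := 'rV[C]_n.
Local Notation mu := (@lebesgue_measure R).
Local Notation mu2 := (mu \x mu)%E.

Lemma tderivable_rdiff (f : R -> C) t : 0 < t -> tderivable f t -> rdiff f t (tderive f t).
Proof.
move=> t0 df; have D : tquot f t s @[s --> within [set s | 0 <= s] t^'] --> tderive f t by exact: df.
split; first by exists (cabs (tderive f t)) => h; rewrite cabsM cabs_toC mulrC.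
move=> e e0; have /cvgCP/(_ e e0) := D.
rewrite /within /= => /nbhs_ballP[d /= d0 hd].
exists (Num.min d t); first by rewrite lt_min d0.
move=> h; rewrite lt_min => /andP[hd1 ht].
have [->|h0] := eqVneq h 0.
  by rewrite addr0 subrr toC0 mul0r subr0 normr0 mulr0 (_ : cabs 0 = 0) //; apply/eqP; rewrite cabs_eq0.
have th : 0 <= t + h by move: ht; rewrite ltr_norml => /andP[h1 _]; lra.
have tb : ball t d (t + h) by rewrite /ball /= opprD addrA subrr sub0r normrN.
have := hd _ tb; rewrite -subr_eq0 addrAC subrr add0r => /(_ h0 th).
rewrite /tquot addrAC subrr add0r => H.
have -> : f (t + h) - f t - toC h * tderive f t =
    toC h * (toC h^-1 * (f (t + h) - f t) - tderive f t).
  by rewrite mulrBr mulrA -toCM divff // toC1 mul1r.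
by rewrite cabsM cabs_toC mulrC ler_wpM2r // ltW.
Qed.

Lemma rdiff_sum (T : Type) (r : seq T) (F : T -> R -> C) x (l : T -> C) :
  (forall i, rdiff (F i) x (l i)) ->
  rdiff (fun s => \sum_(i <- r) F i s) x (\sum_(i <- r) l i).
Proof.
move=> H; elim: r => [|i r IH].
  rewrite big_nil; apply: (@rdiff_near _ (fun=> 0)); last exact: rdiff_cst.
  by apply: filterE => s; rewrite big_nil.
rewrite big_cons; apply: rdiff_near (rdiffD (H i) IH).
by apply: filterE => s; rewrite big_cons.
Qed.

Lemma rdiff_uniq (phi : R -> C) x l l' : rdiff phi x l -> rdiff phi x l' -> l = l'.
Proof.
move=> /rdiff_is_derive[[_ E1] [_ E2]] /rdiff_is_derive[[_ E3] [_ E4]].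
by apply: Cext; [exact: etrans (esym E1) E3 | exact: etrans (esym E2) E4].
Qed.

Lemma open_slab (T : topologicalType) (V : set T) : open V ->
  open [set p : R * T | 0 < p.1 /\ V p.2].
Proof.
move=> oV; apply: (@openI _ [set p : R * T | 0 < p.1] [set p : R * T | V p.2]).
  by apply: (@open_comp _ _ (fun p : R * T => p.1) [set s | 0 < s]); [move=> p _; exact: cvg_fst | exact: open_gt].
by apply: (@open_comp _ _ (fun p : R * T => p.2) V) => // p _; exact: cvg_snd.
Qed.

Lemma Ck_time_continuous k (V : set Cn) (F : R -> Cn -> C) t z : open V ->
  Ck_time k V F -> 0 < t -> V z -> {for (t, z), continuous (fun p : R * Cn => F p.1 p.2)}.
Proof.
move=> oV hF t0 Vz; have {hF}cF : {within [set p : R * Cn | 0 <= p.1 /\ V p.2],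
     continuous (fun p : R * Cn => F p.1 p.2)} by case: k hF => [|k] [].
pose B := [set p : R * Cn | 0 < p.1 /\ V p.2].
have oB : open B := open_slab oV.
have : {within B, continuous (fun p : R * Cn => F p.1 p.2)}.
  by apply: continuous_subspaceW cF => p [h1 h2]; split=> //; exact: ltW.
by rewrite continuous_open_subspace // => /(_ (t, z)); apply; apply/mem_set.
Qed.

Variable M : complex_manifold R n X.
Local Notation I := (cindex M).

Lemma joint_continuous (u : C -> X) (hu : holomorphic_curve M u)
    (A : R -> I -> Cn -> 'M[C]_n) t z :
  (forall i a b s w, 0 < s -> cimage i w -> {for (s, w), continuous (fun p : R * Cn => A p.1 i p.2 a b)}) ->
  (forall i s w, 0 < s -> cdom i (u w) ->
    density (A s) u w = herm_form (A s i (chart i (u w))) (derive1 (chart i \o u) w)) ->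
  0 < t -> {for (t, z), continuous (fun p : R * C => density (A p.1) u p.2)}.
Proof.
move=> cA hA t0; set i := chart_at M (u z).
have iz : cdom i (u z) := cdom_chart_at M (u z).
pose c' a s := derive1 (chart i \o u) s 0 a.
pose F (p : R * C) := \sum_a \sum_b c' a p.2 * A p.1 i (chart i (u p.2)) a b * Num.conj (c' b p.2).
have oU := curve_chart_open hu (i := i).
have hc a s : cdom i (u s) -> pdiff (fun s => chart i (u s) 0 a) s (c' a s) 0.
  exact: (curve_chart_pdiff hu a).
have snd : {for (t, z), continuous (fun p : R * C => p.2)} by exact: cvg_snd.
have cc' a : {for (t, z), continuous (fun p : R * C => c' a p.2)}.
  have [l hl] := hol_derivative_hol oU (hc a) iz.
  exact: (@continuous_comp _ _ _ (fun p : R * C => p.2) (c' a) _ snd (pdiff_continuous hl)).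
have cc : {for (t, z), continuous (fun p : R * C => (p.1, chart i (u p.2)))}.
  have [cu _] := hu.
  have c1 : {for z, continuous (fun s => chart i (u s))}.
    apply: (@continuous_comp _ _ _ u (chart i)); [exact: cu | exact: chart_continuous].
  apply: (@cvg_pair _ _ _ _ (nbhs t) (nbhs (chart i (u z)))); first exact: cvg_fst.
  exact: (@continuous_comp _ _ _ (fun p : R * C => p.2) (fun s => chart i (u s)) _ snd c1).
have cF : {for (t, z), continuous F}.
  rewrite /F; apply: for_sum => a; apply: for_sum => b.
  apply: forM; last by apply: for_conj; exact: cc'.
  apply: forM; first exact: cc'.
  apply: (@continuous_comp _ _ _ (fun p : R * C => (p.1, chart i (u p.2))) (fun p => A p.1 i p.2 a b) _ cc).
  by apply: cA => //; exact: cimage_chart.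
have N : \forall p \near (t, z), F p = density (A p.1) u p.2.
  have n1 : \forall p \near (t, z), 0 < p.1.
    have : nbhs (t, z) [set p : R * C | 0 < p.1 /\ setT p.2].
      by apply: open_nbhs_nbhs; split=> //; exact: open_slab openT.
    by apply: filterS => p [].
  have n2 : \forall p \near (t, z), cdom i (u p.2).
    exact: (snd _ (near_open oU iz)).
  apply: filterS2 n1 n2 => p p0 pi.
  rewrite (hA i _ _ p0 pi) -[herm_form _ _]/(sesq _ _ _) sesqE //.
exact: near_eq_continuous N cF.
Qed.

Variables (gX : I -> Cn -> 'M[C]_n) (g : R -> I -> Cn -> 'M[C]_n) (flow : kahler_ricci_flow gX g).

Let kg t : 0 < t -> kahler_metric (g t).
Proof. by case: flow => H _ _ _ /ltW; exact: H. Qed.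

Section OneCurve.
Variables (u : C -> X) (hu : holomorphic_curve M u).

Lemma flow_density_chart i t z : 0 < t -> cdom i (u z) ->
  density (g t) u z = herm_form (g t i (chart i (u z))) (derive1 (chart i \o u) z).
Proof. by move=> t0 iz; apply: density_chart => //; case: (kg t0) => _ _ _ h _; exact: h. Qed.

Lemma flow_density_rdiff i t z : 0 < t -> cdom i (u z) ->
  rdiff (fun s => density (g s) u z) t
    (- herm_form (ricci (g t i) (chart i (u z))) (derive1 (chart i \o u) z)).
Proof.
move=> t0 iz; set w := chart i (u z); set v := derive1 _ _.
have Vw : cimage i w by exact: cimage_chart.
have D a b : rdiff (fun s => g s i w a b) t (- ricci (g t i) w a b).
  case: flow => _ sm fl _; rewrite -(fl t i w a b (ltW t0) Vw).
  have [_ [_ [d _]]] := sm i a b 1%N.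
  exact: (tderivable_rdiff t0 (d t w (ltW t0) Vw)).
have S : rdiff (fun s => \sum_a \sum_b v 0 a * g s i w a b * Num.conj (v 0 b)) t
    (\sum_a \sum_b v 0 a * (- ricci (g t i) w a b) * Num.conj (v 0 b)).
  apply: rdiff_sum => a; apply: rdiff_sum => b.
  have d := rdiffZ (Num.conj (v 0 b)) (rdiffZ (v 0 a) (D a b)).
  by rewrite [_ * Num.conj _]mulrC; apply: rdiff_near d; apply: filterE => s; rewrite [RHS]mulrC.
have E : - herm_form (ricci (g t i) w) v =
    \sum_a \sum_b v 0 a * (- ricci (g t i) w a b) * Num.conj (v 0 b).
  rewrite -[herm_form _ _]/(sesq _ _ _) sesqE -sumrN; apply: eq_bigr => a _.
  by rewrite -sumrN; apply: eq_bigr => b _; rewrite mulrN mulNr.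
rewrite E; apply: rdiff_near S.
have N : \forall s \near t, 0 < s by apply: open_nbhs_nbhs; split=> //; exact: open_gt.
apply: filterS N => s s0; rewrite (flow_density_chart s0 iz) -[herm_form _ _]/(sesq _ _ _) sesqE //.
Qed.

(** Up to sign this is the derivative in time of the energy density, which does not
    depend on the chart. *)
Lemma ricci_density_chart i t z : 0 < t -> cdom i (u z) ->
  density (fun i => ricci (g t i)) u z =
  herm_form (ricci (g t i) (chart i (u z))) (derive1 (chart i \o u) z).
Proof.
move=> t0 iz; apply: oppr_inj.
exact: (rdiff_uniq (flow_density_rdiff t0 (cdom_chart_at M (u z))) (flow_density_rdiff t0 iz)).
Qed.

Lemma flow_density_continuous t z : 0 < t ->
  {for (t, z), continuous (fun p : R * C => density (g p.1) u p.2)}.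
Proof.
apply: (joint_continuous hu (A := g)) => [i a b s w s0 iw|i s w]; last exact: flow_density_chart.
case: flow => _ sm _ _.
exact: (Ck_time_continuous (@cimage_open _ _ _ M i) (sm i a b 0%N) s0 iw).
Qed.

Lemma ricci_density_continuous t z : 0 < t ->
  {for (t, z), continuous (fun p : R * C => density (fun i => ricci (g p.1 i)) u p.2)}.
Proof.
apply: (joint_continuous hu (A := fun s i => ricci (g s i))) => [i a b s w s0 iw|i s w]; last exact: ricci_density_chart.
case: flow => _ sm fl _.
have [_ [_ [_ h]]] := sm i a b 1%N.
have c := forN (@Ck_time_continuous 0 (cimage i) (fun t z => tderive (fun s => g s i z a b) t) s w (@cimage_open _ _ _ M i) h s0 iw).
pose B := [set p : R * Cn | 0 < p.1 /\ cimage i p.2].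
have oB : open B := open_slab (@cimage_open _ _ _ M i).
have N : \forall p \near (s, w), - tderive (fun s => g s i p.2 a b) p.1 = ricci (g p.1 i) p.2 a b.
  have : nbhs (s, w) B by apply: open_nbhs_nbhs; split.
  by apply: filterS => p [p0 pi]; rewrite (fl _ _ _ _ _ (ltW p0) pi) opprK.
exact: (@near_eq_continuous _ _ _ (fun p : R * Cn => ricci (g p.1 i) p.2 a b) _ N c).
Qed.

End OneCurve.
End FlowAlongCurve.

(** * Constancy of the area *)

Section AreaOfSphere.
Context {R : realType} {n : nat} {X : topologicalType}.
Local Notation C := (Cplx R).
Local Notation Cn := 'rV[C]_n.
Local Notation mu := (@lebesgue_measure R).
Local Notation mu2 := (mu \x mu)%E.
Variable M : complex_manifold R n X.
Local Notation I := (cindex M).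
Variables (u0 u1 : C -> X) (hu0 : holomorphic_curve M u0) (hu1 : holomorphic_curve M u1).
Hypothesis glue : forall w, w != 0 -> u0 w = u1 w^-1.

Lemma density_sphere_bound (A : R -> I -> Cn -> 'M[C]_n) (a b : R) : 0 < a ->
  (forall t z, 0 < t -> {for (t, z), continuous (fun p : R * C => density (A p.1) u0 p.2)}) ->
  (forall t z, 0 < t -> {for (t, z), continuous (fun p : R * C => density (A p.1) u1 p.2)}) ->
  exists2 K : R, 0 <= K & forall t z, a <= t <= b -> cabs (density (A t) u0 z) <= K / rho z.
Proof.
move=> a0 c0 c1.
apply: (@sphere_density_bound _ (fun t z => density (A t) u0 z) (fun t z => density (A t) u1 z)).
- by move=> t z /andP[ta _]; apply: c0; exact: lt_le_trans ta.
- by move=> t z /andP[ta _]; apply: c1; exact: lt_le_trans ta.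
move=> t z _ z0; rewrite (density_inversion _ hu1 hu0 glue z0) cabsM cabs_toC mulrC.
by rewrite ger0_norm // invr_ge0 exprn_ge0 // cabs_ge0.
Qed.

Lemma slice_time (F : R -> C -> C) t : (forall z, {for (t, z), continuous (fun p : R * C => F p.1 p.2)}) ->
  continuous (F t).
Proof.
move=> c z; apply: (@continuous_comp _ _ _ (fun w : C => (t, w)) (fun p => F p.1 p.2)); last exact: c.
move=> A [[P Q] /= [Pt Qz] sub]; apply: filterS Qz => w Qw; apply: sub.
by split=> //=; exact: nbhs_singleton Pt.
Qed.

Variables (gX : I -> Cn -> 'M[C]_n) (g : R -> I -> Cn -> 'M[C]_n) (flow : kahler_ricci_flow gX g).

Let kg t : 0 < t -> kahler_metric (g t).
Proof. by case: flow => H _ _ _ /ltW; exact: H. Qed.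

Definition energy_at t (p : R * R) : R := reC (density (g t) u0 (xy p.1 p.2)).
Definition ricci_at t (p : R * R) : R := reC (density (fun i => ricci (g t i)) u0 (xy p.1 p.2)).

Lemma energy_at_continuous t : 0 < t -> continuous (energy_at t).
Proof.
move=> t0; apply: plane_continuous; apply: (@slice_time (fun t z => density (g t) u0 z) t) => z.
have H := flow_density_continuous flow hu0 t0.
exact: H.
Qed.

Lemma ricci_at_continuous t : 0 < t -> continuous (ricci_at t).
Proof.
move=> t0; apply: plane_continuous; apply: (@slice_time (fun t z => density (fun i => ricci (g t i)) u0 z) t) => z.
have H := ricci_density_continuous flow hu0 t0.
exact: H.
Qed.

Lemma energy_at_bound a b : 0 < a -> exists2 K : R, 0 <= K &
  forall t p, a <= t <= b -> `|energy_at t p| <= K * weight p.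
Proof.
move=> a0; have [K K0 hK] := @density_sphere_bound g a b a0
  (fun t z => @flow_density_continuous _ _ _ _ _ _ flow u0 hu0 t z)
  (fun t z => @flow_density_continuous _ _ _ _ _ _ flow u1 hu1 t z).
exists K => // t p tab; apply: le_trans (reC_le_cabs _) _; apply: le_trans (hK _ _ tab) _.
by apply: ler_wpM2l => //; exact: rhoV_le_weight.
Qed.

Lemma ricci_at_bound a b : 0 < a -> exists2 K : R, 0 <= K &
  forall t p, a <= t <= b -> `|ricci_at t p| <= K * weight p.
Proof.
move=> a0; have [K K0 hK] := @density_sphere_bound (fun t i => ricci (g t i)) a b a0
  (fun t z => @ricci_density_continuous _ _ _ _ _ _ flow u0 hu0 t z)
  (fun t z => @ricci_density_continuous _ _ _ _ _ _ flow u1 hu1 t z).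
exists K => // t p tab; apply: le_trans (reC_le_cabs _) _; apply: le_trans (hK _ _ tab) _.
by apply: ler_wpM2l => //; exact: rhoV_le_weight.
Qed.

Lemma energy_at_integrable t : 0 < t -> mu2.-integrable setT (EFin \o energy_at t).
Proof.
move=> t0; have [K K0 hK] := energy_at_bound t t0.
apply: (@decay_integrable _ _ K (energy_at_continuous t0)) => p.
by apply: hK; rewrite lexx.
Qed.

Lemma ricci_at_integrable t : 0 < t -> mu2.-integrable setT (EFin \o ricci_at t).
Proof.
move=> t0; have [K K0 hK] := ricci_at_bound t t0.
apply: (@decay_integrable _ _ K (ricci_at_continuous t0)) => p.
by apply: hK; rewrite lexx.
Qed.

Definition area t : R := \int[mu2]_p energy_at t p.

Lemma energy_at_derive (t : R) (p : R * R) : 0 < t -> is_derive t 1 (fun s : R => energy_at s p) (- ricci_at t p).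
Proof.
move=> t0; rewrite /ricci_at -reCN.
have [+ _] := rdiff_is_derive (flow_density_rdiff flow hu0 t0 (cdom_chart_at M (u0 (xy p.1 p.2)))).
by [].
Qed.

Lemma area_derive (t : R) : 0 < t -> is_derive t 1 area (- \int[mu2]_p ricci_at t p).
Proof.
move=> t0; have a0 : 0 < t / 2 by lra.
have [K K0 hK] := ricci_at_bound (2 * t) a0.
have uv (s : R) : (`]t / 2, 2 * t[%classic s) -> 0 < s /\ t / 2 <= s <= 2 * t.
  by rewrite /= in_itv /= => /andP[h1 h2]; split; lra.
have tin : `]t / 2, 2 * t[%classic t by rewrite /= in_itv /=; lra.
have dE (s : R) (p : R * R) : `]t / 2, 2 * t[%classic s -> setT p -> derivable (fun s : R => energy_at s p) s 1.
  by move=> /uv[s0 _] _; have [] := energy_at_derive p s0.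
have pE (s : R) (p : R * R) : 0 < s -> partial1of2 energy_at s p = - ricci_at s p.
  by move=> s0; rewrite /partial1of2 derive1E; have [_ ->] := energy_at_derive p s0.
have ge0 p : 0 <= K * weight p by rewrite mulr_ge0 // weight_ge0.
have iE (s : R) : `]t / 2, 2 * t[%classic s -> mu2.-integrable setT (EFin \o energy_at s).
  by move=> /uv[s0 _]; exact: energy_at_integrable.
have iG : mu2.-integrable setT (EFin \o (fun p => K * weight p)).
  apply: (@decay_integrable _ _ K).
    by move=> p; apply: cvgM; [exact: cvg_cst | exact: weight_continuous].
  by move=> p; rewrite ger0_norm.
have bE (s : R) (p : R * R) : `]t / 2, 2 * t[%classic s -> setT p -> `|partial1of2 energy_at s p| <= K * weight p.
  by move=> /uv[s0 sab] _; rewrite pE // normrN; exact: hK.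
have D := @derivable_under_integral R _ _ mu2 energy_at setT measurableT t _ _ tin iE dE _ ge0 iG bE.
have V := @differentiation_under_integral R _ _ mu2 energy_at setT measurableT t _ _ tin iE dE _ ge0 iG bE.
split; first exact: D.
rewrite -derive1E; apply: etrans V _.
have -> : partial1of2 energy_at t = (fun p => - 1 * ricci_at t p).
  by apply/funext => p; rewrite pE // mulN1r.
by rewrite RintegralZl // ?mulN1r //; exact: ricci_at_integrable.
Qed.

Lemma difference_eq0 (x a b : R) : x = a - b -> x = 0 -> b = 0 -> a = 0.
Proof. by move=> -> + b0; rewrite b0 subr0. Qed.

(** The two densities differ by d dbar of a function on the sphere. *)
Lemma ricci_integral_eq0 (h : I -> Cn -> R) t :
  hermitian_metric (anticanonical_bundle (M := M)) h -> 0 < t ->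
  \int[mu2]_p reC (density (chern_form h) u0 (xy p.1 p.2)) = 0 ->
  \int[mu2]_p ricci_at t p = 0.
Proof.
move=> hh t0 ch0.
have p0 := potential_PS hu0 (kg t0) hh; have p1 := potential_PS hu1 (kg t0) hh.
have pE (z : C) : z != 0 -> potential u0 (g t) h z = potential u1 (g t) h z^-1.
  by move=> z0; rewrite /potential glue.
have S := sphere_ddbar_integral p0 p1 pE; have iS := ddbar_integrable p0 p1 pE.
have e : \int[mu2]_p reC (density (chern_form h) u0 (xy p.1 p.2)) =
    \int[mu2]_p ricci_at t p - \int[mu2]_p reC (pz (pzb (potential u0 (g t) h)) (xy p.1 p.2)).
  rewrite -RintegralB //; last exact: ricci_at_integrable.
  apply: eq_Rintegral => p _; rewrite (potential_ddbar hu0 (kg t0) hh) reCB /ricci_at.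
  by rewrite opprB addrC subrK.
exact: difference_eq0 e ch0 S.
Qed.

Lemma chern_integrable (h : I -> Cn -> R) :
  hermitian_metric (anticanonical_bundle (M := M)) h ->
  mu2.-integrable setT (EFin \o (fun p => reC (density (chern_form h) u0 (xy p.1 p.2)))).
Proof.
move=> hh; have p0 := potential_PS hu0 (kg ltr01) hh; have p1 := potential_PS hu1 (kg ltr01) hh.
have pE (z : C) : z != 0 -> potential u0 (g 1) h z = potential u1 (g 1) h z^-1.
  by move=> z0; rewrite /potential glue.
have iS := ddbar_integrable p0 p1 pE.
have := integrableB measurableT (ricci_at_integrable ltr01) iS.
apply: eq_integrable => // p _ /=.
rewrite (potential_ddbar hu0 (kg ltr01) hh) reCB /ricci_at -EFinB.
by congr EFin; rewrite opprB addrC subrK.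
Qed.

(** The derivative of the area is minus the integral of the Ricci form. *)
Lemma area_constant (h : I -> Cn -> R) s t :
  hermitian_metric (anticanonical_bundle (M := M)) h ->
  \int[mu2]_p reC (density (chern_form h) u0 (xy p.1 p.2)) = 0 ->
  0 < s -> s <= t -> area t = area s.
Proof.
move=> hh ch0 s0 st; apply: toC_inj; symmetry.
apply: (@rdiff0_eq _ (fun r => toC (area r)) s t st) => r /andP[sr _].
have r0 := lt_le_trans s0 sr.
have := rdiff_toC (area_derive r0).
by rewrite (ricci_integral_eq0 hh r0 ch0) oppr0 toC0.
Qed.

End AreaOfSphere.

(** * The Laplacian of the logarithm of the energy *)

Section LogEnergy.
Context {R : realType}.
Local Notation C := (Cplx R).
Local Notation mu := (@lebesgue_measure R).
Local Notation mu2 := (mu \x mu)%E.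

Definition rhoC (z : C) : C := (1 + z * Num.conj z) * (1 + z * Num.conj z).

Lemma rhoCE z : rhoC z = toC (rho z).
Proof. by rewrite /rhoC mulconjE -toC1 -toCD -toCM /rho expr2. Qed.

Let pdiff_s (z : C) : pdiff (fun w => 1 + w * Num.conj w) z (Num.conj z) z.
Proof.
have := pdiffD (pdiff_cst z 1) (pdiffM (pdiff_id z) (pdiff_conj (pdiff_id z))).
by apply: pdiff_ext; rewrite ?conj0 ?conj1 ?mul1r ?mulr0 ?addr0 ?add0r ?mul0r ?mulr1 ?add0r.
Qed.

Lemma rhoC_PS k : PCk k setT rhoC.
Proof.
have h : PCk k (setT : set C) (fun z => 1 + z * Num.conj z) := PCkD openT (PCk_cst openT k 1) (PCkM openT (PCk_id openT k) (PCk_conj openT (PCk_id openT k))).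
have H := PCkM openT h h; exact: H.
Qed.

Lemma rhoC_pdiff (z : C) : pdiff rhoC z (2 * (1 + z * Num.conj z) * Num.conj z) (2 * (1 + z * Num.conj z) * z).
Proof.
have := pdiffM (pdiff_s z) (pdiff_s z); apply: pdiff_ext; ring.
Qed.

Lemma rhoC_ddbar (z : C) : pz (pzb rhoC) z = 2 + 4 * (z * Num.conj z).
Proof.
have N : \forall w \near z, 2 * ((1 + w * Num.conj w) * w) = pzb rhoC w.
  by apply: filterE => w; rewrite (pzbE (rhoC_pdiff w)) mulrA.
rewrite (pzE (pdiff_near N (pdiffZ 2 (pdiffM (pdiff_s z) (pdiff_id z))))); ring.
Qed.

(** The pointwise inequality behind dbar_log_ge, at a point with |z|^2 = r and p = rho:
    x is the energy, A the squared modulus of x_z, H its complex Hessian, and m the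
    real part of x_z times the conjugate of rho_z. *)
Lemma log_energy_inequality (x p r A B m H d k : R) :
  0 <= x -> 0 < p -> p = (1 + r) ^+ 2 -> 0 <= r -> 0 <= B -> 0 < d -> 0 <= k ->
  m ^+ 2 <= A * (4 * p * r) -> A <= B * x -> B - k * x ^+ 2 <= H ->
  x * (2 / (x * p + d) - k) <=
  (H * p + 2 * m + x * (2 + 4 * r)) / (x * p + d)
    - (p ^+ 2 * A + 2 * p * x * m + x ^+ 2 * (4 * p * r)) / (x * p + d) ^+ 2.
Proof.
move=> x0 p0 pE r0 B0 d0 k0 mA AB BH.
have w0 : 0 < x * p + d by rewrite ltr_wpDl // mulr_ge0 // ltW.
(* By the two hypotheses on A, |2 m| is at most twice the geometric mean of B p and 4 x r. *)
have mB : 0 <= B * p + 2 * m + 4 * x * r.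
  have T0 : 0 <= B * p + 4 * x * r by rewrite addr_ge0 ?mulr_ge0 // ltW.
  have m2 : m ^+ 2 <= B * x * (4 * p * r).
    by apply: le_trans mA _; apply: ler_wpM2r => //; rewrite !mulr_ge0 // ltW.
  have : (2 * m) ^+ 2 <= (B * p + 4 * x * r) ^+ 2.
    have := sqr_ge0 (B * p - 4 * x * r); rewrite -subr_ge0 => h; rewrite -subr_ge0.
    apply: le_trans h _.
    have -> : (B * p + 4 * x * r) ^+ 2 - (2 * m) ^+ 2 = (B * p - 4 * x * r) ^+ 2 +
      4 * (B * x * (4 * p * r) - m ^+ 2) by ring.
    by rewrite subr0 lerDl; lra.
  have -> : B * p + 2 * m + 4 * x * r = (B * p + 4 * x * r) + 2 * m by ring.
  move: (B * p + 4 * x * r) T0 (2 * m) => T T0 m' h.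
  by rewrite leNgt; apply/negP => h'; nra.
rewrite -subr_ge0.
have -> : (H * p + 2 * m + x * (2 + 4 * r)) / (x * p + d)
    - (p ^+ 2 * A + 2 * p * x * m + x ^+ 2 * (4 * p * r)) / (x * p + d) ^+ 2
    - x * (2 / (x * p + d) - k) =
   ((H * p + 2 * m + x * (2 + 4 * r)) * (x * p + d)
    - (p ^+ 2 * A + 2 * p * x * m + x ^+ 2 * (4 * p * r))
    - x * (2 * (x * p + d) - k * (x * p + d) ^+ 2)) / (x * p + d) ^+ 2.
  by field; rewrite gt_eqF.
apply: divr_ge0; last by rewrite exprn_ge0 // ltW.
(* The hypotheses enter with nonnegative weights, whatever the sign of m. *)
have -> : (H * p + 2 * m + x * (2 + 4 * r)) * (x * p + d)
    - (p ^+ 2 * A + 2 * p * x * m + x ^+ 2 * (4 * p * r))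
    - x * (2 * (x * p + d) - k * (x * p + d) ^+ 2) =
  (H - B + k * x ^+ 2) * (p * (x * p + d)) + p ^+ 2 * (B * x - A)
   + d * (B * p + 2 * m + 4 * x * r) + k * x * (x * p + d) * d by ring.
rewrite !addr_ge0 ?mulr_ge0 ?exprn_ge0 //; lra.
Qed.

Lemma cabs_sum_sq (a b : C) (x p : R) : cabs (a * toC p + toC x * b) ^+ 2 =
  p ^+ 2 * cabs a ^+ 2 + 2 * p * x * reC (a * Num.conj b) + x ^+ 2 * cabs b ^+ 2.
Proof.
rewrite !sqr_cabs !reCD !imCD !reCM !imCM !reC_toC !imC_toC reC_conj imC_conj; ring.
Qed.

Lemma reC_log_ddbar (s N : C) (w : R) :
  reC (s / toC w + Num.conj N * (- toC w ^- 2 * N)) = reC s / w - cabs N ^+ 2 / w ^+ 2.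
Proof.
have -> : Num.conj N * (- toC w ^- 2 * N) = - (toC (w ^- 2) * (N * Num.conj N)).
  by rewrite toCV toCX; ring.
by rewrite mulconjE -toCM -toCV reCB reC_toC mulrC reCZ [w ^- 2 * _]mulrC [w^-1 * _]mulrC.
Qed.

Lemma reC_ddbar_sum (s a b z : C) (x p : R) :
  reC (s * toC p + Num.conj a * b + (a * Num.conj b + toC x * (2 + 4 * (z * Num.conj z)))) =
  reC s * p + 2 * reC (a * Num.conj b) + x * (2 + 4 * cabs z ^+ 2).
Proof.
have -> : toC x * (2 + 4 * (z * Num.conj z)) = toC (x * (2 + 4 * cabs z ^+ 2)).
  by rewrite mulconjE toCM toCD toCM !toC_nat.
rewrite !reCD reC_toC !reCM reC_conj imC_conj reC_conj imC_conj reC_toC imC_toC; ring.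
Qed.

Lemma real_valued_pz (E : C -> C) z : PCk 1 setT E -> (forall w, Num.conj (E w) = E w) ->
  pzb E z = Num.conj (pz E z).
Proof.
move=> hE re; have N : \forall w \near z, Num.conj (E w) = E w by apply: filterE.
exact: pzbE (pdiff_near N (pdiff_conj (PCk_pdiff hE (Logic.I : setT z)))).
Qed.

Variables (E : C -> C) (k d : R).
Hypotheses (hE : PCk 2 setT E) (k0 : 0 <= k) (d0 : 0 < d).
Hypothesis realE : forall z, E z = toC (reC (E z)) /\ 0 <= reC (E z).
Hypothesis bochner : forall z, exists2 B : R, 0 <= B &
  cabs (pz E z) ^+ 2 <= B * reC (E z) /\ B - k * reC (E z) ^+ 2 <= reC (pz (pzb E) z).

(** Up to a constant the squared norm of the differential of the curve for the
    Fubini-Study metric, a function on the sphere. *)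
Definition normalized (z : C) : C := E z * rhoC z.

(** dbar log (normalized + d). *)
Definition dbar_log (z : C) : C := pzb normalized z * (normalized z + toC d)^-1.

Let hN : PCk 2 setT normalized. Proof. have H := PCkM openT hE (rhoC_PS 2); exact: H. Qed.

Let conjE z : Num.conj (E z) = E z.
Proof. by have [-> _] := realE z; exact: conj_toC. Qed.

Let wE z : normalized z + toC d = toC (reC (E z) * rho z + d).
Proof. by rewrite /normalized rhoCE; have [-> _] := realE z; rewrite reC_toC -toCM -toCD. Qed.

Lemma regularised_ge_shift z : d <= reC (E z) * rho z + d.
Proof. by rewrite lerDr mulr_ge0 //; [have [] := realE z | exact: ltW (rho_gt0 z)]. Qed.

Let w0 z : 0 < reC (E z) * rho z + d.
Proof. exact: lt_le_trans d0 (regularised_ge_shift z). Qed.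

Let n0 z : normalized z + toC d != 0.
Proof. by rewrite wE toC_eq0 gt_eqF. Qed.

Let hV : PCk 2 setT (fun z => (normalized z + toC d)^-1).
Proof.
have h : PCk 2 (setT : set C) (fun z => normalized z + toC d) := PCkD openT hN (PCk_cst openT 2 (toC d)).
by have := PCkV openT (fun z _ => n0 z) h.
Qed.

Lemma dbar_log_PS : PCk 1 setT dbar_log.
Proof. have H := PCkM openT (PCk_pzb hN) (PCk_le hV); exact: H. Qed.

Let pzE_z z := PCk_pdiff hE (Logic.I : setT z).

Lemma dbar_log_ge z :
  reC (E z) * (2 / (reC (E z) * rho z + d) - k) <= reC (pz dbar_log z).
Proof.
have [B B0 [AB BH]] := bochner z; have [Er E0] := realE z.
pose a := pz E z; pose b := 2 * (1 + z * Num.conj z) * Num.conj z.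
have bE : Num.conj b = 2 * (1 + z * Num.conj z) * z.
  by rewrite /b !(conjM, conjD, conj1) conjCK [Num.conj z * z]mulrC.
have aE : pzb E z = Num.conj a := real_valued_pz z (PCk_le hE) conjE.
have dN := pdiffM (pzE_z z) (rhoC_pdiff z).
have pN : pz normalized z = a * rhoC z + E z * b by exact: pzE dN.
have pbN : pzb normalized z = Num.conj a * rhoC z + E z * Num.conj b.
  by rewrite bE -aE; exact: pzbE dN.
have ddN : pz (pzb normalized) z = pz (pzb E) z * rhoC z + Num.conj a * b +
    (a * Num.conj b + E z * (2 + 4 * (z * Num.conj z))).
  have N : \forall w \near z, pzb E w * rhoC w + E w * pzb rhoC w = pzb normalized w.
    apply: filterE => w; rewrite (pzbE (rhoC_pdiff w)); symmetry.
    exact: pzbE (pdiffM (pzE_z w) (rhoC_pdiff w)).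
  have hb := PCk_pdiff (PCk_pzb hE) (Logic.I : setT z).
  have hr := PCk_pdiff (PCk_pzb (rhoC_PS 2)) (Logic.I : setT z).
  have := pzE (pdiff_near N (pdiffD (pdiffM hb (rhoC_pdiff z)) (pdiffM (pzE_z z) hr))).
  by rewrite aE (pzbE (rhoC_pdiff z)) -bE rhoC_ddbar.
have dw := @pdiff_comp R (fun w => w^-1) (fun s => normalized s + toC d) z _ _ _ _ (pdiff_inv (n0 z)) (pdiffD (PCk_pdiff hN (Logic.I : setT z)) (pdiff_cst z (toC d))).
have := pzE (pdiffM (PCk_pdiff (PCk_pzb hN) (Logic.I : setT z)) dw).
rewrite -/dbar_log => ->.
rewrite mul0r !addr0 wE.
set w := reC (E z) * rho z + d.
set m := reC (a * Num.conj b).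
have Ez : E z = toC (reC (E z)) by [].
have b2 : cabs b ^+ 2 = 4 * rho z * cabs z ^+ 2.
  have -> : b = toC (2 * (1 + cabs z ^+ 2)) * Num.conj z.
    by rewrite /b mulconjE !(toCM, toCD, toC1).
  by rewrite cabsM cabs_conj exprMn cabs_toC real_normK ?num_real // /rho; ring.
have NE : cabs (pz normalized z) ^+ 2 = rho z ^+ 2 * cabs a ^+ 2 + 2 * rho z * reC (E z) * m
    + reC (E z) ^+ 2 * (4 * rho z * cabs z ^+ 2).
  by rewrite pN rhoCE Ez reC_toC cabs_sum_sq b2.
have S : pzb normalized z = Num.conj (pz normalized z).
  by rewrite pN pbN rhoCE conjD !conjM conjE conj_toC.
rewrite S reC_log_ddbar NE ddN rhoCE Ez reC_toC reC_ddbar_sum.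
apply: (log_energy_inequality (B := B)) => //; [exact: rho_gt0 | exact: sqr_ge0 |].
have -> : cabs a ^+ 2 * (4 * rho z * cabs z ^+ 2) = cabs (a * Num.conj b) ^+ 2.
  by rewrite cabsM cabs_conj exprMn b2.
by rewrite sqr_cabs lerDl sqr_ge0.
Qed.

End LogEnergy.

(** * Lower bounds of integrals by squares *)

Section Squares.
Context {R : realType}.
Local Notation mu := (@lebesgue_measure R).
Local Notation mu2 := (mu \x mu)%E.

Definition square (p : R * R) (r : R) : set (R * R) :=
  `[p.1 - r, p.1 + r]%classic `*` `[p.2 - r, p.2 + r]%classic.

Lemma square_measurable p r : measurable (square p r).
Proof. by apply: measurableX; exact: measurable_itv. Qed.

Lemma square_compact p r : compact (square p r).
Proof. by apply: compact_setX; exact: segment_compact. Qed.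

Lemma square_center p r : 0 <= r -> square p r p.
Proof. by move=> r0; split; rewrite /= in_itv /=; apply/andP; split; lra. Qed.

Lemma square_measure p r : 0 < r -> mu2 (square p r) = (4 * r ^+ 2)%:E.
Proof.
move=> r0; rewrite product_measure1E; [|exact: measurable_itv|exact: measurable_itv].
have side (a : R) : mu `[a - r, a + r]%classic = (2 * r)%:E.
  have ar : a - r < a + r by lra.
  by rewrite lebesgue_measure_itv /= lte_fin ar -EFinD; congr EFin; ring.
apply: etrans (congr2 (fun a b => a * b)%E (side p.1) (side p.2)) _.
by rewrite -EFinM; congr EFin; ring.
Qed.

Lemma nbhs_square (p : R * R) (A : set (R * R)) : nbhs p A -> exists2 r : R, 0 < r & square p r `<=` A.
Proof.
move=> /nbhs_ballP[e /= e0 he]; exists (e / 2); first by lra.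
move=> q [/=]; rewrite !in_itv /= => /andP[h1 h2] /andP[h3 h4].
by apply: he; split; rewrite /ball /= ltr_norml; apply/andP; split; lra.
Qed.

Lemma square_integral_ge (F : R * R -> R) p r m : 0 < r -> 0 <= m -> continuous F ->
  mu2.-integrable setT (EFin \o F) -> (forall q, 0 <= F q) ->
  (forall q, square p r q -> m <= F q) -> m * (4 * r ^+ 2) <= \int[mu2]_q F q.
Proof.
move=> r0 m0 cF iF F0 mF; have mS := square_measurable p r.
have iS : mu2.-integrable (square p r) (EFin \o F) by exact: integrableS iF.
have S1 : \int[mu2]_(q in square p r) F q <= \int[mu2]_q F q.
  rewrite /Rintegral; apply: fine_le; [exact: integrable_fin_num | exact: integrable_fin_num |].
  apply: ge0_subset_integral => //; first by apply/measurable_EFinP; exact: continuous_measurable2.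
  by move=> q _; rewrite lee_fin.
apply: le_trans S1; have iM : mu2.-integrable (square p r) (EFin \o (fun=> m)).
  apply: le_integrable iS => //; first exact: measurable_cst.
  by move=> q Sq /=; rewrite lee_fin ger0_norm // (le_trans (mF q Sq)) // ler_norm.
have L := @le_Rintegral _ _ R mu2 (square p r) (fun=> m) F mS iM iS mF.
apply: le_trans L; have -> := @Rintegral_cst _ _ R mu2 (square p r) mS m.
by have e := congr1 (fun y => m * fine y) (square_measure p r0); rewrite -[X in X <= _]e.
Qed.

End Squares.

(** * The integrated curvature estimate *)

Section SphereEstimate.
Context {R : realType} {n : nat} {X : topologicalType}.
Local Notation C := (Cplx R).
Local Notation Cn := 'rV[C]_n.
Local Notation mu := (@lebesgue_measure R).
Local Notation mu2 := (mu \x mu)%E.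
Variable M : complex_manifold R n X.
Local Notation I := (cindex M).
Variables (u0 u1 : C -> X) (hu0 : holomorphic_curve M u0) (hu1 : holomorphic_curve M u1).
Hypothesis glue : forall w, w != 0 -> u0 w = u1 w^-1.
Variables (gX : I -> Cn -> 'M[C]_n) (g : R -> I -> Cn -> 'M[C]_n) (flow : kahler_ricci_flow gX g).

Let kg t : 0 < t -> kahler_metric (g t).
Proof. by case: flow => H _ _ _ /ltW; exact: H. Qed.

Lemma rho_plane_continuous : continuous (fun p : R * R => rho (xy p.1 p.2)).
Proof.
have -> : (fun p : R * R => rho (xy p.1 p.2)) = (fun p => reC (rhoC (xy p.1 p.2))).
  by apply/funext => p; rewrite rhoCE reC_toC.
by apply: plane_continuous => z; exact: (PCk_continuous (rhoC_PS 0) Logic.I).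
Qed.

Lemma energy_at_ge0 t p : 0 < t -> 0 <= energy_at u0 g t p.
Proof. by move=> t0; have [] := density_real hu0 (kg t0) (xy p.1 p.2). Qed.

Definition regularised t (d : R) (p : R * R) : R :=
  energy_at u0 g t p * rho (xy p.1 p.2) + d.

Lemma regularised_ge t d p : 0 < t -> d <= regularised t d p.
Proof. by move=> t0; rewrite lerDr mulr_ge0 ?energy_at_ge0 // ltW // rho_gt0. Qed.

Lemma quotient_continuous t d : 0 < t -> 0 < d ->
  continuous (fun p => energy_at u0 g t p * (2 / regularised t d p)).
Proof.
move=> t0 d0 p; have cE := energy_at_continuous hu0 flow t0.
apply: cvgM; first exact: cE.
apply: cvgM; first exact: cvg_cst.
apply: cvgV; first by rewrite gt_eqF // (lt_le_trans d0) // regularised_ge.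
apply: cvgD; last exact: cvg_cst.
by apply: cvgM; [exact: cE | exact: rho_plane_continuous].
Qed.

Lemma quotient_integrable t d : 0 < t -> 0 < d ->
  mu2.-integrable setT (EFin \o (fun p => energy_at u0 g t p * (2 / regularised t d p))).
Proof.
move=> t0 d0; have [K K0 hK] := energy_at_bound hu0 hu1 glue flow t t0.
apply: (@decay_integrable _ _ (K * (2 / d)) (quotient_continuous t0 d0)) => p.
have w0 : 0 < regularised t d p := lt_le_trans d0 (regularised_ge d p t0).
rewrite normrM mulrAC; apply: ler_pM => //; first by apply: hK; rewrite lexx.
rewrite ger0_norm ?divr_ge0 ?(ltW w0) //; apply: ler_wpM2l => //.
by rewrite lef_pV2 ?posrE // regularised_ge.
Qed.

(** The integral of d dbar log (e + d) over the sphere vanishes; here only the bound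
    box_flux on the integrals over large squares enters. *)
Lemma quotient_integral_le t d k : 0 < t -> 0 < d -> 0 <= k ->
  (forall z, riemann_norm (g t (chart_at M (u0 z))) (chart (chart_at M (u0 z)) (u0 z)) <= k) ->
  \int[mu2]_p (energy_at u0 g t p * (2 / regularised t d p)) <= k * area u0 g t.
Proof.
move=> t0 d0 k0 rk.
pose E0 := density (g t) u0; pose E1 := density (g t) u1.
have h0 : PCk 2 setT E0 := density_PS hu0 (kg t0) 2.
have h1 : PCk 2 setT E1 := density_PS hu1 (kg t0) 2.
have re0 z : E0 z = toC (reC (E0 z)) /\ 0 <= reC (E0 z) := density_real hu0 (kg t0) z.
have bo z : exists2 B : R, 0 <= B &
    cabs (pz E0 z) ^+ 2 <= B * reC (E0 z) /\ B - k * reC (E0 z) ^+ 2 <= reC (pz (pzb E0) z).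
  have [B B0 [b1 b2]] := density_bochner hu0 (kg t0) z; exists B => //; split=> //.
  apply: le_trans b2; rewrite lerD2l lerN2; apply: ler_wpM2r; [exact: sqr_ge0 | exact: rk].
have N0 : PCk 1 setT (normalized E0) by have := PCkM openT (PCk_le h0) (rhoC_PS 1).
have N1 : PCk 1 setT (normalized E1) by have := PCkM openT (PCk_le h1) (rhoC_PS 1).
have NE (z : C) : z != 0 -> normalized E0 z = normalized E1 z^-1.
  move=> z0; rewrite /normalized !rhoCE rho_inv // /E0 (density_inversion _ hu1 hu0 glue z0).
  by rewrite mulrAC mulrC -toCM [_^-1 * _]mulrC.
have [K K0 hK] := sphere_flux_decay N0 N1 NE.
have hq := dbar_log_PS h0 d0 re0.
have decay z : 1 <= cabs z -> cabs (dbar_log E0 d z) <= K / d / cabs z ^+ 2.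
  move=> z1; rewrite /dbar_log cabsM cabsV mulrAC; apply: ler_pM => //; rewrite ?invr_ge0 ?cabs_ge0 //.
    exact: hK.
  have w0 := regularised_ge_shift d re0 z.
  rewrite /normalized rhoCE; have [-> _] := re0 z; rewrite -toCM -toCD cabs_toC.
  rewrite lef_pV2 ?posrE //; first exact: le_trans w0 (ler_norm _).
  by apply: lt_le_trans (ler_norm _); exact: lt_le_trans w0.
pose F p := energy_at u0 g t p * (2 / regularised t d p - k).
have FE p : F p = energy_at u0 g t p * (2 / regularised t d p) - k * energy_at u0 g t p.
  by rewrite /F mulrBr [k * _]mulrC.
have iQ := quotient_integrable t0 d0.
have iE := energy_at_integrable hu0 hu1 glue flow t0.
have ikE : mu2.-integrable setT (EFin \o (fun p => k * energy_at u0 g t p)).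
  have := integrableZl measurableT k iE.
  by apply: eq_integrable => // p _ /=.
have cF : continuous F.
  move=> p; rewrite (_ : F = fun p => energy_at u0 g t p * (2 / regularised t d p) - k * energy_at u0 g t p); last by apply/funext.
  apply: cvgB; first exact: (quotient_continuous t0 d0).
  by apply: cvgM; [exact: cvg_cst | exact: (energy_at_continuous hu0 flow t0)].
have iF : mu2.-integrable setT (EFin \o F).
  have := integrableB measurableT iQ ikE.
  by apply: eq_integrable => // p _ /=; rewrite FE EFinB.
have bF L : 1 <= L -> \int[mu2]_(p in box L) F p <= 4 * (K / d) / L.
  move=> L1; have cq : continuous (pz (dbar_log E0 d)) by move=> z; exact: (PCk_continuous (PCk_pz hq) Logic.I).
  apply: le_trans (le_trans (ler_norm _) (box_flux hq decay L1)).
  apply: (@le_Rintegral _ _ R mu2 (box L) F _ (box_measurable L) (@box_integrable _ F L cF)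
    (@box_integrable _ _ L (plane_continuous cq))).
  by move=> p _; exact: (dbar_log_ge h0 k0 d0 re0 bo).
have := Rintegral_le0_of_boxes cF iF bF.
have -> : \int[mu2]_p F p = \int[mu2]_p (energy_at u0 g t p * (2 / regularised t d p)) - k * area u0 g t.
  rewrite /area -RintegralZl // -RintegralB //.
  by apply: eq_Rintegral => p _; exact: FE.
by rewrite subr_le0.
Qed.

End SphereEstimate.

(** * The bound that is uniform in time, and the conclusion *)

Section UniformLowerBound.
Context {R : realType} {n : nat} {X : topologicalType}.
Local Notation C := (Cplx R).
Local Notation Cn := 'rV[C]_n.
Variable M : complex_manifold R n X.
Local Notation I := (cindex M).
Variables (u0 u1 : C -> X) (hu0 : holomorphic_curve M u0) (hu1 : holomorphic_curve M u1).
Hypothesis glue : forall w, w != 0 -> u0 w = u1 w^-1.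
Variables (gX : I -> Cn -> 'M[C]_n) (g : R -> I -> Cn -> 'M[C]_n) (flow : kahler_ricci_flow gX g).

Let kg t : 0 < t -> kahler_metric (g t).
Proof. by case: flow => H _ _ _ /ltW; exact: H. Qed.

Lemma quotient_lower_bound (x p N d : R) : 0 < x -> 0 < p -> p <= N -> 0 < d -> d <= x * p ->
  N^-1 <= x * (2 / (x * p + d)).
Proof.
move=> x0 p0 pN d0 dx; have N0 : 0 < N := lt_le_trans p0 pN.
have w0 : 0 < x * p + d by rewrite addr_gt0 // mulr_gt0.
rewrite -[N^-1]mul1r mulrA ler_pdivlMr // mulrAC ler_pdivrMr //; nra.
Qed.

(** The constant c comes from a square around z0 on which the velocity does not
    vanish, hence is the same for all metrics; d is the minimum of e over that square
    and depends on t. *)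
Lemma curvature_area_lower_bound z0 : velocity M u0 z0 != 0 ->
  exists2 c : R, 0 < c & forall t k, 0 < t -> 0 <= k ->
    (forall z, riemann_norm (g t (chart_at M (u0 z))) (chart (chart_at M (u0 z)) (u0 z)) <= k) ->
    c <= k * area u0 g t.
Proof.
move=> v0; pose p0 := (reC z0, imC z0).
have pos t q : 0 < t -> (0 < energy_at u0 g t q) = (velocity M u0 (xy q.1 q.2) != 0).
  by move=> t0; rewrite /energy_at (density_gt0 u0 (kg t0)).
have [r r0 hr] : exists2 r : R, 0 < r & square p0 r `<=` [set q | 0 < energy_at u0 g 1 q].
  have e0 : 0 < energy_at u0 g 1 p0 by rewrite (pos _ _ ltr01) /p0 xyE.
  apply: (@nbhs_square R p0 [set q | 0 < energy_at u0 g 1 q]).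
  apply: open_nbhs_nbhs; split; last exact: e0.
  apply: (@open_comp _ _ (energy_at u0 g 1) [set s | 0 < s]); last exact: open_gt.
  by move=> q _; exact: (energy_at_continuous hu0 flow ltr01).
have ne : square p0 r !=set0 by exists p0; apply: square_center; exact: ltW.
have cS := @square_compact _ p0 r.
have [q1 _ hq1] := compact_EVT_max ne cS (continuous_subspaceT (@rho_plane_continuous R)).
pose N := rho (xy q1.1 q1.2); have N0 : 0 < N by exact: rho_gt0.
exists (N^-1 * (4 * r ^+ 2)).
  by rewrite mulr_gt0 ?invr_gt0 // mulr_gt0 // exprn_gt0.
move=> t k t0 k0 rk; have cE := energy_at_continuous hu0 flow t0.
have cX : continuous (fun q : R * R => energy_at u0 g t q * rho (xy q.1 q.2)).
  by move=> q; apply: cvgM; [exact: cE | exact: rho_plane_continuous].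
have [q2 q2S hq2] := compact_EVT_min ne cS (continuous_subspaceT cX).
pose d := energy_at u0 g t q2 * rho (xy q2.1 q2.2).
have ep q : square p0 r q -> 0 < energy_at u0 g t q by move=> /hr /=; rewrite !pos.
have d0 : 0 < d by rewrite mulr_gt0 ?rho_gt0 //; apply: ep; exact: set_mem.
apply: le_trans (quotient_integral_le hu0 hu1 glue flow t0 d0 k0 rk).
apply: (@square_integral_ge _ _ p0 r N^-1 r0).
- by rewrite invr_ge0 ltW.
- exact: (quotient_continuous hu0 flow t0 d0).
- exact: (quotient_integrable hu0 hu1 glue flow t0 d0).
- move=> q; rewrite mulr_ge0 ?(energy_at_ge0 hu0 flow) // divr_ge0 // ltW //.
  by apply: lt_le_trans d0 _; exact: (regularised_ge hu0 flow).
move=> q Sq; apply: quotient_lower_bound => //; first exact: ep.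
- exact: rho_gt0.
- by apply: hq1; exact: mem_set.
- by apply: hq2; exact: mem_set.
Qed.

End UniformLowerBound.

Lemma real_bound_of_ereal_sup (R : realType) (S : set (\bar R)) :
  ereal_sup S <> +oo%E -> (exists r : R, S r%:E) -> exists K : R, forall r : R, S r%:E -> r <= K.
Proof.
move=> nS [r0 Sr0]; have ub r : S r%:E -> (r%:E <= ereal_sup S)%E by move=> ?; exact: ereal_sup_ubound.
case E : (ereal_sup S) nS => [s| |] // _.
- by exists s => r /ub; rewrite E lee_fin.
- by have := ub _ Sr0; rewrite E leeNy_eq.
Qed.

Lemma infinite_plane (R : realType) (A : set (CP1 (R := R))) : finite_set A ->
  exists z : Cplx R, ~ A (affine0 z).
Proof.
move=> fA; apply: contrapT => H.
have all z : A (affine0 z) by apply: contrapT => nA; apply: H; exists z.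
pose F (k : nat) := affine0 (toC k%:R : Cplx R).
have injF : {in F @^-1` A &, injective F} by move=> j k _ _ [/eqP]; rewrite eqr_nat => /eqP.
apply: infinite_nat; have := finite_preimage injF fA.
by have -> : F @^-1` A = setT by apply/seteqP; split=> // k _; exact: all.
Qed.

Theorem proposition1p4 (R : realType) (n : nat) (X : topologicalType)
    (M : complex_manifold R n X) (compactX : compact [set: X]%classic)
    (gX : cindex M -> 'rV[Cplx R]_n -> 'M[Cplx R]_n)
    (kahlerX : kahler_metric gX)
    (nefKX : nef gX (canonical_bundle (M := M)))
    (C : set X) (f : CP1 (R := R) -> X)
    (curveC : rational_curve M f C)
    (c1C : c1_integral_is M f 0%R)
    (g : R -> cindex M -> 'rV[Cplx R]_n -> 'M[Cplx R]_n)
    (flow : kahler_ricci_flow gX g) :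
  type_IIb g.
Proof.
case: curveC => -[hu0 hu1] _ [T [_ finT _ imm]] _.
have glue (w : Cplx R) : w != 0 -> (f \o affine0) w = (f \o affine1) w^-1.
  by move=> w0; rewrite /= /affine1 invr_eq0 (negbTE w0) invrK.
case: c1C => h hh c1.
have iC := chern_integrable hu0 hu1 glue flow hh.
have ch0 : (\int[(lebesgue_measure \x lebesgue_measure)%E]_p
    reC (density (chern_form h) (f \o affine0) (xy p.1 p.2)) = 0)%R.
  have pb : pullback_integral f (chern_form h) = 0.
    apply/eqP; have /esym/eqP := c1; rewrite mulf_eq0 invr_eq0 mulf_eq0 pnatr_eq0 /= gt_eqF ?pi_gt0 //.
  have e := RintegralZl 2 measurableT iC.
  have e2 : pullback_integral f (chern_form h) =
    (\int[(lebesgue_measure \x lebesgue_measure)%E]_p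
      (2 * reC (density (chern_form h) (f \o affine0) (xy p.1 p.2))))%R.
    apply: eq_Rintegral => p _; rewrite /density.
    have -> : xy p.1 p.2 = (p.1 +i* p.2)%C by apply: Cext; rewrite ?reC_xy ?imC_xy.
    by [].
  have : (2 * \int[(lebesgue_measure \x lebesgue_measure)%E]_p
      reC (density (chern_form h) (f \o affine0) (xy p.1 p.2)) = 0)%R.
    exact: etrans (esym e) (etrans (esym e2) pb).
  by move=> /eqP; rewrite mulf_eq0 pnatr_eq0 /= => /eqP.
(* Birationality provides a point of the affine chart where the velocity does not vanish. *)
have [z0 nz0] := infinite_plane finT.
have [v0 _] := imm z0.
have [c c0 lower] := curvature_area_lower_bound hu0 hu1 glue flow (v0 nz0).
apply: contrapT => nIIb.
have [K hK] := real_bound_of_ereal_sup nIIb (ex_intro _ _ (ex_intro _ 0 (ex_intro _ (f None) (conj (lexx 0) erefl)))).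
pose A := area (f \o affine0) g 1; pose K' := `|K|.
have A0 : 0 <= A.
  apply: Rintegral_ge0 => p _; exact: (energy_at_ge0 hu0 flow).
have main t : 1 <= t -> c * t <= K' * A.
  move=> t1; have t0 : 0 < t by exact: lt_le_trans t1.
  have bound z : riemann_norm (g t (chart_at M ((f \o affine0) z)))
      (chart (chart_at M ((f \o affine0) z)) ((f \o affine0) z)) <= K' / t.
    rewrite ler_pdivlMr // mulrC; apply: le_trans (ler_norm K).
    by apply: hK; exists t, ((f \o affine0) z); split=> //; exact: ltW.
  have kt : 0 <= K' / t by rewrite divr_ge0 ?normr_ge0 // ltW.
  have := lower t _ t0 kt bound.
  rewrite (area_constant hu0 hu1 glue flow hh ch0 ltr01 t1) -/A mulrAC ler_pdivlMr //.
have KA : 0 <= K' * A / c by rewrite divr_ge0 ?mulr_ge0 ?normr_ge0 // ltW.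
(* At this time the area bound K' A / t is smaller than c. *)
have := main (K' * A / c + 1); rewrite lerDr KA => /(_ isT).
rewrite mulrDr mulr1 mulrC divfK ?gt_eqF // -subr_ge0 opprD addrA subrr sub0r oppr_ge0 leNgt c0 //.
Qed.
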